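(* Let $\alpha\in(0,2]$. There exist a constant $C(\alpha)>0$ depending only on $\alpha$ and an absolute constant $C>0$ such that the following holds. Let $B\in\mathbb{R}^{l\times m}$ be a fixed matrix and let $A\in\mathbb{R}^{m\times n}$ be a random matrix with zero mean whose rows are independent, isotropic, and have $\psi_\alpha$-norm (quasi-norm when $\alpha<1$) uniformly bounded by $K$. Let $T\subset\mathbb{R}^n$ be a bounded set. Then $$\mathbb{E}\sup_{x\in T}\Bigl|\|BAx\|_2-\|B\|_{HS}\|x\|_2\Bigr|\le C(\alpha)K^{4/\alpha}\|B\|_{op}\bigl(\gamma_\alpha(T)+\mathrm{rad}(T)\bigr).$$ Moreover, for any $u\ge 0$, with probability at least $1-C\exp(-u^\alpha)$, $$\sup_{x\in T}\Bigl|\|BAx\|_2-\|B\|_{HS}\|x\|_2\Bigr|\le C(\alpha)K^{4/\alpha}\|B\|_{op}\bigl(\gamma_\alpha(T)+u\cdot\mathrm{rad}(T)\bigr).$$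
   Context: For a real random variable $\xi$ and $\alpha>0$, $\|\xi\|_{\psi_\alpha}:=\inf\{t>0:\mathbb{E}\exp(|\xi/t|^\alpha)\le 2\}$. For a random vector $\xi$ in $\mathbb{R}^n$, $\|\xi\|_{\psi_\alpha}:=\sup_{x\in S^{n-1}}\|\langle\xi,x\rangle\|_{\psi_\alpha}$. A random vector $X$ in $\mathbb{R}^n$ is isotropic if $\mathbb{E}XX^\top=I_n$. $\|\cdot\|_{HS}$ and $\|\cdot\|_{op}$ are the Hilbert–Schmidt (Frobenius) and operator norms of a matrix. $\mathrm{rad}(T):=\sup_{t\in T}\|t\|_2$. Talagrand's functional: an admissible sequence of partitions of $T$ is an increasing sequence $(\mathcal{A}_k)_{k\ge0}$ of partitions of $T$ (each $\mathcal{A}_{k+1}$ refines $\mathcal{A}_k$) with $|\mathcal{A}_0|=1$ and $|\mathcal{A}_k|\le 2^{2^k}$ for $k\ge1$. For $t\in T$, $A_k(t)$ is the unique element of $\mathcal{A}_k$ containing $t$. Then $$\gamma_\alpha(T):=\inf\sup_{t\in T}\sum_{k\ge0}2^{k/\alpha}\Delta(A_k(t)),$$ where the infimum is over all admissible sequences and $\Delta(S)=\sup_{s,t\in S}\|s-t\|_2$ is the Euclidean diameter. *)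

(* Defs.v *)
From mathcomp Require Import all_boot all_order all_algebra.
From mathcomp Require Import all_classical all_reals all_analysis.

Set Implicit Arguments.
Unset Strict Implicit.
Unset Printing Implicit Defensive.

Import Order.TTheory GRing.Theory Num.Theory.
Import numFieldNormedType.Exports.

Local Open Scope classical_set_scope.
Local Open Scope card_scope.
Local Open Scope ring_scope.

(* The library norm `|v| on 'cV[R]_n is the maximum norm, hence the separate
   definition of the Euclidean norm. *)
Definition l2norm (R : realType) (n : nat) (v : 'cV[R]_n) : R :=
  Num.sqrt (\sum_(i < n) v i 0 ^+ 2).

Definition dotp (R : realType) (n : nat) (u v : 'cV[R]_n) : R :=
  \sum_(i < n) u i 0 * v i 0.

Definition hs_norm (R : realType) (l m : nat) (B : 'M[R]_(l, m)) : R :=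
  Num.sqrt (\sum_(i < l) \sum_(j < m) B i j ^+ 2).

(* Supremum over the closed unit ball, which unlike the sphere is nonempty
   when m = 0. *)
Definition op_norm (R : realType) (l m : nat) (B : 'M[R]_(l, m)) : R :=
  sup [set l2norm (B *m x) | x in [set x : 'cV[R]_m | l2norm x <= 1]].

Section random_vectors.
Context (d : measure_display) (Omega : measurableType d) (R : realType).
Variable P : probability Omega R.

(* Extended real valued: +oo when no t is admissible. *)
Definition psi_norm (alpha : R) (xi : Omega -> R) : \bar R :=
  ereal_inf [set t%:E | t in [set t : R | 0 < t /\
    (\int[P]_w (expR (`|xi w / t| `^ alpha))%:E <= 2%:E)%E]].

Definition psi_norm_vec (alpha : R) (n : nat) (xi : Omega -> 'cV[R]_n) :
    \bar R :=
  ereal_sup [set psi_norm alpha (fun w => dotp (xi w) x) |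
             x in [set x : 'cV[R]_n | l2norm x = 1]].

Definition isotropic (n : nat) (X : Omega -> 'cV[R]_n) : Prop :=
  forall j k : 'I_n,
    ('E_P[fun w => (X w *m (X w)^T) j k] = ((1%:M : 'M[R]_n) j k)%:E)%E.

Definition random_matrix (m n : nat) (A : Omega -> 'M[R]_(m, n)) : Prop :=
  forall i j, measurable_fun [set: Omega] (fun w => A w i j).

Definition zero_mean (m n : nat) (A : Omega -> 'M[R]_(m, n)) : Prop :=
  forall i j, ('E_P[fun w => A w i j] = 0)%E.

Definition row_vec (m n : nat) (A : Omega -> 'M[R]_(m, n)) (i : 'I_m) :
    Omega -> 'cV[R]_n :=
  fun w => (row i (A w))^T.

Definition borel (n : nat) : set (set 'cV[R]_n) :=
  <<s [set U : set 'cV[R]_n | open U] >>.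

Definition independent_vectors (m n : nat)
    (X : 'I_m -> Omega -> 'cV[R]_n) : Prop :=
  forall (J : {set 'I_m}) (E : 'I_m -> set 'cV[R]_n),
    (forall i, @borel n (E i)) ->
    P (\bigcap_(i in [set i | i \in J]) (X i @^-1` E i)) =
    (\prod_(i in J) P (X i @^-1` E i))%E.

End random_vectors.

Section talagrand_functional.
Context (R : realType) (n : nat).
Implicit Types (T S : set 'cV[R]_n) (A : nat -> set (set 'cV[R]_n)).

Definition rad_set T : \bar R := ereal_sup [set (l2norm t)%:E | t in T].

Definition diameter S : \bar R :=
  ereal_sup [set (l2norm (s - t))%:E | s in S & t in S].

Definition admissible T A : Prop :=
  [/\ forall k, partition (A k) id T,
      forall k S, A k.+1 S -> exists2 S', A k S' & S `<=` S',
      A 0%N #= `I_1 &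
      forall k, (1 <= k)%N -> A k #<= `I_(2 ^ (2 ^ k))].

(* [pblock (A k) id t] is the cell of the partition [A k] containing [t]. *)
Definition talagrand_gamma (alpha : R) T : \bar R :=
  ereal_inf [set ereal_sup
      [set (\sum_(0 <= k <oo)
              (2 `^ (k%:R / alpha))%:E * diameter (pblock (A k) id t))%E | t in T]
    | A in admissible T].

End talagrand_functional.

Definition sup_dev (R : realType) (l m n : nat) (B : 'M[R]_(l, m))
    (A : 'M[R]_(m, n)) (T : set 'cV[R]_n) : \bar R :=
  ereal_sup [set `|l2norm (B *m A *m x) - hs_norm B * l2norm x|%:E | x in T].

(* Main.v *)
(* Let Z x = |BAx| - |B|_HS |x|. The increments satisfy
   E (Z x - Z y)^(2q) <= (C K^2 |B|_op q^(1/alpha) |x - y|)^(2q) for all q >= 1, and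
   generic chaining turns such bounds into both conclusions: with
   c = C K^2 |B|_op, chaining from level k0 on gives, uniformly in x,
   |Z x| <= c (2^(k0/alpha) rad T + gamma) (1 + W) with E W <= 2 exp(-2^(k0+1)). The
   expectation bound is k0 = 0; the tail bound is Markov's inequality for W
   with 2^k0 <= u^alpha < 2^(k0+1).

   The increment bound comes from a Hanson-Wright inequality for the moments of
   |BAx|^2 - |B|_HS^2, |x| = 1, together with polarization. The diagonal part of
   this chaos is a sum of independent centred variables. The off-diagonal part
   is decoupled: it is an average over index sets I of forms that are linear in
   the coordinates inside I, so its 2q-th moment is controlled by that of
   |B v|^2 with v supported outside I, that is by the same quadratic form on
   fewer coordinates. The maximum of the moments over all index sets therefore
   satisfies X <= a + b sqrt X. *)
Require Import Defs.
From mathcomp Require Import all_boot all_order all_algebra.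
From mathcomp Require Import all_classical all_reals all_analysis.
From mathcomp Require Import measurable_realfun.
From mathcomp Require Import ring lra zify.
Set Implicit Arguments.
Unset Strict Implicit.
Unset Printing Implicit Defensive.
Import Order.TTheory GRing.Theory Num.Theory.
Import numFieldNormedType.Exports.
Local Open Scope classical_set_scope.
Local Open Scope ring_scope.

(** * Moments and independence *)

Section Moments.
Context d (Omega : measurableType d) (R : realType) (P : probability Omega R).
Implicit Types f g : Omega -> R.

(** For alpha < 1 a psi_alpha variable may have no exponential moments, and the quasi-norm is not a
    norm. Every estimate is therefore made at one even order 2q, with constants that do not depend
    on q. The square of the growth rate r^(1/alpha) exceeds the subgaussian rate r by the factor
    r^(2/alpha - 1), whose exponent is nonnegative because alpha <= 2. Up to the top order this
    factor is at most its value there; once it is frozen at that value, the variable is subgaussian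
    and its square subexponential up to the order in use. The price is a power of q, which
    recombines with the classical rates into q^(1/alpha). At q = 2^(k+1) this is, up to a constant,
    the weight 2^(k/alpha) of Talagrand's functional.

    Independence is used through mixed moments of polynomials in the projections of the rows.
    Conditioning on some of the coordinates is then a regrouping of a finite expansion, carried out
    on the given probability space. *)

Definition Ex f : R := \int[P]_w f w.

Definition intg f := P.-integrable setT (EFin \o f).

(** Unlike plain integrability, this class is stable under products as well as sums, so
    integrability of polynomial expressions follows structurally. *)
Definition all_moments f :=
  measurable_fun setT f /\ forall k, intg (fun w => f w ^+ k).

Lemma intg_dom f g : measurable_fun setT f -> intg g ->
  (forall w, `|f w| <= g w) -> intg f.
Proof.
move=> mf ig fg; apply: le_integrable ig => //.
  exact/measurable_EFinP.
move=> w _ /=; rewrite lee_fin; apply: le_trans (fg w) _; exact: ler_norm.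
Qed.

Lemma intg_cst c : intg (fun=> c).
Proof. exact: finite_measure_integrable_cst. Qed.

Lemma intgD f g : intg f -> intg g -> intg (fun w => f w + g w).
Proof.
move=> h1 h2; rewrite /intg.
rewrite (_ : EFin \o _ = (EFin \o f) \+ (EFin \o g))%E; last exact/funext.
exact: integrableD.
Qed.

Lemma intgZ c f : intg f -> intg (fun w => c * f w).
Proof.
move=> h; rewrite /intg.
rewrite (_ : EFin \o _ = (fun w => c%:E * (EFin \o f) w))%E; last exact/funext.
exact: integrableZl.
Qed.

Lemma intg_abs f : intg f -> intg (fun w => `|f w|).
Proof. by move=> h; exact: integrable_norm h. Qed.

Lemma ExD f g : intg f -> intg g -> Ex (fun w => f w + g w) = Ex f + Ex g.
Proof. by move=> *; exact: RintegralD. Qed.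

Lemma ExZ c f : intg f -> Ex (fun w => c * f w) = c * Ex f.
Proof. by move=> *; exact: RintegralZl. Qed.

Lemma Ex_cst c : Ex (fun=> c) = c.
Proof.
rewrite /Ex Rintegral_cst// -[RHS]mulr1; congr (_ * _).
by rewrite -[RHS]/(fine 1); congr fine; exact: probability_setT.
Qed.

Lemma Ex_le f g : intg f -> intg g -> (forall w, f w <= g w) -> Ex f <= Ex g.
Proof. by move=> ? ? fg; apply: le_Rintegral => // w _; exact: fg. Qed.

Lemma Ex_ge0 f : (forall w, 0 <= f w) -> 0 <= Ex f.
Proof. by move=> f0; apply: Rintegral_ge0 => w _; exact: f0. Qed.

Lemma Ex_abs f : intg f -> `|Ex f| <= Ex (fun w => `|f w|).
Proof. by move=> fi; exact: le_normr_Rintegral. Qed.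

Lemma Ex_EFin f : intg f -> (\int[P]_w (f w)%:E)%E = (Ex f)%:E.
Proof.
move=> fi; rewrite /Ex /Rintegral fineK//; exact: integrable_fin_num.
Qed.

Lemma intg_sum I (s : seq I) (p : pred I) (F : I -> Omega -> R) :
  (forall i, p i -> intg (F i)) -> intg (fun w => \sum_(i <- s | p i) F i w).
Proof.
move=> h; elim: s => [|i s ih].
  by under eq_fun do rewrite big_nil; exact: intg_cst.
under eq_fun do rewrite big_cons.
by case: (boolP (p i)) => [/h ?|_] //; exact: intgD.
Qed.

Lemma Ex_sum I (s : seq I) (p : pred I) (F : I -> Omega -> R) :
  (forall i, p i -> intg (F i)) ->
  Ex (fun w => \sum_(i <- s | p i) F i w) = \sum_(i <- s | p i) Ex (F i).
Proof.
move=> h; elim: s => [|i s ih].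
  by rewrite big_nil; under eq_fun do rewrite big_nil; exact: Ex_cst.
rewrite big_cons; under eq_fun do rewrite big_cons.
case: (boolP (p i)) => [/h ?|_] //; rewrite -ih ExD//; exact: intg_sum.
Qed.

Lemma all_moments_meas f : all_moments f -> measurable_fun setT f.
Proof. by case. Qed.

Lemma all_moments_intg f : all_moments f -> intg f.
Proof. by move=> [_ /(_ 1%N)]; under eq_fun do rewrite expr1. Qed.

Lemma all_moments_intgX f k : all_moments f -> intg (fun w => f w ^+ k).
Proof. by case. Qed.

Lemma all_momentsP f : measurable_fun setT f ->
  (forall k, intg (fun w => `|f w| ^+ k)) -> all_moments f.
Proof.
move=> mf h; split=> // k.
apply: intg_dom (h k) _ => [|w]; last by rewrite normrX.
exact: measurable_funX.
Qed.

Lemma all_moments_abs f : all_moments f -> all_moments (fun w => `|f w|).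
Proof.
move=> [mf h]; apply: all_momentsP.
  exact: measurableT_comp.
move=> k; under eq_fun do rewrite normr_id -normrX.
exact: intg_abs.
Qed.

Lemma all_moments_dom f g : measurable_fun setT f -> all_moments g ->
  (forall w, `|f w| <= g w) -> all_moments f.
Proof.
move=> mf [mg h] fg; apply: all_momentsP => // k.
apply: intg_dom (h k) _ => [|w].
  by apply: measurable_funX; exact: measurableT_comp.
rewrite normrX normr_id; apply: lerXn2r; rewrite ?nnegrE//.
exact: le_trans (fg w).
Qed.

Lemma all_moments_cst c : all_moments (fun=> c).
Proof. by split=> // k; exact: intg_cst. Qed.

Lemma all_momentsX f k : all_moments f -> all_moments (fun w => f w ^+ k).
Proof.
move=> [mf h]; split; first exact: measurable_funX.
by move=> j; under eq_fun do rewrite -exprM.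
Qed.

Lemma all_momentsM f g : all_moments f -> all_moments g ->
  all_moments (fun w => f w * g w).
Proof.
move=> hf hg; apply: all_momentsP.
  by apply: measurable_funM; [exact: hf.1|exact: hg.1].
move=> k.
have h : intg (fun w => f w ^+ (2 * k) + g w ^+ (2 * k)).
  by apply: intgD; [exact: hf.2|exact: hg.2].
apply: intg_dom h _ => [|w].
  apply: measurable_funX; apply: measurableT_comp => //.
  by apply: measurable_funM; [exact: hf.1|exact: hg.1].
rewrite normrX normr_id normrM exprMn !exprM ![(_ ^+ 2) ^+ k]exprAC.
rewrite -[f w ^+ k ^+ 2]real_normK ?num_real// -[g w ^+ k ^+ 2]real_normK ?num_real//.
rewrite !normrX; set a := _ ^+ k; set b := `|g w| ^+ k.
have := sqr_ge0 (a - b); have := sqr_ge0 (a + b); nra.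
Qed.

Lemma all_momentsD f g : all_moments f -> all_moments g ->
  all_moments (fun w => f w + g w).
Proof.
move=> hf hg; apply: all_momentsP.
  by apply: measurable_funD; [exact: hf.1|exact: hg.1].
move=> k.
have h : intg (fun w => 2 ^+ k * `|f w| ^+ k + 2 ^+ k * `|g w| ^+ k).
  by apply: intgD; apply: intgZ; apply: all_moments_intgX; exact: all_moments_abs.
apply: intg_dom h _ => [|w].
  apply: measurable_funX; apply: measurableT_comp => //.
  by apply: measurable_funD; [exact: hf.1|exact: hg.1].
rewrite normrX normr_id.
apply: (@le_trans _ _ ((`|f w| + `|g w|) ^+ k)).
  by apply: lerXn2r; rewrite ?nnegrE ?addr_ge0// ler_normD.
rewrite -!exprMn.
have [ab|/ltW ab] := lerP `|f w| `|g w|.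
- apply: (@le_trans _ _ ((2 * `|g w|) ^+ k)).
    by apply: lerXn2r; rewrite ?nnegrE ?addr_ge0 ?mulr_ge0//; lra.
  by rewrite lerDr exprn_ge0// mulr_ge0.
- apply: (@le_trans _ _ ((2 * `|f w|) ^+ k)).
    by apply: lerXn2r; rewrite ?nnegrE ?addr_ge0 ?mulr_ge0//; lra.
  by rewrite lerDl exprn_ge0// mulr_ge0.
Qed.

Lemma all_momentsZ c f : all_moments f -> all_moments (fun w => c * f w).
Proof. by apply: all_momentsM; exact: all_moments_cst. Qed.

Lemma all_momentsB f g : all_moments f -> all_moments g ->
  all_moments (fun w => f w - g w).
Proof.
move=> hf hg; under eq_fun do rewrite -mulN1r.
by apply: all_momentsD => //; exact: all_momentsZ.
Qed.

Lemma all_moments_sum I (s : seq I) (p : pred I) (F : I -> Omega -> R) :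
  (forall i, p i -> all_moments (F i)) ->
  all_moments (fun w => \sum_(i <- s | p i) F i w).
Proof.
move=> h; elim: s => [|i s ih].
  by under eq_fun do rewrite big_nil; exact: all_moments_cst.
under eq_fun do rewrite big_cons.
by case: (boolP (p i)) => [/h ?|_] //; exact: all_momentsD.
Qed.

Lemma all_moments_prod I (s : seq I) (p : pred I) (F : I -> Omega -> R) :
  (forall i, p i -> all_moments (F i)) ->
  all_moments (fun w => \prod_(i <- s | p i) F i w).
Proof.
move=> h; elim: s => [|i s ih].
  by under eq_fun do rewrite big_nil; exact: all_moments_cst.
under eq_fun do rewrite big_cons.
by case: (boolP (p i)) => [/h ?|_] //; exact: all_momentsM.
Qed.

Lemma Ex_sqr_le f : all_moments f -> Ex f ^+ 2 <= Ex (fun w => f w ^+ 2).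
Proof.
move=> hf; have : 0 <= Ex (fun w => (f w - Ex f) ^+ 2).
  by apply: Ex_ge0 => w; exact: sqr_ge0.
rewrite (_ : (fun w => _) =
  fun w => f w ^+ 2 + ((- 2 * Ex f) * f w + Ex f ^+ 2)); last first.
  by apply/funext => w; ring.
have i1 := all_moments_intg hf; have i2 := all_moments_intgX 2 hf.
have i3 : intg (fun w => - 2 * Ex f * f w) by exact: intgZ.
rewrite ExD//; last by apply: intgD => //; exact: intg_cst.
rewrite ExD//; last exact: intg_cst.
rewrite ExZ// Ex_cst; nra.
Qed.

End Moments.

Import HBNNSimple.

(** * From independent events to expectations of products *)

Section Independence.
Context d (Omega : measurableType d) (R : realType) (P : probability Omega R).
Local Notation E := (Ex P).

Lemma simple_approximation (f : R -> R) : measurable_fun setT f ->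
  (forall x, 0 <= f x) -> exists g : nat -> R -> R,
  [/\ forall n, exists (N : nat) (a : 'I_N -> R) (A : 'I_N -> set R),
        (forall i, measurable (A i)) /\
        forall x, g n x = \sum_(i < N) a i * \1_(A i) x,
      forall n x, 0 <= g n x <= f x &
      forall x, g n x @[n --> \oo] --> f x].
Proof.
move=> mf f0; have mf' : measurable_fun setT (EFin \o f) by exact/measurable_EFinP.
pose g n : R -> R := nnsfun_approx (@measurableT _ R) mf' n.
exists g; split.
- move=> n; do 3 eexists; split; last by move=> x; exact: fimfunEord.
  by move=> i; exact: measurable_funPTI.
- move=> n x; apply/andP; split; first exact: fun_ge0.
  rewrite -lee_fin /g nnsfun_approxE.
  by apply: (le_approx (f := EFin \o f)) => // y _; rewrite lee_fin.
- move=> x; have : EFin \o (fun n => g n x) @ \oo --> (EFin \o f) x.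
    by apply: cvg_nnsfun_approx => // y _; rewrite lee_fin.
  by move/fine_cvg.
Qed.

Lemma Ex_cvg (F : nat -> Omega -> R) (f g : Omega -> R) :
  (forall n, measurable_fun setT (F n)) -> measurable_fun setT f ->
  (forall w, F n w @[n --> \oo] --> f w) -> intg P g ->
  (forall n w, `|F n w| <= g w) -> E (F n) @[n --> \oo] --> E f.
Proof.
move=> mF mf Ff ig Fg.
have [|||||_ _] := @dominated_convergence _ _ _ P setT measurableT
  (fun n => EFin \o F n) (EFin \o f) (EFin \o g).
- by move=> n; exact/measurable_EFinP.
- exact/measurable_EFinP.
- apply/aeW => w _; apply: cvg_EFin => //; first exact: nearW.
  exact: Ff.
- exact: ig.
- by apply/aeW => w n _; rewrite lee_fin.
have fi : intg P f.
  apply: (intg_dom mf ig) => w.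
  have : `|F n w| @[n --> \oo] --> `|f w| by exact: cvg_norm.
  move=> c; rewrite -(cvg_lim _ c)//; apply: limr_le; first by apply/cvg_ex; eexists; exact: c.
  exact: nearW.
move=> c; rewrite -[E f]/(fine (E f)%:E) -Ex_EFin//.
apply: (@fine_cvg _ _ _ _ (fun n => \int[P]_w (EFin \o F n) w)%E) => //.
by move: c; rewrite Ex_EFin.
Qed.

(** The hypothesis is the case where [f] is an indicator. It extends to nonnegative [f] by simple
    approximation from below and dominated convergence, then to all [f] by positive and negative
    parts. Here [c] plays the role of the expectation of [W]. *)
Lemma Ex_mul_indep (W X : Omega -> R) (c : R) (f : R -> R) :
  all_moments P W -> measurable_fun setT X ->
  (forall A, measurable A ->
     E (fun w => W w * \1_A (X w)) = c * E (fun w => \1_A (X w))) ->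
  measurable_fun setT f -> all_moments P (f \o X) ->
  E (fun w => W w * f (X w)) = c * E (f \o X).
Proof.
move=> hW mX hA.
have hind A : measurable A -> all_moments P (fun w => \1_A (X w)).
  move=> mA; apply: (all_moments_dom (g := fun=> 1)); last 1 first.
  - by move=> w; rewrite ger0_norm indicE//; case: (_ \in _).
  - exact: measurableT_comp.
  - exact: all_moments_cst.
have pos (g : R -> R) : measurable_fun setT g -> (forall x, 0 <= g x) ->
    all_moments P (g \o X) ->
    E (fun w => W w * g (X w)) = c * E (g \o X).
  move=> mg g0 hg; have [G [Gs G0 Gg]] := simple_approximation mg g0.
  have mGX n : measurable_fun setT (G n \o X).
    have [N [a [A [mA GE]]]] := Gs n.
    rewrite (_ : G n = fun x => \sum_(i < N) a i * \1_(A i) x); last exact/funext.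
    by apply: measurable_sum => i; apply: all_moments_meas (all_momentsZ _ (hind _ _)).
  have EG n : E (fun w => W w * G n (X w)) = c * E (G n \o X).
    have [N [a [A [mA GE]]]] := Gs n.
    have hi i : all_moments P (fun w => W w * \1_(A i) (X w)).
      by apply: all_momentsM => //; exact: hind.
    rewrite (_ : (fun w => W w * G n (X w)) =
      fun w => \sum_(i < N) a i * (W w * \1_(A i) (X w))); last first.
      apply/funext => w; rewrite GE mulr_sumr; apply: eq_bigr => i _.
      by rewrite mulrCA.
    rewrite (_ : G n \o X = fun w => \sum_(i < N) a i * \1_(A i) (X w)); last first.
      by apply/funext => w /=; rewrite GE.
    rewrite !Ex_sum; last 2 first.
    - by move=> i _; apply: intgZ; exact: all_moments_intg (hind _ _).
    - by move=> i _; apply: intgZ; exact: all_moments_intg.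
    rewrite mulr_sumr; apply: eq_bigr => i _.
    rewrite ExZ; last exact: all_moments_intg.
    rewrite ExZ; last exact: all_moments_intg (hind _ _).
    by rewrite hA// mulrCA.
  have c1 : E (fun w => W w * G n (X w)) @[n --> \oo] --> E (fun w => W w * g (X w)).
    apply: (Ex_cvg (g := fun w => `|W w * g (X w)|)).
    - by move=> n; apply: measurable_funM; [exact: hW.1|exact: mGX].
    - by apply: measurable_funM; [exact: hW.1|exact: hg.1].
    - by move=> w; apply: cvgM => //; exact: cvg_cst.
    - by apply/intg_abs/all_moments_intg; exact: all_momentsM.
    - move=> n w; rewrite !normrM ler_wpM2l// !ger0_norm//; by have /andP[] := G0 n (X w).
  have c2 : E (G n \o X) @[n --> \oo] --> E (g \o X).
    apply: (Ex_cvg (g := g \o X)) => //.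
    - exact: hg.1.
    - by move=> w; exact: Gg.
    - exact: all_moments_intg.
    - move=> n w /=; rewrite ger0_norm//; by have /andP[] := G0 n (X w).
  have c3 : c * E (G n \o X) @[n --> \oo] --> c * E (g \o X) by apply: cvgM => //; exact: cvg_cst.
  move: c1; under eq_fun do rewrite EG.
  by move=> c1; exact: (cvg_unique _ c1 c3).
move=> mf hf.
pose fp x := Num.max (f x) 0; pose fn x := Num.max (- f x) 0.
have mfp : measurable_fun setT fp by exact: measurable_maxr.
have mfn : measurable_fun setT fn.
  by apply: measurable_maxr => //; exact: measurableT_comp.
have fE x : f x = fp x - fn x.
  rewrite /fp /fn /Num.max; case: (ltP (f x) 0) => ?; case: (ltP (- f x) 0) => ?; lra.
have dom (g : R -> R) : measurable_fun setT g -> (forall x, `|g x| <= `|f x|) ->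
    all_moments P (g \o X).
  move=> mg gf; apply: (all_moments_dom (g := fun w => `|f (X w)|)).
  - exact: measurableT_comp.
  - exact: all_moments_abs.
  - by move=> w; exact: gf.
have hp : all_moments P (fp \o X).
  apply: dom => // x; rewrite /fp /Num.max; case: ltP => _; last by [].
  by rewrite normr0.
have hn : all_moments P (fn \o X).
  apply: dom => // x; rewrite /fn /Num.max; case: ltP => _; last by rewrite normrN.
  by rewrite normr0.
have p0 x : 0 <= fp x by rewrite /fp le_max lexx orbT.
have n0 x : 0 <= fn x by rewrite /fn le_max lexx orbT.
have := pos _ mfp p0 hp; have := pos _ mfn n0 hn => e1 e2.
rewrite (_ : (fun w => _) = fun w => W w * fp (X w) + (- 1) * (W w * fn (X w))); last first.
  by apply/funext => w; rewrite (fE (X w)); ring.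
rewrite (_ : f \o X = fun w => (fp \o X) w + (- 1) * (fn \o X) w); last first.
  by apply/funext => w /=; rewrite (fE (X w)); ring.
have i1 : intg P (fun w => W w * fp (X w)) by apply/all_moments_intg/all_momentsM.
have i2 : intg P (fun w => W w * fn (X w)) by apply/all_moments_intg/all_momentsM.
have i3 := all_moments_intg hp; have i4 := all_moments_intg hn.
rewrite !ExD// ?ExZ//; [|exact: intgZ..].
by rewrite e1 e2; ring.
Qed.

Section family.
Variables (m : nat) (xi : 'I_m -> Omega -> R).
Hypothesis xi_moments : forall i, all_moments P (xi i).
Hypothesis xi_indep : forall F : 'I_m -> set R, (forall i, measurable (F i)) ->
  E (fun w => \prod_i \1_(F i) (xi i w)) = \prod_i E (fun w => \1_(F i) (xi i w)).

(** Indicators are exchanged for general functions one coordinate at a time: in the induction on [k]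
    the factors of index at least [k] are indicators, and [Ex_mul_indep] frees one more, with the
    product of the other factors as [W]. *)
Lemma Ex_prod_indep (F : 'I_m -> R -> R) :
  (forall i, measurable_fun setT (F i)) -> (forall i, all_moments P (F i \o xi i)) ->
  E (fun w => \prod_i F i (xi i w)) = \prod_i E (F i \o xi i).
Proof.
have H k : forall F : 'I_m -> R -> R,
  (forall i, measurable_fun setT (F i)) -> (forall i, all_moments P (F i \o xi i)) ->
  (forall i : 'I_m, (k <= i)%N -> exists2 A : set R, measurable A & F i = \1_A) ->
  E (fun w => \prod_i F i (xi i w)) = \prod_i E (F i \o xi i).
  elim: k => [G mG hG h|k ih G mG hG h].
    have /choice[A hA] : forall i, exists A : set R, measurable A /\ G i = \1_A.
      by move=> i; have [A ? ?] := h i (leq0n _); exists A.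
    rewrite (_ : (fun w => _) = fun w => \prod_i \1_(A i) (xi i w)); last first.
      by apply/funext => w; apply: eq_bigr => i _; rewrite (hA i).2.
    rewrite xi_indep; last by move=> i; exact: (hA i).1.
    by apply: eq_bigr => i _; rewrite (hA i).2.
  have [mk|km] := leqP m k.
    by apply: ih => // i ki; have := ltn_ord i; rewrite ltnNge (leq_trans mk ki).
  pose i0 := Ordinal km.
  rewrite (bigD1 i0)//=.
  rewrite (_ : (fun w => _) =
     fun w => (\prod_(i | i != i0) G i (xi i w)) * G i0 (xi i0 w)); last first.
    by apply/funext => w; rewrite (bigD1 i0)//= mulrC.
  rewrite [RHS]mulrC; apply: Ex_mul_indep => //.
  - by apply: all_moments_prod => i _; exact: hG.
  - by have [] := xi_moments i0.
  (* Putting the indicator of [A] at coordinate [i0] gives a family covered by the induction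
     hypothesis; this supplies the indicator case that [Ex_mul_indep] asks for. *)
  move=> A mA; pose G' i := if i == i0 then \1_A else G i.
  have hA : all_moments P (fun w => \1_A (xi i0 w)).
    apply: (all_moments_dom (g := fun=> 1)); last 1 first.
    - by move=> w; rewrite ger0_norm indicE//; case: (_ \in _).
    - by apply: measurableT_comp => //; have [] := xi_moments i0.
    - exact: all_moments_cst.
  have G'0 : G' i0 = \1_A by rewrite /G' eqxx.
  have G'N i : i != i0 -> G' i = G i by rewrite /G' => /negbTE ->.
  have e : E (fun w => \prod_i G' i (xi i w)) = \prod_i E (G' i \o xi i).
    apply: ih.
    - by move=> i; rewrite /G'; case: eqP.
    - by move=> i; rewrite /G'; case: eqP => [->|].
    - move=> i ki; rewrite /G'; case: eqVneq => [_|ii0]; first by exists A.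
      by apply: h; rewrite ltn_neqAle ki andbT; apply: contra ii0 => /eqP ?; apply/eqP/val_inj.
  transitivity (E (fun w => \prod_i G' i (xi i w))).
    congr (Ex P _); apply/funext => w; rewrite [RHS](bigD1 i0)//= G'0 [RHS]mulrC; congr (_ * _).
    by apply: eq_bigr => i /G'N ->.
  rewrite e [LHS](bigD1 i0)//= G'0 [LHS]mulrC; congr (_ * _).
  by apply: eq_bigr => i /G'N ->.
move=> mF hF; apply: (H m) => // i; by rewrite leqNgt ltn_ord.
Qed.

End family.

End Independence.

(** * Polynomials in independent variables *)

Section Polynomials.
Context d (Omega : measurableType d) (R : realType) (P : probability Omega R).
Local Notation E := (Ex P).
Variables (m : nat) (xi : 'I_m -> Omega -> R).
Implicit Types (k l : 'I_m -> nat) (I J : {set 'I_m}) (f g : Omega -> R).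

Definition monomial k (w : Omega) : R := \prod_i xi i w ^+ k i.

(** Takes the place of measurability with respect to the variables indexed by [J]: expectations over
    disjoint index sets then factor by finite algebra. *)
Definition polynomial_in J f := exists s : seq (R * {ffun 'I_m -> nat}),
  (forall p, p \in s -> forall i, i \notin J -> p.2 i = 0%N) /\
  f = fun w => \sum_(p <- s) p.1 * monomial p.2 w.

Lemma polynomial_in_cst J (c : R) : polynomial_in J (fun=> c).
Proof.
exists [:: (c, [ffun=> 0%N])]; split.
  by move=> p; rewrite inE => /eqP -> i _ /=; rewrite ffunE.
apply/funext => w; rewrite big_seq1 /= /monomial big1 ?mulr1// => i _.
by rewrite ffunE.
Qed.

Lemma polynomial_in_var J i : i \in J -> polynomial_in J (xi i).
Proof.
move=> iJ; exists [:: (1, [ffun j => (j == i) : nat])]; split.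
  move=> p; rewrite inE => /eqP -> j jJ /=; rewrite ffunE.
  by case: eqP jJ => // ->; rewrite iJ.
apply/funext => w; rewrite big_seq1 /= /monomial mul1r (bigD1 i)//= ffunE eqxx.
by rewrite big1 ?mulr1// => j /negbTE ji; rewrite ffunE ji.
Qed.

Lemma polynomial_inD J f g : polynomial_in J f -> polynomial_in J g ->
  polynomial_in J (fun w => f w + g w).
Proof.
move=> [s [hs ->]] [t [ht ->]]; exists (s ++ t); split.
  by move=> p; rewrite mem_cat => /orP[]; [exact: hs|exact: ht].
by apply/funext => w; rewrite big_cat.
Qed.

Lemma monomialM k l w :
  monomial k w * monomial l w = monomial (fun i => k i + l i)%N w.
Proof. by rewrite /monomial -big_split; apply: eq_bigr => i _; rewrite exprD. Qed.

Lemma polynomial_inM J f g : polynomial_in J f -> polynomial_in J g ->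
  polynomial_in J (fun w => f w * g w).
Proof.
move=> [s [hs ->]] [t [ht ->]].
pose pq (p q : R * {ffun 'I_m -> nat}) := (p.1 * q.1, [ffun i => p.2 i + q.2 i]%N).
exists [seq pq p q | p <- s, q <- t]; split.
  move=> _ /allpairsP[[p q] /= [ps qt ->]] i iJ /=.
  by rewrite ffunE (hs _ ps)// (ht _ qt).
apply/funext => w; rewrite big_allpairs_dep /= mulr_suml; apply: eq_bigr => p _.
rewrite mulr_sumr; apply: eq_bigr => q _.
rewrite mulrACA monomialM; congr (_ * _); apply: eq_bigr => i _.
by rewrite ffunE.
Qed.

Lemma polynomial_in_sub I J f : I \subset J ->
  polynomial_in I f -> polynomial_in J f.
Proof.
move=> /fintype.subsetP IJ [s [hs ->]]; exists s; split=> // p ps i iJ.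
by apply: hs => //; apply: contra iJ; exact: IJ.
Qed.

Lemma polynomial_in_sum J T (s : seq T) (p : pred T) (F : T -> Omega -> R) :
  (forall i, p i -> polynomial_in J (F i)) ->
  polynomial_in J (fun w => \sum_(i <- s | p i) F i w).
Proof.
move=> h; elim: s => [|i s ih].
  by under eq_fun do rewrite big_nil; exact: polynomial_in_cst.
under eq_fun do rewrite big_cons.
by case: (boolP (p i)) => [/h ?|_] //; exact: polynomial_inD.
Qed.

Lemma polynomial_in_prod J T (s : seq T) (p : pred T) (F : T -> Omega -> R) :
  (forall i, p i -> polynomial_in J (F i)) ->
  polynomial_in J (fun w => \prod_(i <- s | p i) F i w).
Proof.
move=> h; elim: s => [|i s ih].
  by under eq_fun do rewrite big_nil; exact: polynomial_in_cst.
under eq_fun do rewrite big_cons.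
by case: (boolP (p i)) => [/h ?|_] //; exact: polynomial_inM.
Qed.

Lemma polynomial_inX J f n : polynomial_in J f -> polynomial_in J (fun w => f w ^+ n).
Proof.
move=> hf; elim: n => [|n ih].
  by under eq_fun do rewrite expr0; exact: polynomial_in_cst.
by under eq_fun do rewrite exprS; exact: polynomial_inM.
Qed.

Hypothesis xi_moments : forall i, all_moments P (xi i).
Hypothesis xi_indep : forall F : 'I_m -> set R, (forall i, measurable (F i)) ->
  E (fun w => \prod_i \1_(F i) (xi i w)) = \prod_i E (fun w => \1_(F i) (xi i w)).

Lemma monomial_moments k : all_moments P (monomial k).
Proof. by apply: all_moments_prod => i _; exact: all_momentsX. Qed.

Lemma polynomial_moments J f : polynomial_in J f -> all_moments P f.
Proof.
move=> [s [_ ->]]; apply: all_moments_sum => p _; apply: all_momentsZ.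
exact: monomial_moments.
Qed.

Lemma Ex_monomial k : E (monomial k) = \prod_i E (fun w => xi i w ^+ k i).
Proof.
apply: (Ex_prod_indep xi_moments xi_indep (F := fun i x => x ^+ k i)) => i.
  exact: measurable_funX.
exact: all_momentsX.
Qed.

(** At every index one of the two exponents vanishes, so the factor of the product at that index is
    already the product of the two factors. *)
Lemma Ex_monomialM k l : (forall i, k i = 0%N \/ l i = 0%N) ->
  E (fun w => monomial k w * monomial l w) = E (monomial k) * E (monomial l).
Proof.
move=> kl; under eq_fun do rewrite monomialM.
rewrite !Ex_monomial -big_split; apply: eq_bigr => i _ /=.
case: (kl i) => ->.
  rewrite [X in X * _](_ : _ = 1) ?mul1r// -[RHS](Ex_cst P 1).
  by congr (Ex P _); apply/funext => w; rewrite expr0.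
rewrite addn0 [X in _ * X](_ : _ = 1) ?mulr1// -[RHS](Ex_cst P 1).
by congr (Ex P _); apply/funext => w; rewrite expr0.
Qed.

Lemma Ex_polynomialM I J f g : (forall i, i \in I -> i \notin J) ->
  polynomial_in I f -> polynomial_in J g ->
  E (fun w => f w * g w) = E f * E g.
Proof.
move=> IJ [s [hs ->]] [t [ht ->]].
have hm k := all_moments_intg (monomial_moments k).
rewrite Ex_sum => [|p _]; last exact: intgZ.
rewrite Ex_sum => [|p _]; last exact: intgZ.
rewrite (_ : (fun w => _) = fun w => \sum_(p <- s) \sum_(q <- t)
    (p.1 * q.1) * (monomial p.2 w * monomial q.2 w)); last first.
  apply/funext => w; rewrite mulr_suml; apply: eq_bigr => p _.
  by rewrite mulr_sumr; apply: eq_bigr => q _; rewrite mulrACA.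
have hmm k l : intg P (fun w => monomial k w * monomial l w).
  by apply/all_moments_intg/all_momentsM; exact: monomial_moments.
rewrite Ex_sum => [|p _]; last first.
  by apply: intg_sum => q _; apply: intgZ.
rewrite mulr_suml big_seq [RHS]big_seq; apply: eq_bigr => p ps.
rewrite Ex_sum => [|q _]; last exact: intgZ.
rewrite mulr_sumr big_seq [RHS]big_seq; apply: eq_bigr => q qt.
rewrite !ExZ// mulrACA Ex_monomialM// => i.
have [iI|iI] := boolP (i \in I); last by left; exact: hs ps _ iI.
by right; apply: ht qt _ _; exact: IJ.
Qed.

End Polynomials.

(** * Truncated moment generating functions *)

Section TruncatedMgf.
Context d (Omega : measurableType d) (R : realType) (P : probability Omega R).
Local Notation E := (Ex P).
Implicit Types f g : Omega -> R.

(* For alpha < 1 the exponential moments are infinite. Cutting the series at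
   order N keeps submultiplicativity over independent summands and still
   controls the moment of order N. *)
Definition truncated_mgf (N : nat) (s : R) f : R :=
  \sum_(n < N.+1) `|E (fun w => f w ^+ n)| * s ^+ n / n`!%:R.

(** The left side runs over the pairs of indices with sum below [N], the right side over all pairs
    of indices below [N], and all terms are nonnegative. *)
Lemma sum_truncated_cauchy_le (N : nat) (a b : nat -> R) :
  (forall n, 0 <= a n) -> (forall n, 0 <= b n) ->
  \sum_(n < N) \sum_(i < n.+1) a (n - i)%N * b i <=
  (\sum_(n < N) a n) * (\sum_(n < N) b n).
Proof.
move=> a0 b0.
have wid n : (n < N)%N -> \sum_(i < n.+1) a (n - i)%N * b i =
    \sum_(i < N | (i < n.+1)%N) a (n - i)%N * b i.
  by move=> nN; rewrite (big_ord_widen _ (fun i => a (n - i)%N * b i) nN).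
rewrite (eq_bigr (fun n : 'I_N => \sum_(i < N | (i < n.+1)%N) a (n - i)%N * b i)).
  2: by move=> n _; exact: wid.
rewrite (exchange_big_dep xpredT)//= mulr_sumr; apply: ler_sum => i _.
rewrite -mulr_suml ler_wpM2r//.
rewrite -(big_mkord (fun n => i < n.+1)%N (fun n => a (n - i)%N)).
rewrite -(big_mkord xpredT a).
have -> : \sum_(0 <= n < N | (i < n.+1)%N) a (n - i)%N = \sum_(i <= n < N) a (n - i)%N.
  rewrite [RHS](big_nat_widenl _ 0)//.
rewrite -{1}[nat_of_ord i]add0n big_addn.
rewrite [leLHS](_ : _ = \sum_(0 <= j < N - i) a j); last first.
  by apply: eq_bigr => j _; rewrite addnK.
rewrite [leRHS](big_cat_nat (n := (N - i)%N))//= ?leq_subr// lerDl.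
by apply: sumr_ge0.
Qed.

(** The binomial expansion of E (f + g)^n factors term by term and becomes a Cauchy product after
    division by n!. The absolute values stand outside the expectations, so a centred variable
    contributes no term of order one. *)
Lemma truncated_mgfD N s f g : 0 <= s -> all_moments P f -> all_moments P g ->
  (forall i j, E (fun w => f w ^+ i * g w ^+ j) =
     E (fun w => f w ^+ i) * E (fun w => g w ^+ j)) ->
  truncated_mgf N s (fun w => f w + g w) <= truncated_mgf N s f * truncated_mgf N s g.
Proof.
move=> s0 hf hg fg.
pose a n := `|E (fun w => f w ^+ n)| * s ^+ n / n`!%:R.
pose b n := `|E (fun w => g w ^+ n)| * s ^+ n / n`!%:R.
apply: (le_trans _ (@sum_truncated_cauchy_le N.+1 a b _ _)); last 2 first.
- by move=> n; rewrite /a divr_ge0// mulr_ge0// exprn_ge0.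
- by move=> n; rewrite /b divr_ge0// mulr_ge0// exprn_ge0.
apply: ler_sum => n _.
have -> : E (fun w => (f w + g w) ^+ n) = \sum_(i < n.+1)
    E (fun w => f w ^+ (n - i)) * E (fun w => g w ^+ i) * 'C(n, i)%:R.
  rewrite (_ : (fun w => _) = fun w => \sum_(i < n.+1)
     'C(n, i)%:R * (f w ^+ (n - i) * g w ^+ i)); last first.
    by apply/funext => w; rewrite exprDn; apply: eq_bigr => i _; rewrite mulr_natl.
  have hi i : intg P (fun w => f w ^+ (n - i) * g w ^+ i).
    by apply/all_moments_intg/all_momentsM; exact: all_momentsX.
  rewrite Ex_sum => [|i _]; last exact: intgZ.
  by apply: eq_bigr => i _; rewrite ExZ// fg mulrC.
rewrite -mulrA; apply: le_trans (ler_wpM2r _ (ler_norm_sum _ _ _)) _.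
  by rewrite divr_ge0// exprn_ge0.
rewrite mulr_suml; apply: ler_sum => i _.
rewrite !normrM /a /b normr_nat le_eqVlt; apply/orP; left; apply/eqP.
have ni : (i <= n)%N by rewrite -ltnS.
have n0 (k : nat) : (k`!%:R : R) != 0 by rewrite pnatr_eq0 -lt0n fact_gt0.
have <- : ('C(n, i) * (i`! * (n - i)`!))%N%:R = n`!%:R :> R by rewrite bin_fact.
have -> : s ^+ n = s ^+ (n - i) * s ^+ i by rewrite -exprD subnK.
have c0 : ('C(n, i)%:R : R) != 0 by rewrite pnatr_eq0 -lt0n bin_gt0.
rewrite !natrM; field.
by rewrite !n0 c0.
Qed.

Lemma truncated_mgf0 N s : truncated_mgf N s (fun=> 0) = 1.
Proof.
rewrite /truncated_mgf big_ord_recl big1 => [|i _].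
  rewrite (_ : (fun w => _) = fun=> 1); last by apply/funext => w; rewrite expr0.
  by rewrite Ex_cst normr1 mulr1 fact0 divr1 addr0.
rewrite (_ : (fun w => _) = fun=> 0); last by apply/funext => w; rewrite expr0n.
by rewrite Ex_cst normr0 !mul0r.
Qed.

Lemma truncated_mgf_ge0 N s f : 0 <= s -> 0 <= truncated_mgf N s f.
Proof. by move=> s0; apply: sumr_ge0 => n _; rewrite divr_ge0// mulr_ge0// exprn_ge0. Qed.

Lemma moment_le_truncated_mgf N s f : 0 < s ->
  E (fun w => f w ^+ N) <= N`!%:R / s ^+ N * truncated_mgf N s f.
Proof.
move=> s0; have f0 : (0 : R) < N`!%:R by rewrite ltr0n fact_gt0.
rewrite mulrAC ler_pdivlMr ?exprn_gt0// -ler_pdivrMl//.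
rewrite /truncated_mgf big_ord_recr /= mulrC ler_wpDl//.
  by apply: sumr_ge0 => n _; rewrite divr_ge0// mulr_ge0// exprn_ge0// ltW.
rewrite ler_wpM2r ?invr_ge0 ?ler0n// ler_wpM2r ?exprn_ge0//; first exact: ltW.
exact: ler_norm.
Qed.

Lemma sum_expr_fact_le_expR (y : R) n : 0 <= y ->
  \sum_(j < n) y ^+ j / j`!%:R <= expR y.
Proof.
move=> y0.
rewrite -(big_mkord xpredT (fun j => y ^+ j / j`!%:R)).
rewrite [leLHS](_ : _ = series (exp_coeff y) n); last by [].
rewrite -[leRHS]/(limn (series (exp_coeff y))).
apply: nondecreasing_cvgn_le; last exact: is_cvg_series_exp_coeff.
by apply: nondecreasing_series => i _ _; exact: exp_coeff_ge0.
Qed.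

(** The term of order one vanishes, and a later term of odd order 2j + 1 is absorbed by its even
    neighbours through |z| <= (1 + z^2) / 2. The even terms are dominated by the series of exp y
    with y = (s kap)^2, since j! j! <= (2j)!. *)
Lemma truncated_mgf_subgaussian (q : nat) (s kap : R) f :
  0 <= s -> all_moments P f -> E f = 0 ->
  (forall j, (0 < j <= q)%N -> E (fun w => f w ^+ (2 * j)) <= kap ^+ (2 * j) * j`!%:R) ->
  truncated_mgf (2 * q) s f <= expR (2 * (s * kap) ^+ 2).
Proof.
move=> s0 hf f0 hk; set y := (s * kap) ^+ 2.
have y0 : 0 <= y by exact: sqr_ge0.
pose e k := `|E (fun w => f w ^+ k)| * s ^+ k / k`!%:R.
pose t j := y ^+ j / j`!%:R.
have fp (k : nat) : (0 : R) < k`!%:R by rewrite ltr0n fact_gt0.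
have t0 j : 0 <= t j by rewrite /t divr_ge0// exprn_ge0.
have M0 j : 0 <= E (fun w => f w ^+ (2 * j)).
  by apply: Ex_ge0 => w; rewrite exprM exprn_ge0 ?sqr_ge0.
have M j : (0 < j <= q)%N ->
    s ^+ (2 * j) * E (fun w => f w ^+ (2 * j)) <= y ^+ j * j`!%:R.
  move=> jq; rewrite /y -exprM exprMn -mulrA ler_wpM2l ?exprn_ge0//.
  exact: hk.
have fact_sq j : (j`! * j`! <= (2 * j)`!)%N.
  have := @bin_fact (2 * j) j; rewrite mul2n -addnn addnK => <-; last by rewrite leq_addr.
  by rewrite leq_pmull// bin_gt0 leq_addr.
have fact_sq1 j : (0 < j)%N -> (j.+1`! * j.+1`! <= (2 * j).+1`!)%N.
  elim: j => // -[_ _ //|j] /(_ isT) ih _.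
  rewrite [j.+3`!]factS (_ : (2 * j.+2).+1 = (2 * j.+1).+3)%N; last by lia.
  rewrite [(2 * j.+1).+3`!]factS [(2 * j.+1).+2`!]factS mulnA.
  by move: ih; set a := j.+2`!; set b := (_.+1)`!; nia.
have div_le (x : R) (a b : nat) : 0 <= x -> (a`! * a`! <= b`!)%N ->
    x * a`!%:R / b`!%:R <= x / a`!%:R.
  move=> x0 ab; rewrite ler_pdivrMr// -!mulrA ler_wpM2l// ler_pdivlMl//.
  by rewrite -natrM ler_nat.
have e0 k : 0 <= e k by rewrite /e divr_ge0// mulr_ge0// exprn_ge0.
have e2 j : (0 < j <= q)%N -> e (2 * j)%N <= t j.
  move=> jq; apply: le_trans (div_le _ _ _ _ (fact_sq j)); last exact: exprn_ge0.
  by rewrite /e ger0_norm// ler_pM2r ?invr_gt0// mulrC M.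
have e1 j : (0 < j)%N -> (j < q)%N -> e (2 * j).+1 <= (t j + t j.+1) / 2.
  move=> j0 jq.
  have h1 : y ^+ j * j`!%:R / (2 * j).+1`!%:R <= t j.
    apply: (div_le); first exact: exprn_ge0.
    by apply: leq_trans (fact_sq1 _ j0); rewrite leq_mul// factS leq_pmull.
  have h2 : y ^+ j.+1 * j.+1`!%:R / (2 * j).+1`!%:R <= t j.+1.
    by apply: (div_le); [exact: exprn_ge0|exact: fact_sq1].
  apply: (@le_trans _ _ ((y ^+ j * j`!%:R / (2 * j).+1`!%:R +
      y ^+ j.+1 * j.+1`!%:R / (2 * j).+1`!%:R) / 2)); last by lra.
  rewrite -mulrDl -mulrA [_^-1 / 2]mulrC mulrA /e ler_pM2r ?invr_gt0//.
  have jq1 : (0 < j <= q)%N by rewrite j0 ltnW.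
  have := M _ jq1; have := M j.+1 jq; rewrite mulnS => m2 m1.
  have : `|E (fun w => f w ^+ (2 * j).+1)| * s ^+ (2 * j).+1 <=
    (s ^+ (2 * j) * E (fun w => f w ^+ (2 * j)) +
     s ^+ (2 + 2 * j) * E (fun w => f w ^+ (2 + 2 * j))) / 2.
    have ii k : intg P (fun w => f w ^+ k) by exact: all_moments_intgX.
    have iic k c : intg P (fun w => c * f w ^+ k) by exact: intgZ.
    apply: (@le_trans _ _ (E (fun w => s ^+ (2 * j).+1 * `|f w ^+ (2 * j).+1|))).
      rewrite mulrC ExZ; last exact: intg_abs.
      by rewrite ler_wpM2l ?exprn_ge0// Ex_abs.
    rewrite -!ExZ// -ExD// mulrC -ExZ; last exact: intgD.
    apply: Ex_le.
    - by apply: intgZ; exact: intg_abs.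
    - by apply: intgZ; exact: intgD.
    move=> w; set x := `|f w|.
    have fx : forall k, ~~ odd k -> f w ^+ k = x ^+ k.
      by move=> k ek; rewrite /x -normrX ger0_norm// exprn_even_ge0.
    rewrite normrX -/x !fx ?oddM//; last by rewrite oddD oddM.
    rewrite !add2n !exprS; set b := (2 * j)%N.
    have : 0 <= s ^+ b * x ^+ b * (1 - s * x) ^+ 2.
      by rewrite mulr_ge0 ?sqr_ge0// mulr_ge0// exprn_ge0// normr_ge0.
    set sb := s ^+ b; set xb := x ^+ b; nra.
  by move=> /le_trans; apply; lra.
(* The extra t_(n+1) / 2 pays in advance for the lower half of the bound on the next odd term. *)
have main n : (n < q)%N -> \sum_(k < (2 * n.+1).+1) e k + t n.+1 / 2 <=
    1 + 2 * \sum_(1 <= j < n.+2) t j.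
  elim: n => [|n ih] nq.
    rewrite 3!big_ord_recr big_ord0 /= big_nat1.
    have -> : e 0%N = 1.
      rewrite /e (_ : (fun w => _) = fun=> 1); last by apply/funext => w; rewrite expr0.
      by rewrite Ex_cst normr1 mul1r expr0 fact0 divr1.
    have -> : e 1%N = 0.
      by rewrite /e; under eq_fun do rewrite expr1; rewrite f0 normr0 !mul0r.
    have := e2 1%N; rewrite muln1 => /(_ nq); have := t0 1%N; lra.
  rewrite mulnS 2!big_ord_recr [X in 1 + 2 * X]big_nat_recr//=.
  have := ih (ltnW nq); have := e1 n.+1 isT nq; have := e2 n.+2 nq.
  rewrite [X in e X <= _ -> _](_ : _ = (2 * n.+1).+2)%N; last by lia.
  move=> a1 a2 a3; lra.
have fin n : \sum_(1 <= j < n.+1) t j <= expR y - 1.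
  have := sum_expr_fact_le_expR n.+1 y0.
  rewrite -(big_mkord xpredT t) big_nat_recl// /t expr0 fact0 divr1 big_add1 /=; lra.
have ey : expR (2 * y) = expR y ^+ 2 by rewrite expRM_natl.
case: q hk M e2 e1 main => [|q] _ _ _ _ main.
  rewrite /truncated_mgf muln0 big_ord1 ey.
  rewrite (_ : (fun w => _) = fun=> 1); last by apply/funext => w; rewrite expr0.
  rewrite Ex_cst normr1 mul1r expr0 fact0 divr1.
  have : 1 <= expR y by rewrite -[leLHS]expR0 ler_expR.
  set x := expR y; nra.
have := main q (ltnSn _); have := fin q.+1; have := t0 q.+1.
rewrite /truncated_mgf -/e ey => a1 a2 a3.
apply: (@le_trans _ _ (1 + 2 * (expR y - 1))); first by lra.
have := sqr_ge0 (expR y - 1); lra.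
Qed.

(** With no term of order one and ratio s a h <= 1/2, the terms of order at least 2 are dominated by
    a geometric series starting at (s a sig)^2, so the sum is at most 1 + 2 (s a sig)^2. *)
Lemma truncated_mgf_bernstein (N : nat) (s a sig h : R) f :
  0 <= s -> 0 <= a -> 0 <= sig -> 0 <= h -> all_moments P f -> E f = 0 ->
  (forall k, (2 <= k <= N)%N ->
     `|E (fun w => f w ^+ k)| <= k`!%:R * sig ^+ 2 * h ^+ (k - 2)) ->
  s * a * h <= 1 / 2 ->
  truncated_mgf N s (fun w => a * f w) <= expR (2 * (s * a * sig) ^+ 2).
Proof.
move=> s0 a0 sig0 h0 hf f0 hk sah; set z := (s * a * sig) ^+ 2.
have z0 : 0 <= z by exact: sqr_ge0.
pose e k := `|E (fun w => (a * f w) ^+ k)| * s ^+ k / k`!%:R.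
have e00 : e 0%N = 1.
  rewrite /e (_ : (fun w => _) = fun=> 1); last by apply/funext => w; rewrite expr0.
  by rewrite Ex_cst normr1 mul1r expr0 fact0 divr1.
have e10 : e 1%N = 0.
  rewrite /e; under eq_fun do rewrite expr1.
  by rewrite ExZ ?f0 ?mulr0 ?normr0 ?mul0r//; exact: all_moments_intg.
have ek k : (k.+2 <= N)%N -> e k.+2 <= z * (1 / 2) ^+ k.
  move=> kN; rewrite /e; under eq_fun do rewrite exprMn.
  rewrite ExZ; last exact: all_moments_intgX.
  have fp : (0 : R) < (k.+2)`!%:R by rewrite ltr0n fact_gt0.
  rewrite ler_pdivrMr// normrM ger0_norm ?exprn_ge0//.
  have := hk k.+2 kN; rewrite !subSS subn0 => H.
  apply: (@le_trans _ _ (a ^+ k.+2 * (k.+2`!%:R * sig ^+ 2 * h ^+ k) * s ^+ k.+2)).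
    by rewrite ler_wpM2r ?exprn_ge0// ler_wpM2l// exprn_ge0.
  rewrite (_ : _ * s ^+ k.+2 = z * (s * a * h) ^+ k * k.+2`!%:R); last first.
    by rewrite /z !exprMn !exprS; ring.
  rewrite ler_pM2r// ler_wpM2l//; apply: lerXn2r; rewrite ?nnegrE ?mulr_ge0//.
have main n : (n.+1 <= N)%N -> \sum_(k < n.+2) e k <= 1 + z * (2 - 2 * (1 / 2) ^+ n).
  elim: n => [|n ih] nN.
    by rewrite 2!big_ord_recr big_ord0 /= e00 e10 expr0; lra.
  rewrite big_ord_recr /= exprS; have := ih (ltnW nN); have := ek n nN; lra.
apply: (@le_trans _ _ (1 + 2 * z)); last exact: expR_ge1Dx.
case: N hk ek main => [|N] _ _ main.
  by rewrite /truncated_mgf big_ord1 -/(e 0%N) e00; lra.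
apply: le_trans (main N (ltnSn _)) _.
have : 0 <= (1 / 2 : R) ^+ N by rewrite exprn_ge0//; lra.
set p := _ ^+ N; nra.
Qed.

End TruncatedMgf.

(** * Moments of sums of independent variables *)

Section IndependentSums.
Context d (Omega : measurableType d) (R : realType) (P : probability Omega R).
Local Notation E := (Ex P).
Variables (m : nat) (xi : 'I_m -> Omega -> R).
Hypothesis xi_moments : forall i, all_moments P (xi i).
Hypothesis xi_indep : forall F : 'I_m -> set R, (forall i, measurable (F i)) ->
  E (fun w => \prod_i \1_(F i) (xi i w)) = \prod_i E (fun w => \1_(F i) (xi i w)).
Local Notation poly := (polynomial_in xi).

Lemma truncated_mgf_sum N s (zeta : 'I_m -> Omega -> R) (A : {set 'I_m}) :
  0 <= s -> (forall i, poly [set i]%SET (zeta i)) ->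
  truncated_mgf P N s (fun w => \sum_(i in A) zeta i w) <=
  \prod_(i in A) truncated_mgf P N s (zeta i).
Proof.
move=> s0 hz; have hm i := polynomial_moments xi_moments (hz i).
have Hr (r : seq 'I_m) : uniq r ->
    truncated_mgf P N s (fun w => \sum_(i <- r) zeta i w) <=
    \prod_(i <- r) truncated_mgf P N s (zeta i).
  elim: r => [_|i r ih /= /andP[ir ur]].
    by under eq_fun do rewrite big_nil; rewrite big_nil truncated_mgf0.
  under eq_fun do rewrite big_cons; rewrite big_cons.
  have hs : poly [set j in r]%SET (fun w => \sum_(j <- r) zeta j w).
    rewrite (_ : (fun w => _) = fun w => \sum_(j <- r | j \in r) zeta j w); last first.
      by apply/funext => w; rewrite big_seq.
    apply: polynomial_in_sum => j jr; apply: polynomial_in_sub (hz j).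
    by apply/fintype.subsetP => k; rewrite !inE => /eqP ->.
  apply: le_trans (truncated_mgfD _ s0 _ _ _) _.
  - exact: hm.
  - exact: polynomial_moments hs.
  - move=> a b; apply: (Ex_polynomialM xi_moments xi_indep
      (I := [set i]%SET) (J := [set j in r]%SET)).
    + by move=> k; rewrite !inE => /eqP ->.
    + exact: polynomial_inX.
    + exact: polynomial_inX.
  by rewrite ler_wpM2l ?ih// truncated_mgf_ge0.
by have := Hr (enum A) (enum_uniq _); rewrite big_enum; under eq_fun do rewrite big_enum.
Qed.

Lemma moment_sum_le N s (zeta : 'I_m -> Omega -> R) (A : {set 'I_m}) (v : 'I_m -> R) :
  0 < s -> (forall i, poly [set i]%SET (zeta i)) ->
  (forall i, truncated_mgf P N s (zeta i) <= expR (v i)) ->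
  E (fun w => (\sum_(i in A) zeta i w) ^+ N) <=
  N%:R ^+ N / s ^+ N * expR (\sum_(i in A) v i).
Proof.
move=> s0 hz hv; apply: le_trans (moment_le_truncated_mgf _ _ _ s0) _.
apply: ler_pM.
- by rewrite divr_ge0// exprn_ge0// ltW.
- by apply: truncated_mgf_ge0; exact: ltW.
- rewrite ler_pM2r ?invr_gt0 ?exprn_gt0// -natrX ler_nat.
  elim: (N) => // n ih; rewrite factS expnS leq_mul//.
  apply: leq_trans ih _; by case: n => // n; rewrite leq_exp2r.
- apply: le_trans (truncated_mgf_sum _ _ (ltW s0) hz) _.
  rewrite expR_sum; apply: ler_prod => i _.
  by rewrite hv truncated_mgf_ge0// ltW.
Qed.

Section linear.
Variables (q : nat) (kap : R).
Hypotheses (q0 : (0 < q)%N) (kap0 : 0 < kap).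
Hypothesis xi_mean : forall i, E (xi i) = 0.
Hypothesis xi_even : forall i j, (0 < j <= q)%N ->
  E (fun w => xi i w ^+ (2 * j)) <= kap ^+ (2 * j) * j`!%:R.

(** With V the sum of the squared coefficients and s^2 = q / (kap^2 V), the bound (2q / s)^(2q)
    exp(2 s^2 kap^2 V) is the q-th power of this constant times V. *)
Definition linear_const : R := 4 * q%:R * kap ^+ 2 * expR 2.

Lemma linear_const_ge0 : 0 <= linear_const.
Proof. by rewrite /linear_const mulr_ge0 ?expR_ge0// mulr_ge0 ?sqr_ge0. Qed.

Lemma linear_moment (c : 'I_m -> R) (A : {set 'I_m}) :
  E (fun w => (\sum_(i in A) c i * xi i w) ^+ (2 * q)) <=
  (linear_const * \sum_(i in A) c i ^+ 2) ^+ q.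
Proof.
set V := \sum_(i in A) _.
have V0 : 0 <= V by apply: sumr_ge0 => i _; exact: sqr_ge0.
have q0' : (0 : R) < q%:R by rewrite ltr0n.
have [Vp|] := ltP 0 V; last first.
  move=> Vn; have c0 i : i \in A -> c i = 0.
    move=> iA; have : c i ^+ 2 <= 0.
      apply: le_trans Vn; rewrite /V (bigD1 i)//= lerDl.
      by apply: sumr_ge0 => j _; exact: sqr_ge0.
    by move=> h; apply/eqP; rewrite -sqrf_eq0 eq_le h sqr_ge0.
  rewrite (_ : (fun w => _) = fun=> 0); last first.
    apply/funext => w; rewrite big1 => [|i /c0 ->]; last by rewrite mul0r.
    by rewrite expr0n muln_eq0 /= eqn0Ngt q0.
  by rewrite Ex_cst exprn_ge0// mulr_ge0// linear_const_ge0.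
pose s := Num.sqrt (q%:R / (kap ^+ 2 * V)).
have s20 : 0 < q%:R / (kap ^+ 2 * V) by rewrite divr_gt0// mulr_gt0// exprn_gt0.
have s0 : 0 < s by rewrite sqrtr_gt0.
have s2 : s ^+ 2 = q%:R / (kap ^+ 2 * V) by rewrite sqr_sqrtr// ltW.
have hz i : poly [set i]%SET (fun w => c i * xi i w).
  apply: polynomial_inM; first exact: polynomial_in_cst.
  by apply: polynomial_in_var; rewrite inE.
apply: le_trans (@moment_sum_le (2 * q) s _ A
  (fun i => 2 * (s * (kap * `|c i|)) ^+ 2) s0 hz _) _.
  move=> i; apply: truncated_mgf_subgaussian => //.
  - exact: ltW.
  - exact: all_momentsZ.
  - by rewrite ExZ ?xi_mean ?mulr0//; exact: all_moments_intg.
  - move=> j jq; under eq_fun do rewrite exprMn.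
    rewrite ExZ; last exact: all_moments_intgX.
    rewrite exprMn -normrX [`|_ ^+ (2 * j)|]ger0_norm; last by rewrite exprM exprn_ge0// sqr_ge0.
    rewrite [kap ^+ _ * _]mulrC -mulrA ler_wpM2l ?xi_even//.
    by rewrite exprM exprn_ge0// sqr_ge0.
have -> : \sum_(i in A) 2 * (s * (kap * `|c i|)) ^+ 2 = 2 * q%:R.
  rewrite (eq_bigr (fun i => 2 * s ^+ 2 * kap ^+ 2 * c i ^+ 2)); last first.
    by move=> i _; rewrite !exprMn real_normK ?num_real//; ring.
  rewrite -mulr_sumr -/V s2; field.
  by rewrite !gt_eqF.
rewrite [2 * q%:R]mulrC expRM_natl.
rewrite 2![_ ^+ (2 * q)]exprM -exprVn -!exprMn s2 le_eqVlt; apply/orP; left.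
apply/eqP; congr (_ ^+ _); rewrite /linear_const natrM; field.
by rewrite !gt_eqF.
Qed.

(** Conditioning on the coordinates in [J], done algebraically: the power expands into words in the
    [c i] times words in the [xi i], whose expectations factor. Resummed with the [c i] frozen at
    [w], it is the moment of a linear form with constant coefficients, to which [linear_moment]
    applies. *)
Lemma linear_moment_random (c : 'I_m -> Omega -> R) (A J : {set 'I_m}) :
  (forall i, i \in A -> i \notin J) -> (forall i, i \in A -> poly J (c i)) ->
  E (fun w => (\sum_(i in A) c i w * xi i w) ^+ (2 * q)) <=
  E (fun w => (linear_const * \sum_(i in A) c i w ^+ 2) ^+ q).
Proof.
move=> AJ hc.
pose word (y : 'I_m -> R) (f : {ffun 'I_(2 * q) -> 'I_m}) := \prod_t y (f t).
have expand (x y : 'I_m -> R) : (\sum_(i in A) x i * y i) ^+ (2 * q) =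
    \sum_(f in ffun_on A) word x f * word y f.
  rewrite -[in LHS](card_ord (2 * q)) -prodr_const bigA_distr_big /=.
  by apply: eq_bigr => f _; rewrite -big_split.
have wordE f : f \in ffun_on A -> poly A (fun w => word (xi^~ w) f).
  by move=> /ffun_onP fA; apply: polynomial_in_prod => t _; exact: polynomial_in_var.
have wordC f : f \in ffun_on A -> poly J (fun w => word (c^~ w) f).
  by move=> /ffun_onP fA; apply: polynomial_in_prod => t _; exact: hc.
have mC f : f \in ffun_on A -> all_moments P (fun w => word (c^~ w) f).
  by move=> fA; exact: polynomial_moments (wordC f fA).
have mX f : f \in ffun_on A -> all_moments P (fun w => word (xi^~ w) f).
  by move=> fA; exact: polynomial_moments (wordE f fA).
pose G w := \sum_(f in ffun_on A) E (fun w' => word (xi^~ w') f) * word (c^~ w) f.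
have EG : E (fun w => (\sum_(i in A) c i w * xi i w) ^+ (2 * q)) = E G.
  under eq_fun do rewrite expand.
  rewrite /G !Ex_sum; last 2 first.
  - by move=> f fA; apply: intgZ; apply: all_moments_intg; exact: mC.
  - by move=> f fA; apply: all_moments_intg; apply: all_momentsM; [exact: mC|exact: mX].
  apply: eq_bigr => f fA; rewrite ExZ; last exact: all_moments_intg (mC _ fA).
  rewrite -(Ex_polynomialM xi_moments xi_indep AJ (wordE f fA) (wordC f fA)).
  by congr (Ex P _); apply/funext => w; rewrite mulrC.
rewrite EG; apply: Ex_le.
- by apply: all_moments_intg; apply: all_moments_sum => f fA; apply: all_momentsZ; exact: mC.
- apply: all_moments_intgX; apply: all_momentsZ; apply: all_moments_sum => i iA.
  by apply: all_momentsX; exact: polynomial_moments (hc i iA).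
move=> w; rewrite (_ : G w = E (fun w' => (\sum_(i in A) c i w * xi i w') ^+ (2 * q))).
  exact: linear_moment.
under [in RHS]eq_fun do rewrite expand.
rewrite Ex_sum; last by move=> f fA; apply: intgZ; apply: all_moments_intg; exact: mX.
apply: eq_bigr => f fA; rewrite ExZ 1?mulrC//; exact: all_moments_intg (mX _ fA).
Qed.

End linear.

(** [Y] dominates the two scales of a Bernstein bound: sqrt q sig |a| from the variances and 2 q h
    max a from the largest weight. With s = q / Y the second keeps s a_i h <= 1/2, and the first
    keeps the total exponent at most 2q. *)
Lemma square_sum_moment (q : nat) (sig h Y : R) (a : 'I_m -> R) :
  (0 < q)%N -> 0 <= sig -> 0 <= h -> 0 < Y -> (forall i, 0 <= a i) ->
  (forall i, E (fun w => xi i w ^+ 2) = 1) ->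
  (forall i k, (2 <= k <= 2 * q)%N ->
     `|E (fun w => (xi i w ^+ 2 - 1) ^+ k)| <= k`!%:R * sig ^+ 2 * h ^+ (k - 2)) ->
  q%:R * sig ^+ 2 * (\sum_i a i ^+ 2) <= Y ^+ 2 ->
  (forall i, 2 * q%:R * h * a i <= Y) ->
  E (fun w => (\sum_i a i * (xi i w ^+ 2 - 1)) ^+ (2 * q)) <= (2 * expR 1 * Y) ^+ (2 * q).
Proof.
move=> q0 sig0 h0 Y0 a0 hv hk YY Yh.
have q0' : (0 : R) < q%:R by rewrite ltr0n.
pose s := q%:R / Y; have s0 : 0 < s by rewrite divr_gt0.
have hz i : poly [set i]%SET (fun w => a i * (xi i w ^+ 2 - 1)).
  apply: polynomial_inM; first exact: polynomial_in_cst.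
  apply: polynomial_inD; last exact: polynomial_in_cst.
  by apply: polynomial_inX; apply: polynomial_in_var; rewrite inE.
have hm i : all_moments P (fun w => xi i w ^+ 2 - 1).
  by apply: all_momentsB; [exact: all_momentsX|exact: all_moments_cst].
have := @moment_sum_le (2 * q) s _ [set: 'I_m]%SET
  (fun i => 2 * (s * a i * sig) ^+ 2) s0 hz.
rewrite (_ : (fun w => _) = (fun w => (\sum_i a i * (xi i w ^+ 2 - 1)) ^+ (2 * q))); last first.
  by apply/funext => w; congr (_ ^+ _); apply: eq_bigl => i; rewrite inE.
move=> H; apply: le_trans (H _) _ => {H}.
  move=> i; apply: (truncated_mgf_bernstein (h := h)) => //.
  - exact: ltW.
  - rewrite ExD; [|exact: all_moments_intgX|exact: intg_cst].
    by rewrite hv Ex_cst subrr.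
  - move=> k; exact: hk.
  - rewrite /s (_ : _ * h = q%:R * h * a i / Y); last by ring.
    by rewrite ler_pdivrMr//; have := Yh i; lra.
have e2 : expR (\sum_(i in [set: 'I_m]%SET) 2 * (s * a i * sig) ^+ 2) <= expR 1 ^+ (2 * q).
  rewrite -expRM_natl ler_expR mulr1 natrM.
  rewrite (eq_bigl xpredT); last by move=> i; rewrite inE.
  rewrite (eq_bigr (fun i => 2 * s ^+ 2 * sig ^+ 2 * a i ^+ 2)); last first.
    by move=> i _; rewrite !exprMn; ring.
  rewrite -mulr_sumr /s; set V := \sum_i _ in YY *.
  rewrite (_ : _ * V = 2 * q%:R * (q%:R * sig ^+ 2 * V) / Y ^+ 2); last by field; rewrite gt_eqF.
  by rewrite ler_pdivrMr ?exprn_gt0// ler_wpM2l// mulr_ge0// ltW.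
apply: le_trans (ler_wpM2l _ e2) _.
  by rewrite divr_ge0// exprn_ge0// ltW.
rewrite -exprVn -!exprMn le_eqVlt; apply/orP; left; apply/eqP; congr (_ ^+ _).
by rewrite /s natrM; field; rewrite !gt_eqF.
Qed.

End IndependentSums.

(** * Euclidean and operator norms *)

Section EuclideanNorm.
Variable R : realType.
Implicit Types n : nat.

Lemma l2norm_ge0 n (v : 'cV[R]_n) : 0 <= l2norm v.
Proof. exact: sqrtr_ge0. Qed.

Lemma l2norm_sqr n (v : 'cV[R]_n) : l2norm v ^+ 2 = \sum_i v i 0 ^+ 2.
Proof. by rewrite sqr_sqrtr//; apply: sumr_ge0 => i _; exact: sqr_ge0. Qed.

Lemma dotpp n (v : 'cV[R]_n) : dotp v v = l2norm v ^+ 2.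
Proof. by rewrite l2norm_sqr; apply: eq_bigr => i _; rewrite expr2. Qed.

Lemma dotpC n (u v : 'cV[R]_n) : dotp u v = dotp v u.
Proof. by apply: eq_bigr => i _; rewrite mulrC. Qed.

Lemma dotpDr n (u v w : 'cV[R]_n) : dotp u (v + w) = dotp u v + dotp u w.
Proof. by rewrite -big_split; apply: eq_bigr => i _; rewrite mxE mulrDr. Qed.

Lemma dotpZr n (a : R) (u v : 'cV[R]_n) : dotp u (a *: v) = a * dotp u v.
Proof. by rewrite [RHS]mulr_sumr; apply: eq_bigr => i _; rewrite mxE mulrCA. Qed.

Lemma dotpNr n (u v : 'cV[R]_n) : dotp u (- v) = - dotp u v.
Proof. by rewrite -scaleN1r dotpZr mulN1r. Qed.

Lemma dotpDl n (u v w : 'cV[R]_n) : dotp (v + w) u = dotp v u + dotp w u.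
Proof. by rewrite ![dotp _ u]dotpC dotpDr. Qed.

Lemma dotpZl n (a : R) (u v : 'cV[R]_n) : dotp (a *: v) u = a * dotp v u.
Proof. by rewrite ![dotp _ u]dotpC dotpZr. Qed.

Lemma dotpNl n (u v : 'cV[R]_n) : dotp (- v) u = - dotp v u.
Proof. by rewrite ![dotp _ u]dotpC dotpNr. Qed.

Lemma dotp_trmx l m (B : 'M[R]_(l, m)) (x : 'cV[R]_m) (y : 'cV[R]_l) :
  dotp (B *m x) y = dotp x (B^T *m y).
Proof.
rewrite /dotp; under eq_bigr do rewrite mxE mulr_suml.
rewrite exchange_big /=; apply: eq_bigr => i _; rewrite mxE mulr_sumr.
by apply: eq_bigr => j _; rewrite mxE -mulrA mulrCA.
Qed.

Lemma l2norm0_eq0 n (v : 'cV[R]_n) : l2norm v = 0 -> v = 0.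
Proof.
move=> v0; have := l2norm_sqr v; rewrite v0 expr0n => /esym /psumr_eq0P h.
apply/colP => i; rewrite mxE; apply/eqP; rewrite -sqrf_eq0; apply/eqP.
by apply: h => // j _; exact: sqr_ge0.
Qed.

Lemma l2norm0 n : l2norm (0 : 'cV[R]_n) = 0.
Proof. by rewrite /l2norm big1 ?sqrtr0// => i _; rewrite mxE expr0n. Qed.

Lemma cauchy_schwarz n (u v : 'cV[R]_n) : `|dotp u v| <= l2norm u * l2norm v.
Proof.
have [v0|vn0] := eqVneq (l2norm v) 0.
  rewrite v0 mulr0 (l2norm0_eq0 v0) (_ : dotp u 0 = 0) ?normr0//.
  by rewrite -(scale0r (0 : 'cV[R]_n)) dotpZr mul0r.
have vp : 0 < l2norm v by rewrite lt_neqAle eq_sym vn0 l2norm_ge0.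
rewrite -ler_sqr ?nnegrE ?mulr_ge0 ?l2norm_ge0// exprMn real_normK ?num_real//.
have := sqr_ge0 (l2norm (l2norm v ^+ 2 *: u - dotp u v *: v)).
rewrite -[X in 0 <= X]dotpp dotpDr !dotpDl !dotpNr !dotpNl !dotpZl !dotpZr !dotpp.
rewrite (dotpC v u); set D := dotp u v; set V := l2norm v; set U := l2norm u.
rewrite (_ : _ + _ = V ^+ 2 * (U ^+ 2 * V ^+ 2 - D ^+ 2)); last by ring.
by rewrite pmulr_rge0 ?exprn_gt0// subr_ge0.
Qed.

Lemma l2normD n (u v : 'cV[R]_n) : l2norm (u + v) <= l2norm u + l2norm v.
Proof.
rewrite -ler_sqr ?nnegrE ?addr_ge0 ?l2norm_ge0// -dotpp dotpDr !dotpDl !dotpp.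
have := le_trans (ler_norm _) (cauchy_schwarz u v); rewrite (dotpC v u); nra.
Qed.

Lemma l2normZ n (a : R) (v : 'cV[R]_n) : l2norm (a *: v) = `|a| * l2norm v.
Proof.
apply/eqP; rewrite -(@eqrXn2 _ 2)// ?mulr_ge0 ?l2norm_ge0//; apply/eqP.
rewrite exprMn real_normK ?num_real// !l2norm_sqr mulr_sumr.
by apply: eq_bigr => i _; rewrite mxE exprMn.
Qed.

Lemma l2normN n (v : 'cV[R]_n) : l2norm (- v) = l2norm v.
Proof. by rewrite -scaleN1r l2normZ normrN1 mul1r. Qed.

Lemma l2norm_dist n (u v : 'cV[R]_n) : `|l2norm u - l2norm v| <= l2norm (u - v).
Proof.
rewrite ler_norml; apply/andP; split.
  have := l2normD (v - u) u; rewrite subrK -(l2normN (v - u)) opprB; lra.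
have := l2normD (u - v) v; rewrite subrK; lra.
Qed.

Lemma l2norm_le_sum n (v : 'cV[R]_n) : l2norm v <= \sum_i `|v i 0|.
Proof.
rewrite -ler_sqr ?nnegrE ?l2norm_ge0 ?sumr_ge0// l2norm_sqr expr2 mulr_suml.
apply: ler_sum => i _; rewrite -real_normK ?num_real// expr2 ler_wpM2l//.
by rewrite (bigD1 i)//= lerDl sumr_ge0.
Qed.

Section operator.
Variables (l m : nat) (B : 'M[R]_(l, m)).

Lemma hs_norm_ge0 : 0 <= hs_norm B. Proof. exact: sqrtr_ge0. Qed.

Definition col_sqnorm (i : 'I_m) : R := \sum_k B k i ^+ 2.

Lemma col_sqnorm_ge0 i : 0 <= col_sqnorm i.
Proof. by apply: sumr_ge0 => k _; exact: sqr_ge0. Qed.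

Lemma hs_norm_sqr : hs_norm B ^+ 2 = \sum_i col_sqnorm i.
Proof.
rewrite sqr_sqrtr; first by rewrite exchange_big.
by apply: sumr_ge0 => i _; apply: sumr_ge0 => j _; exact: sqr_ge0.
Qed.

Lemma l2norm_mulmx_le_hs (x : 'cV[R]_m) : l2norm (B *m x) <= hs_norm B * l2norm x.
Proof.
rewrite -ler_sqr ?nnegrE ?mulr_ge0 ?l2norm_ge0 ?hs_norm_ge0// exprMn.
rewrite l2norm_sqr hs_norm_sqr exchange_big mulr_suml; apply: ler_sum => k _.
pose r : 'cV[R]_m := (row k B)^T.
have -> : (B *m x) k 0 = dotp r x.
  by rewrite mxE; apply: eq_bigr => i _; rewrite !mxE.
have -> : \sum_(i < m) B k i ^+ 2 = l2norm r ^+ 2.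
  by rewrite l2norm_sqr; apply: eq_bigr => i _; rewrite !mxE.
rewrite -exprMn -[X in X <= _]real_normK ?num_real//.
by rewrite ler_sqr ?nnegrE ?mulr_ge0 ?l2norm_ge0// cauchy_schwarz.
Qed.

Lemma op_norm_has_sup :
  has_sup [set l2norm (B *m x) | x in [set x : 'cV[R]_m | l2norm x <= 1]].
Proof.
split; first by exists (l2norm (B *m 0)), 0; rewrite //= l2norm0.
exists (hs_norm B) => _ [x /= x1 <-]; apply: le_trans (l2norm_mulmx_le_hs x) _.
by rewrite ler_piMr// hs_norm_ge0.
Qed.

Lemma op_norm_ge0 : 0 <= op_norm B.
Proof.
apply: ub_le_sup; first by have [] := op_norm_has_sup.
by exists 0; rewrite /= ?mulmx0 l2norm0.
Qed.

Lemma op_norm_le_hs : op_norm B <= hs_norm B.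
Proof.
apply: ge_sup; first by have [] := op_norm_has_sup.
move=> _ [x /= x1 <-]; apply: le_trans (l2norm_mulmx_le_hs x) _.
by rewrite ler_piMr// hs_norm_ge0.
Qed.

Lemma l2norm_mulmx_le (x : 'cV[R]_m) : l2norm (B *m x) <= op_norm B * l2norm x.
Proof.
have [x0|xn0] := eqVneq (l2norm x) 0.
  by rewrite (l2norm0_eq0 x0) mulmx0 !l2norm0 mulr0.
have xp : 0 < l2norm x by rewrite lt_neqAle eq_sym xn0 l2norm_ge0.
rewrite -ler_pdivrMr//.
have -> : l2norm (B *m x) / l2norm x = l2norm (B *m ((l2norm x)^-1 *: x)).
  by rewrite -scalemxAr l2normZ ger0_norm ?invr_ge0 ?l2norm_ge0// mulrC.
apply: ub_le_sup; first by have [] := op_norm_has_sup.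
exists ((l2norm x)^-1 *: x) => //=.
by rewrite l2normZ ger0_norm ?invr_ge0 ?l2norm_ge0// mulVf.
Qed.

(** Duality: with z = B^T y, |z|^2 = <B z, y>. *)
Lemma l2norm_trmulmx_le (y : 'cV[R]_l) : l2norm (B^T *m y) <= op_norm B * l2norm y.
Proof.
set z := B^T *m y; have [z0|zn0] := eqVneq (l2norm z) 0.
  by rewrite z0 mulr_ge0 ?op_norm_ge0 ?l2norm_ge0.
have zp : 0 < l2norm z by rewrite lt_neqAle eq_sym zn0 l2norm_ge0.
rewrite -(ler_pM2r zp) -expr2 -dotpp {2}/z -dotp_trmx.
apply: le_trans (ler_norm _) _; apply: le_trans (cauchy_schwarz _ _) _.
by rewrite mulrAC ler_wpM2r ?l2norm_ge0// l2norm_mulmx_le.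
Qed.

Lemma col_sqnorm_le i : col_sqnorm i <= op_norm B ^+ 2.
Proof.
have := l2norm_mulmx_le (delta_mx i 0).
have -> : l2norm (delta_mx i 0 : 'cV[R]_m) = 1.
  rewrite /l2norm (bigD1 i)//= mxE !eqxx expr1n big1 ?addr0 ?sqrtr1//.
  by move=> j /negbTE ji; rewrite mxE ji expr0n.
rewrite mulr1 -ler_sqr ?nnegrE ?l2norm_ge0 ?op_norm_ge0// l2norm_sqr.
rewrite -colE; congr (_ <= _); apply: eq_bigr => k _; by rewrite mxE.
Qed.

(** Controls the variance of the diagonal part of the chaos, whose weights are the squared column
    norms. *)
Lemma sum_col_sqnorm_sqr : \sum_i col_sqnorm i ^+ 2 <= (op_norm B * hs_norm B) ^+ 2.
Proof.
rewrite exprMn hs_norm_sqr mulr_sumr; apply: ler_sum => i _.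
by rewrite expr2 ler_wpM2r ?col_sqnorm_ge0// col_sqnorm_le.
Qed.

Lemma op_norm0_hs : op_norm B = 0 -> hs_norm B = 0.
Proof.
move=> o0; apply/eqP; rewrite -sqrf_eq0 hs_norm_sqr big1// => i _.
by apply/eqP; rewrite eq_le col_sqnorm_ge0 andbT; have := col_sqnorm_le i; rewrite o0 expr0n.
Qed.

End operator.
End EuclideanNorm.

(** For i != j, a quarter of the 2^m index sets contain i and miss j: among the four sets obtained
    from [I] by toggling i and j, exactly one does, and each toggle permutes the index sets. *)
Lemma decoupling (R : realFieldType) (m : nat) (h : 'I_m -> 'I_m -> R) :
  \sum_i \sum_(j | j != i) h i j =
  4 / 2 ^+ m * \sum_(I : {set 'I_m}) \sum_(i in I) \sum_(j | j \notin I) h i j.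
Proof.
pose flip (i : 'I_m) (I : {set 'I_m}) := [set k | (k \in I) (+) (k == i)]%SET.
have flipK i : involutive (flip i).
  by move=> I; apply/setP => k; rewrite !inE addbK.
have sumflip i (f : {set 'I_m} -> R) : \sum_I f (flip i I) = \sum_I f I.
  by rewrite [RHS](reindex_inj (inv_inj (flipK i))).
have count i j : j != i ->
    4 * \sum_(I : {set 'I_m}) ((i \in I) && (j \notin I))%:R = 2 ^+ m :> R.
  move=> ji; pose f (I : {set 'I_m}) : R := ((i \in I) && (j \notin I))%:R.
  have -> : 4 * \sum_I f I = \sum_I (f I + f (flip i I) + (f (flip j I) + f (flip i (flip j I)))).
    rewrite !big_split /= (sumflip j (fun I => f (flip i I))) !sumflip; ring.
  rewrite (eq_bigr (fun=> 1)) => [|I _].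
    by rewrite sumr_const -cardsT -powersetT card_powerset cardsT card_ord natrX.
  rewrite /f !inE !eqxx (negbTE ji) eq_sym (negbTE ji).
  by case: (i \in I); case: (j \in I); rewrite /= ?addr0 ?add0r.
have -> : \sum_(I : {set 'I_m}) \sum_(i in I) \sum_(j | j \notin I) h i j =
    \sum_i \sum_j h i j * \sum_(I : {set 'I_m}) ((i \in I) && (j \notin I))%:R.
  under eq_bigr => I _.
    rewrite big_mkcond /=; under eq_bigr => i _.
      rewrite (_ : (if _ then _ else _) = \sum_j h i j * ((i \in I) && (j \notin I))%:R); last first.
        case: ifP => iI; last by rewrite big1// => j _; rewrite mulr0.
        rewrite big_mkcond; apply: eq_bigr => j _; case: (j \in I) => /=; by rewrite ?mulr1 ?mulr0.
      over.
    over.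
  rewrite /= exchange_big; apply: eq_bigr => i _.
  by rewrite exchange_big; apply: eq_bigr => j _; rewrite mulr_sumr.
rewrite mulr_sumr; apply: eq_bigr => i _.
rewrite [X in _ = _ * X](bigD1 i)//= [X in _ = _ * (_ * X + _)]big1 => [|I _].
  2: by rewrite andbN.
rewrite mulr0 add0r mulr_sumr; apply: eq_bigr => j ji; have := count i j ji.
set S := \sum_I _ => hS.
have p0 : (2 ^+ m : R) != 0 by rewrite expf_neq0.
have -> : S = 2 ^+ m / 4 by rewrite -hS; field.
by field.
Qed.

(** * A Hanson-Wright moment inequality *)

Section QuadraticForm.
Context d (Omega : measurableType d) (R : realType) (P : probability Omega R).
Local Notation E := (Ex P).
Variables (m : nat) (xi : 'I_m -> Omega -> R).
Hypothesis xi_moments : forall i, all_moments P (xi i).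
Hypothesis xi_indep : forall F : 'I_m -> set R, (forall i, measurable (F i)) ->
  E (fun w => \prod_i \1_(F i) (xi i w)) = \prod_i E (fun w => \1_(F i) (xi i w)).
Local Notation poly := (polynomial_in xi).
Variables (q : nat) (kap sig h : R).
Hypotheses (q0 : (0 < q)%N) (kap0 : 0 < kap) (sig0 : 0 <= sig) (h0 : 0 <= h).
Hypothesis xi_mean : forall i, E (xi i) = 0.
Hypothesis xi_var : forall i, E (fun w => xi i w ^+ 2) = 1.
Hypothesis xi_even : forall i j, (0 < j <= q)%N ->
  E (fun w => xi i w ^+ (2 * j)) <= kap ^+ (2 * j) * j`!%:R.
Hypothesis xi_sqr : forall i k, (2 <= k <= 2 * q)%N ->
  `|E (fun w => (xi i w ^+ 2 - 1) ^+ k)| <= k`!%:R * sig ^+ 2 * h ^+ (k - 2).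
Variables (l : nat) (B : 'M[R]_(l, m)).

Local Notation o := (op_norm B).
Local Notation H := (hs_norm B).
Local Notation L := (linear_const q kap).

Definition subvec (J : {set 'I_m}) w : 'cV[R]_m := \col_i (if i \in J then xi i w else 0).

Definition quad (J : {set 'I_m}) w : R :=
  l2norm (B *m subvec J w) ^+ 2 - \sum_(i in J) col_sqnorm B i.

Definition gram (i j : 'I_m) : R := \sum_k B k i * B k j.

Lemma polynomial_subvec J i : poly J (fun w => subvec J w i 0).
Proof.
have [iJ|iJ] := boolP (i \in J).
  rewrite (_ : (fun w => _) = xi i); first exact: polynomial_in_var.
  by apply/funext => w; rewrite mxE iJ.
rewrite (_ : (fun w => _) = fun=> 0); first exact: polynomial_in_cst.
by apply/funext => w; rewrite mxE (negbTE iJ).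
Qed.

Lemma polynomial_mulmx p (C : 'M[R]_(p, m)) J k :
  poly J (fun w => (C *m subvec J w) k 0).
Proof.
rewrite (_ : (fun w => _) = fun w => \sum_j C k j * subvec J w j 0); last first.
  by apply/funext => w; rewrite mxE.
apply: polynomial_in_sum => j _; apply: polynomial_inM; first exact: polynomial_in_cst.
exact: polynomial_subvec.
Qed.

Lemma polynomial_sqnorm J : poly J (fun w => l2norm (B *m subvec J w) ^+ 2).
Proof.
rewrite (_ : (fun w => _) = fun w => \sum_k (B *m subvec J w) k 0 ^+ 2); last first.
  by apply/funext => w; rewrite l2norm_sqr.
by apply: polynomial_in_sum => k _; apply: polynomial_inX; exact: polynomial_mulmx.
Qed.

Lemma polynomial_quad J : poly J (quad J).
Proof.
by apply: polynomial_inD; [exact: polynomial_sqnorm|exact: polynomial_in_cst].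
Qed.

Lemma quad_moments J : all_moments P (quad J).
Proof. exact: polynomial_moments (polynomial_quad J). Qed.

(** Restricting the inner vector to [J :\: I] encodes the condition that j lies outside [I], so that
    the vector appearing there is again one of the vectors in [quad]. *)
Lemma quad_split J w : quad J w =
  \sum_(i in J) col_sqnorm B i * (xi i w ^+ 2 - 1) +
  4 / 2 ^+ m * \sum_(I : {set 'I_m})
     \sum_(i in I) subvec J w i 0 * (B^T *m (B *m subvec (J :\: I)%SET w)) i 0.
Proof.
pose x := subvec J w.
have BJ i j : (B^T *m B) i j = gram i j.
  by rewrite mxE; apply: eq_bigr => k _; rewrite mxE.
have e1 : l2norm (B *m x) ^+ 2 = \sum_i \sum_j x i 0 * (gram i j * x j 0).
  rewrite -dotpp dotp_trmx mulmxA; apply: eq_bigr => i _.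
  by rewrite [X in _ * X]mxE mulr_sumr; apply: eq_bigr => j _; rewrite BJ.
have e2 (I : {set 'I_m}) :
    \sum_(i in I) x i 0 * (B^T *m (B *m subvec (J :\: I)%SET w)) i 0 =
    \sum_(i in I) \sum_(j | j \notin I) x i 0 * (gram i j * x j 0).
  apply: eq_bigr => i iI; rewrite mulmxA [X in _ * X = _]mxE mulr_sumr [RHS]big_mkcond.
  apply: eq_bigr => j _; rewrite BJ /x !mxE !inE.
  by case: (j \in I); case: (j \in J); rewrite //= !mulr0.
have e3 : 4 / 2 ^+ m * \sum_(I : {set 'I_m})
     \sum_(i in I) x i 0 * (B^T *m (B *m subvec (J :\: I)%SET w)) i 0 =
   \sum_i \sum_(j | j != i) x i 0 * (gram i j * x j 0).
  by rewrite decoupling; congr (_ * _); apply: eq_bigr => I _.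
rewrite -/x e3 /quad -/x e1.
have e4 : \sum_(i in J) col_sqnorm B i * (xi i w ^+ 2 - 1) =
    \sum_i x i 0 * (gram i i * x i 0) - \sum_(i in J) col_sqnorm B i.
  rewrite [X in _ = X - _](_ : _ = \sum_(i in J) col_sqnorm B i * xi i w ^+ 2); last first.
    rewrite [RHS]big_mkcond; apply: eq_bigr => i _; rewrite /x mxE.
    have -> : gram i i = col_sqnorm B i by apply: eq_bigr => k _; rewrite expr2.
    by case: ifP => _; [ring|rewrite mul0r].
  by rewrite -sumrB; apply: eq_bigr => i _; ring.
rewrite e4 addrAC -big_split /=; congr (_ - _); apply: eq_bigr => i _.
by rewrite (bigD1 i).
Qed.

Lemma powD_le (x y : R) n : 0 <= x -> 0 <= y ->
  (x + y) ^+ n <= 2 ^+ n * (x ^+ n + y ^+ n).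
Proof.
move=> x0 y0; have [xy|/ltW xy] := lerP x y.
  apply: (@le_trans _ _ ((2 * y) ^+ n)).
    by apply: lerXn2r; rewrite ?nnegrE ?addr_ge0 ?mulr_ge0//; lra.
  by rewrite exprMn ler_wpM2l ?exprn_ge0// lerDr exprn_ge0.
apply: (@le_trans _ _ ((2 * x) ^+ n)).
  by apply: lerXn2r; rewrite ?nnegrE ?addr_ge0 ?mulr_ge0//; lra.
by rewrite exprMn ler_wpM2l ?exprn_ge0// lerDl exprn_ge0.
Qed.

Lemma even_powD_le (x y : R) n :
  (x + y) ^+ (2 * n) <= 2 ^+ (2 * n) * (x ^+ (2 * n) + y ^+ (2 * n)).
Proof.
have ab (z : R) : z ^+ (2 * n) = `|z| ^+ (2 * n).
  by rewrite !exprM real_normK ?num_real.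
rewrite !(ab x) !(ab y) (ab (x + y)); apply: le_trans _ (powD_le _ _ _); rewrite ?normr_ge0//.
by apply: lerXn2r; rewrite ?nnegrE ?addr_ge0// ler_normD.
Qed.

(** Convexity: the power lies above its tangent at [a]. When [a] is the mean, the linear terms
    cancel on summation, which gives Jensen's inequality in [expr_mean_le]. *)
Lemma expr_tangent_le (t a : R) n : 0 <= t -> 0 <= a ->
  a ^+ n.+1 + n.+1%:R * a ^+ n * (t - a) <= t ^+ n.+1.
Proof.
move=> t0 a0; elim: n => [|n ih]; first by rewrite expr0 !expr1; lra.
rewrite [t ^+ n.+2]exprS; apply: le_trans (ler_wpM2l t0 ih).
rewrite !exprS -![n.+2%:R]natr1.
have : 0 <= n.+1%:R * a ^+ n * (t - a) ^+ 2 by rewrite mulr_ge0 ?sqr_ge0// mulr_ge0// exprn_ge0.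
set b := a ^+ n; set c := n.+1%:R; nra.
Qed.

Lemma expr_mean_le (I : finType) (f : I -> R) n : (0 < #|I|)%N ->
  (forall i, 0 <= f i) ->
  ((\sum_i f i) / #|I|%:R) ^+ n.+1 <= (\sum_i f i ^+ n.+1) / #|I|%:R.
Proof.
move=> I0 f0; have N0 : (0 : R) < #|I|%:R by rewrite ltr0n.
set a := (\sum_i f i) / _; have a0 : 0 <= a by rewrite divr_ge0// sumr_ge0.
rewrite ler_pdivlMr//.
have -> : a ^+ n.+1 * #|I|%:R = \sum_i (a ^+ n.+1 + n.+1%:R * a ^+ n * (f i - a)).
  rewrite big_split /= -mulr_sumr sumrB !sumr_const -(mulr_natr (a ^+ n.+1)) -(mulr_natr a).
  have -> : \sum_i f i = a * #|I|%:R by rewrite /a divfK// gt_eqF.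
  by rewrite subrr mulr0 addr0.
by apply: ler_sum => i _; exact: expr_tangent_le.
Qed.

(** From g s <= (g^2 + s^2) / 2 with s = sqrt X. *)
Lemma le_of_sqrt_recursion (X A g : R) : 0 <= X -> X <= A + g * Num.sqrt X ->
  X <= 2 * A + g ^+ 2.
Proof.
move=> X0 h1; have e : X = Num.sqrt X ^+ 2 by rewrite sqr_sqrtr.
by move: e h1; set s := Num.sqrt X => e h1; have := sqr_ge0 (g - s); nra.
Qed.

(** For each I the form is linear in the coordinates of I and J together, with coefficients the
    entries of B^T B v for a v supported on J minus I; their squares sum to at most |B|_op^2 |B
    v|^2. By Cauchy-Schwarz the q-th moment of |B v|^2 is at most the root of its 2q-th moment,
    whence sqrt X. *)
Lemma offdiag_moment (J : {set 'I_m}) (X : R) :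
  (forall J', E (fun w => quad J' w ^+ (2 * q)) <= X) ->
  E (fun w => (4 / 2 ^+ m * \sum_(I : {set 'I_m})
     \sum_(i in I) subvec J w i 0 * (B^T *m (B *m subvec (J :\: I)%SET w)) i 0) ^+ (2 * q))
  <= (32 * L * o ^+ 2) ^+ q * (H ^+ (2 * q) + Num.sqrt X).
Proof.
move=> hX.
have X0 : 0 <= X.
  apply: le_trans (hX J); apply: Ex_ge0 => w; rewrite exprM exprn_ge0 ?sqr_ge0//.
have L0 := linear_const_ge0 q kap.
have N (J' : {set 'I_m}) : E (fun w => (l2norm (B *m subvec J' w) ^+ 2) ^+ q) <=
    2 ^+ q * (H ^+ (2 * q) + Num.sqrt X).
  have m1 := polynomial_moments xi_moments (polynomial_sqnorm J').
  have m2 := quad_moments J'.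
  have H2 : E (fun w => (l2norm (B *m subvec J' w) ^+ 2) ^+ (2 * q)) <=
      2 ^+ (2 * q) * (H ^+ (2 * (2 * q)) + X).
    apply: (@le_trans _ _ (E (fun w => 2 ^+ (2 * q) * (H ^+ (2 * (2 * q)) + quad J' w ^+ (2 * q))))).
      apply: Ex_le.
      - exact: all_moments_intgX.
      - apply: intgZ; apply: intgD; first exact: intg_cst.
        exact: all_moments_intgX.
      move=> w.
      have -> : H ^+ (2 * (2 * q)) = (H ^+ 2) ^+ (2 * q) by rewrite exprM.
      have ab (z : R) : z ^+ (2 * q) = `|z| ^+ (2 * q).
        by rewrite !exprM real_normK ?num_real.
      rewrite (ab (quad J' w)); apply: le_trans _ (powD_le _ _ _); rewrite ?sqr_ge0//.
      apply: lerXn2r; rewrite ?nnegrE ?addr_ge0 ?sqr_ge0//.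
      have : \sum_(i in J') col_sqnorm B i <= H ^+ 2.
        rewrite hs_norm_sqr [leRHS](bigID (mem J'))/= lerDl.
        by apply: sumr_ge0 => i _; exact: col_sqnorm_ge0.
      have := ler_norm (quad J' w); rewrite {1}/quad; lra.
    rewrite ExZ; last by apply: intgD; [exact: intg_cst|exact: all_moments_intgX].
    rewrite ExD; [|exact: intg_cst|exact: all_moments_intgX].
    by rewrite Ex_cst ler_wpM2l ?exprn_ge0// lerD2l.
  have Y0 : 0 <= E (fun w => (l2norm (B *m subvec J' w) ^+ 2) ^+ q).
    by apply: Ex_ge0 => w; rewrite exprn_ge0// sqr_ge0.
  have Z0 : 0 <= 2 ^+ q * (H ^+ (2 * q) + Num.sqrt X).
    by rewrite mulr_ge0 ?exprn_ge0// addr_ge0 ?sqrtr_ge0// exprn_ge0// hs_norm_ge0.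
  rewrite -ler_sqr ?nnegrE//; apply: le_trans (Ex_sqr_le _) _; first exact: all_momentsX.
  under eq_fun do rewrite -exprM mulnC.
  apply: le_trans H2 _; rewrite exprMn -exprM mulnC ler_wpM2l ?exprn_ge0//.
  rewrite [(2 * (q * 2))%N]mulnC exprM -[X in _ + X <= _](sqr_sqrtr X0).
  have := mulr_ge0 (exprn_ge0 (q * 2) (hs_norm_ge0 B)) (sqrtr_ge0 X).
  set a := H ^+ _; set b := Num.sqrt X; nra.
pose O (I : {set 'I_m}) w :=
  \sum_(i in I) subvec J w i 0 * (B^T *m (B *m subvec (J :\: I)%SET w)) i 0.
have polO I : poly [set: 'I_m]%SET (O I).
  apply: polynomial_in_sum => i _; apply: polynomial_inM.
    by apply: polynomial_in_sub (polynomial_subvec J i); exact: finset.subsetT.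
  under eq_fun do rewrite mulmxA.
  by apply: polynomial_in_sub (polynomial_mulmx _ _ _); exact: finset.subsetT.
have mO I := polynomial_moments xi_moments (polO I).
have EO I : E (fun w => O I w ^+ (2 * q)) <= (2 * L * o ^+ 2) ^+ q * (H ^+ (2 * q) + Num.sqrt X).
  pose c i w := (B^T *m (B *m subvec (J :\: I)%SET w)) i 0.
  have hc i : poly (J :\: I)%SET (c i).
    by rewrite /c; under eq_fun do rewrite mulmxA; exact: polynomial_mulmx.
  have -> : O I = fun w => \sum_(i in (I :&: J)%SET) c i w * xi i w.
    apply/funext => w; rewrite /O big_mkcond [RHS]big_mkcond; apply: eq_bigr => i _.
    rewrite mxE !inE; case: (i \in I); case: (i \in J) => //=; by rewrite ?mul0r// mulrC.
  apply: le_trans (linear_moment_random xi_moments xi_indep q0 kap0 xi_mean xi_even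
    (J := (J :\: I)%SET) _ _) _.
  - by move=> i; rewrite !inE => /andP[-> _].
  - by move=> i _; exact: hc.
  have mc i : all_moments P (c i) := polynomial_moments xi_moments (hc i).
  have mB := polynomial_moments xi_moments (polynomial_sqnorm (J :\: I)%SET).
  apply: (@le_trans _ _ (E (fun w => (L * o ^+ 2) ^+ q *
      (l2norm (B *m subvec (J :\: I)%SET w) ^+ 2) ^+ q))).
    apply: Ex_le.
    - apply: all_moments_intgX; apply: all_momentsZ; apply: all_moments_sum => i _.
      exact: all_momentsX.
    - by apply: intgZ; exact: all_moments_intgX.
    move=> w; rewrite -exprMn; apply: lerXn2r; rewrite ?nnegrE.
    - by rewrite mulr_ge0// sumr_ge0// => i _; exact: sqr_ge0.
    - by apply: mulr_ge0; [apply: mulr_ge0|]; rewrite ?sqr_ge0.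
    rewrite -(mulrA L) ler_wpM2l//.
    apply: (@le_trans _ _ (\sum_i c i w ^+ 2)).
      rewrite [leRHS](bigID (mem (I :&: J)%SET)) /= lerDl.
      by apply: sumr_ge0 => i _; exact: sqr_ge0.
    rewrite -l2norm_sqr -exprMn; apply: lerXn2r; rewrite ?nnegrE ?mulr_ge0 ?l2norm_ge0 ?op_norm_ge0//.
    exact: l2norm_trmulmx_le.
  rewrite ExZ; last exact: all_moments_intgX.
  rewrite -(mulrA 2 L) (exprMn q 2) [2 ^+ q * _]mulrC -(mulrA ((L * _) ^+ q)).
  apply: ler_wpM2l; last exact: N.
  by rewrite exprn_ge0// mulr_ge0// sqr_ge0.
have cardI : #|{set 'I_m}|%:R = 2 ^+ m :> R.
  by rewrite -cardsT -powersetT card_powerset cardsT card_ord natrX.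
have cI : (0 < #|{set 'I_m}|)%N.
  by rewrite -cardsT -powersetT card_powerset expn_gt0.
have p0 : (0 : R) < 2 ^+ m by rewrite exprn_gt0.
(* The prefactor makes the sum 4 times an average over the 2^m index sets, so Jensen's inequality
   moves the power inside. The resulting 16^q and the factor 2 of [EO] combine to 32^q. *)
apply: (@le_trans _ _ (E (fun w => 4 ^+ (2 * q) / 2 ^+ m * \sum_I O I w ^+ (2 * q)))).
  apply: Ex_le.
  - apply: all_moments_intgX; apply: all_momentsZ; apply: all_moments_sum => I _.
    exact: mO.
  - by apply: intgZ; apply: intg_sum => I _; apply: all_moments_intgX; exact: mO.
  move=> w; rewrite -/(O _ w) -mulrA exprMn -mulrA ler_wpM2l ?exprn_ge0//.
  have ab (z : R) : z ^+ (2 * q) = `|z| ^+ (2 * q).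
    by rewrite !exprM real_normK ?num_real.
  have := @expr_mean_le _ (fun I => `|O I w|) (2 * q).-1 cI (fun I => normr_ge0 _).
  rewrite prednK ?muln_gt0// cardI => hm.
  have -> : \sum_I O I w ^+ (2 * q) = \sum_I `|O I w| ^+ (2 * q).
    by apply: eq_bigr => I _; rewrite -ab.
  rewrite ab [leRHS]mulrC.
  apply: le_trans hm; apply: lerXn2r; rewrite ?nnegrE ?divr_ge0 ?sumr_ge0 ?(ltW p0)//.
  rewrite normrM ger0_norm ?invr_ge0 ?(ltW p0)// mulrC ler_wpM2r ?invr_ge0 ?(ltW p0)//.
  exact: ler_norm_sum.
rewrite ExZ; last by apply: intg_sum => I _; apply: all_moments_intgX; exact: mO.
rewrite Ex_sum; last by move=> I _; apply: all_moments_intgX; exact: mO.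
set r := _ + Num.sqrt X in EO *.
apply: (@le_trans _ _ (4 ^+ (2 * q) / 2 ^+ m * \sum_(I : {set 'I_m}) (2 * L * o ^+ 2) ^+ q * r)).
  rewrite ler_wpM2l ?divr_ge0 ?exprn_ge0//; apply: ler_sum => I _; exact: EO.
set t := _ * r; have -> : \sum_(I : {set 'I_m}) t = 2 ^+ m * t.
  by rewrite sumr_const -cardI mulr_natl.
rewrite (mulrA _ (2 ^+ m)) divfK ?gt_eqF// /t (mulrA (4 ^+ _)) exprM -exprMn.
by rewrite le_eqVlt; apply/orP; left; apply/eqP; congr (_ ^+ _ * _); ring.
Qed.

(* The off-diagonal moments are controlled by those of the same forms restricted
   to smaller index sets, so the worst subset satisfies a self-bounding
   inequality. *)
Lemma quad_moment (Y : R) : 0 < Y -> q%:R * (sig * (o * H)) ^+ 2 <= Y ^+ 2 ->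
  2 * q%:R * h * o ^+ 2 <= Y -> forall J,
  E (fun w => quad J w ^+ (2 * q)) <=
  (8 * expR 1 * Y + 24 * (Num.sqrt L * o * H) + 128 * L * o ^+ 2) ^+ (2 * q).
Proof.
move=> Y0 YH Yo.
have L0 := linear_const_ge0 q kap.
have o0 := op_norm_ge0 B; have H0 := hs_norm_ge0 B; have e0 := expR_ge0 (1 : R).
pose F (J : {set 'I_m}) := E (fun w => quad J w ^+ (2 * q)).
have F0 J : 0 <= F J by apply: Ex_ge0 => w; rewrite exprM exprn_ge0 ?sqr_ge0.
have [J0 _ hJ0] : exists2 J0, true & forall J, F J <= F J0.
  by case: (@arg_maxP _ _ _ finset.set0 xpredT F isT) => J0 _ hJ; exists J0 => // J; exact: hJ.
set X := F J0 in hJ0.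
have D J : E (fun w => (\sum_(i in J) col_sqnorm B i * (xi i w ^+ 2 - 1)) ^+ (2 * q)) <=
    (2 * expR 1 * Y) ^+ (2 * q).
  pose a i := if i \in J then col_sqnorm B i else 0.
  have -> : (fun w => (\sum_(i in J) col_sqnorm B i * (xi i w ^+ 2 - 1)) ^+ (2 * q)) =
      (fun w => (\sum_i a i * (xi i w ^+ 2 - 1)) ^+ (2 * q)).
    apply/funext => w; congr (_ ^+ _); rewrite big_mkcond; apply: eq_bigr => i _.
    by rewrite /a; case: ifP => // _; rewrite mul0r.
  have aC i : 0 <= a i <= col_sqnorm B i.
    by rewrite /a; case: ifP; rewrite ?lexx ?col_sqnorm_ge0.
  apply: (square_sum_moment xi_moments xi_indep (sig := sig) (h := h)) => //.
  - by move=> i; have /andP[] := aC i.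
  - apply: le_trans YH; rewrite exprMn -mulrA ler_wpM2l// ler_wpM2l ?sqr_ge0//.
    apply: le_trans (sum_col_sqnorm_sqr B); apply: ler_sum => i _.
    by have /andP[a0 aC'] := aC i; apply: lerXn2r; rewrite ?nnegrE ?col_sqnorm_ge0.
  - move=> i; apply: le_trans Yo; rewrite ler_wpM2l ?mulr_ge0//.
    by have /andP[_] := aC i; move=> /le_trans; apply; exact: col_sqnorm_le.
set D0 := (2 * expR 1 * Y) ^+ (2 * q) in D.
set g := (128 * L * o ^+ 2) ^+ q.
have XX : X <= (2 ^+ (2 * q) * D0 + g * H ^+ (2 * q)) + g * Num.sqrt X.
  rewrite {1}/X /F.
  pose dia w := \sum_(i in J0) col_sqnorm B i * (xi i w ^+ 2 - 1).
  pose off w := 4 / 2 ^+ m * \sum_(I : {set 'I_m})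
     \sum_(i in I) subvec J0 w i 0 * (B^T *m (B *m subvec (J0 :\: I)%SET w)) i 0.
  have mdia : all_moments P dia.
    apply: all_moments_sum => i _; apply: all_momentsZ; apply: all_momentsB.
      exact: all_momentsX.
    exact: all_moments_cst.
  have moff : all_moments P off.
    have -> : off = fun w => quad J0 w - dia w by apply/funext => w; rewrite quad_split addrAC subrr add0r.
    by apply: all_momentsB => //; exact: quad_moments.
  have := offdiag_moment J0 hJ0; rewrite -/(off _) => hoff.
  apply: (@le_trans _ _ (E (fun w => 2 ^+ (2 * q) * (dia w ^+ (2 * q) + off w ^+ (2 * q))))).
    apply: Ex_le.
    - by apply: all_moments_intgX; exact: quad_moments.
    - by apply: intgZ; apply: intgD; exact: all_moments_intgX.
    by move=> w; rewrite quad_split; exact: even_powD_le.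
  rewrite ExZ; last by apply: intgD; exact: all_moments_intgX.
  rewrite ExD; [|exact: all_moments_intgX..].
  apply: (@le_trans _ _ (2 ^+ (2 * q) * (D0 + (32 * L * o ^+ 2) ^+ q * (H ^+ (2 * q) + Num.sqrt X)))).
    rewrite ler_wpM2l ?exprn_ge0//; apply: lerD; [exact: D|exact: hoff].
  have -> : g = 2 ^+ (2 * q) * (32 * L * o ^+ 2) ^+ q.
    by rewrite exprM -exprMn; congr (_ ^+ _); ring.
  by rewrite le_eqVlt; apply/orP; left; apply/eqP; ring.
move=> J; apply: le_trans (hJ0 J) _.
apply: le_trans (le_of_sqrt_recursion (F0 J0) XX) _.
have -> : 2 * (2 ^+ (2 * q) * D0 + g * H ^+ (2 * q)) + g ^+ 2 =
   2 * (4 * expR 1 * Y) ^+ (2 * q) + 2 * (Num.sqrt (128 * L) * o * H) ^+ (2 * q) +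
   (128 * L * o ^+ 2) ^+ (2 * q).
  rewrite /D0 -exprMn /g -exprM [(q * 2)%N]mulnC mulrDr; congr (_ + _ + _).
    by congr (_ * _ ^+ _); ring.
  rewrite [in RHS]exprM !(exprMn 2) sqr_sqrtr; last by rewrite mulr_ge0.
  by rewrite [in RHS](exprMn q) -(exprM H).
have sum_le (x y : R) n : 0 <= x -> 0 <= y -> x ^+ n.+1 + y ^+ n.+1 <= (x + y) ^+ n.+1.
  move=> x0 y0; elim: n => [|n ih]; first by rewrite !expr1.
  rewrite ![_ ^+ n.+2]exprS; apply: le_trans (ler_wpM2l (addr_ge0 x0 y0) ih).
  have : 0 <= x ^+ n.+1 by rewrite exprn_ge0.
  have : 0 <= y ^+ n.+1 by rewrite exprn_ge0.
  set a := x ^+ _; set b := y ^+ _; nra.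
have two x : 0 <= x -> 2 * x ^+ (2 * q) <= (2 * x) ^+ (2 * q).
  move=> x0; rewrite exprMn ler_wpM2r ?exprn_ge0// -{1}[2]expr1 ler_weXn2l ?muln_gt0//.
  by rewrite ler1n.
have s12 : 2 * Num.sqrt (128 * L) <= 24 * Num.sqrt L.
  rewrite sqrtrM// mulrA ler_wpM2r ?sqrtr_ge0//.
  have : Num.sqrt 128 <= 12 :> R.
    by rewrite -[leRHS]ger0_norm// -sqrtr_sqr ler_wsqrtr//; lra.
  lra.
have Y0' := ltW Y0; have k0' := ltW kap0.
have sL := sqrtr_ge0 L; have sL' := sqrtr_ge0 (128 * L).
apply: (@le_trans _ _ ((2 * (4 * expR 1 * Y) + 2 * (Num.sqrt (128 * L) * o * H) + 128 * L * o ^+ 2) ^+ (2 * q))).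
  have -> : (2 * q = (2 * q).-1.+1)%N by rewrite prednK// muln_gt0.
  apply: le_trans (sum_le _ _ _ _ _); rewrite ?addr_ge0 ?mulr_ge0 ?sqr_ge0//.
  rewrite lerD2r; apply: le_trans (sum_le _ _ _ _ _); rewrite ?mulr_ge0//.
  rewrite prednK ?muln_gt0//; apply: lerD; apply: two; by rewrite ?mulr_ge0.
apply: lerXn2r; rewrite ?nnegrE ?addr_ge0 ?mulr_ge0 ?sqr_ge0//.
rewrite lerD2r; apply: lerD; first by rewrite !mulrA -natrM.
by have := ler_wpM2r (mulr_ge0 o0 H0) s12; set a := Num.sqrt _; set b := Num.sqrt L; lra.
Qed.

End QuadraticForm.

(** * Moment growth under a psi_alpha bound *)

Section PsiMoments.
Context d (Omega : measurableType d) (R : realType) (P : probability Omega R).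
Local Notation E := (Ex P).

(** Raise y / a <= exp(y / a) to the power a. *)
Lemma powR_le_expR (a y : R) : 0 < a -> 0 <= y -> y `^ a <= a `^ a * expR y.
Proof.
move=> a0 y0; have ya0 : 0 <= y / a by rewrite divr_ge0// ltW.
rewrite -[in leLHS](divfK (lt0r_neq0 a0) y) mulrC powRM//; last exact: ltW.
rewrite ler_wpM2l ?powR_ge0//.
have -> : expR y = expR (y / a) `^ a by rewrite -expRM divfK// lt0r_neq0.
apply: ge0_ler_powR; rewrite ?nnegrE ?expR_ge0 ?(ltW a0)//.
by apply: le_trans (expR_ge1Dx _); rewrite lerDr.
Qed.

(* With beta = 1/alpha this is the moment form of a psi_alpha bound. *)
Definition moment_growth (beta tau : R) (f : Omega -> R) :=
  forall r, (0 < r)%N -> E (fun w => `|f w| ^+ r) <= 2 * (tau * r%:R `^ beta) ^+ r.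

(** Apply [powR_le_expR] to |f / t|^alpha with exponent r / alpha. The factor 2 in [moment_growth]
    is the bound on the exponential moment. *)
Lemma psi_moments (alpha t : R) (f : Omega -> R) :
  0 < alpha -> 0 < t -> measurable_fun setT f ->
  (\int[P]_w (expR (`|f w / t| `^ alpha))%:E <= 2%:E)%E ->
  all_moments P f /\ moment_growth alpha^-1 (t * alpha^-1 `^ alpha^-1) f.
Proof.
move=> a0 t0 mf hE; pose G w := expR (`|f w / t| `^ alpha).
have mG : measurable_fun setT G.
  apply: measurableT_comp; first exact: measurable_expR.
  apply: (measurableT_comp (measurable_powR alpha)).
  by apply: measurableT_comp => //; exact: measurable_funM.
have iG : intg P G.
  apply/integrableP; split; first exact/measurable_EFinP.
  apply: le_lt_trans (ltry 2); apply: le_trans hE.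
  rewrite le_eqVlt; apply/orP; left; apply/eqP; apply: eq_integral => w _.
  by rewrite /= ger0_norm// expR_ge0.
have EG : E G <= 2 by rewrite -lee_fin -Ex_EFin.
have b0 : 0 < alpha^-1 by rewrite invr_gt0.
have key r w : (0 < r)%N ->
    `|f w| ^+ r <= (t * (alpha^-1 `^ alpha^-1 * r%:R `^ alpha^-1)) ^+ r * G w.
  move=> r0; have rb : 0 < r%:R * alpha^-1 by rewrite mulr_gt0// ltr0n.
  have e1 : (r%:R * alpha^-1) `^ (r%:R * alpha^-1) =
      (alpha^-1 `^ alpha^-1 * r%:R `^ alpha^-1) ^+ r.
    rewrite -powRM ?(ltW b0)// -powR_mulrn ?powR_ge0// -powRrM.
    by rewrite [alpha^-1 * r%:R]mulrC.
  have e2 : (`|f w / t| `^ alpha) `^ (r%:R * alpha^-1) = `|f w| ^+ r / t ^+ r.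
    rewrite -powRrM mulrCA mulfV ?lt0r_neq0// mulr1 powR_mulrn//.
    by rewrite normrM normfV (gtr0_norm t0) exprMn exprVn.
  have := powR_le_expR rb (powR_ge0 `|f w / t| alpha).
  rewrite e1 e2 -/(G w) ler_pdivrMr ?exprn_gt0// => /le_trans; apply.
  by rewrite mulrAC [in leRHS]exprMn [t ^+ r * _]mulrC.
have am : all_moments P f.
  apply: all_momentsP => // -[|r].
    by under eq_fun do rewrite expr0; exact: intg_cst.
  apply: intg_dom (intgZ _ iG) _ => [|w].
    by apply: measurable_funX; exact: measurableT_comp.
  by rewrite ger0_norm ?exprn_ge0//; exact: key.
split=> // r r0.
apply: (@le_trans _ _ (E (fun w => (t * (alpha^-1 `^ alpha^-1 * r%:R `^ alpha^-1)) ^+ r * G w))).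
  apply: Ex_le => [||w]; [|exact: intgZ|exact: key].
  by apply: all_moments_intgX; exact: all_moments_abs.
rewrite ExZ// mulrA mulrC ler_wpM2r//.
by rewrite exprn_ge0// mulr_ge0 ?mulr_ge0 ?powR_ge0// ltW.
Qed.

End PsiMoments.

(** * The quadratic form under moment growth *)

Section QuadraticFormPsi.
Context d (Omega : measurableType d) (R : realType) (P : probability Omega R).
Local Notation E := (Ex P).
Variable beta : R.
Hypothesis beta_ge : 1 / 2 <= beta.
Let gam : R := 2 * beta - 1.

(** The bound on E f^2 that [moment_growth] gives at r = 2, hence at least 1 for a variable of unit
    variance. *)
Definition growth_const (tau : R) : R := 2 * tau ^+ 2 * 4 `^ beta.

Definition quad_const : R :=
  8 * expR 1 ^+ 2 * 4 `^ gam * (2 + 4 `^ beta) + 512 * expR 1 ^+ 3.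

Let beta_ge0 : 0 <= beta. Proof. by have := beta_ge; lra. Qed.
Let gam_ge0 : 0 <= gam. Proof. by rewrite /gam; have := beta_ge; lra. Qed.

Lemma quad_const_ge0 : 0 <= quad_const.
Proof.
have e0 := expR_ge0 (1 : R); have p1 := powR_ge0 (4 : R) gam; have p2 := powR_ge0 (4 : R) beta.
apply: addr_ge0; last by apply: mulr_ge0; rewrite ?ler0n ?exprn_ge0.
apply: mulr_ge0; last exact: addr_ge0.
by apply: mulr_ge0 => //; apply: mulr_ge0; rewrite ?ler0n ?exprn_ge0.
Qed.

Lemma pow_self_le n : (n%:R : R) ^+ n <= expR 1 ^+ n * n`!%:R.
Proof.
have f0 : (0 : R) < n`!%:R by rewrite ltr0n fact_gt0.
rewrite -expRM_natl mulr1 -ler_pdivrMr//.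
apply: le_trans (sum_expr_fact_le_expR n.+1 (ler0n R n)).
rewrite big_ord_recr /= lerDr; apply: sumr_ge0 => i _.
by rewrite divr_ge0// exprn_ge0.
Qed.

Lemma powR2beta (x : R) : 0 <= x -> x `^ beta ^+ 2 = x `^ (2 * beta).
Proof. by move=> x0; rewrite mulrC powRrM powR_mulrn ?powR_ge0. Qed.

Lemma powR2beta_gam (x : R) : 0 < x -> x `^ beta ^+ 2 = x * x `^ gam.
Proof.
move=> x0; rewrite powR2beta ?ltW// (_ : 2 * beta = 1 + gam); last by rewrite /gam; ring.
rewrite powRD ?powRr1 ?ltW//; apply/implyP => _; exact: lt0r_neq0.
Qed.

Lemma four_powR_beta : (4 : R) `^ beta = 2 `^ beta ^+ 2.
Proof.
rewrite (_ : 4 = 2 * 2 :> R); last by ring.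
by rewrite powRM ?expr2.
Qed.

Section one.
Variables (tau : R) (f : Omega -> R).
Hypotheses (tau0 : 0 <= tau) (hf : all_moments P f).
Hypothesis f_var : E (fun w => f w ^+ 2) = 1.
Hypothesis f_growth : moment_growth P beta tau f.
Local Notation kap0 := (growth_const tau).

Lemma growth_const_ge1 : 1 <= kap0.
Proof.
have := f_growth (ltn0Sn 1).
have -> : (fun w => `|f w| ^+ 2) = fun w => f w ^+ 2.
  by apply/funext => w; rewrite real_normK ?num_real.
by rewrite f_var exprMn -four_powR_beta mulrA.
Qed.

(** In the bound of order 2j the factor (2j)^gam is frozen at (2q)^gam; what remains is subgaussian
    growth, by j^j <= e^j j!. *)
Lemma even_growth q j : (0 < j <= q)%N ->
  E (fun w => f w ^+ (2 * j)) <=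
  Num.sqrt (4 * expR 1 * tau ^+ 2 * (2 * q%:R) `^ gam) ^+ (2 * j) * j`!%:R.
Proof.
move=> /andP[j0 jq].
have e0 := expR_ge0 (1 : R); have j0' : (0 : R) < j%:R by rewrite ltr0n.
have pg := powR_ge0 (2 * q%:R : R) gam.
have X0 : 0 <= 4 * expR 1 * tau ^+ 2 * (2 * q%:R) `^ gam.
  by apply: mulr_ge0 => //; apply: mulr_ge0; rewrite ?sqr_ge0// mulr_ge0.
rewrite exprM sqr_sqrtr//.
have -> : (fun w => f w ^+ (2 * j)) = fun w => `|f w| ^+ (2 * j).
  by apply/funext => w; rewrite !exprM real_normK ?num_real.
have j2 : (0 < 2 * j)%N by rewrite muln_gt0.
apply: le_trans (f_growth j2) _.
rewrite exprM (exprMn 2) powR2beta_gam; last by rewrite ltr0n.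
apply: (@le_trans _ _ (2 * (tau ^+ 2 * (2 * j%:R * (2 * q%:R) `^ gam)) ^+ j)).
  rewrite ler_wpM2l//; apply: lerXn2r; rewrite ?nnegrE.
  - by apply: mulr_ge0; rewrite ?sqr_ge0// mulr_ge0 ?powR_ge0.
  - by apply: mulr_ge0; rewrite ?sqr_ge0// mulr_ge0 ?powR_ge0// mulr_ge0.
  rewrite ler_wpM2l ?sqr_ge0// natrM ler_wpM2l ?mulr_ge0//.
  by apply: ge0_ler_powR; rewrite ?nnegrE ?mulr_ge0// ler_wpM2l// ler_nat.
rewrite (_ : tau ^+ 2 * _ = (2 * tau ^+ 2 * (2 * q%:R) `^ gam) * j%:R); last by ring.
rewrite (exprMn j (2 * tau ^+ 2 * (2 * q%:R) `^ gam)).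
set Z := _ * _ `^ gam; have Z0 : 0 <= Z.
  by apply: mulr_ge0 => //; apply: mulr_ge0; rewrite ?sqr_ge0.
apply: (@le_trans _ _ (2 ^+ j * (Z ^+ j * (expR 1 ^+ j * j`!%:R)))).
  apply: ler_pM => //.
  - by rewrite mulr_ge0// exprn_ge0.
  - by rewrite -{1}[2]expr1 ler_weXn2l// ler1n.
  - by rewrite ler_wpM2l ?exprn_ge0// pow_self_le.
rewrite !mulrA -!exprMn le_eqVlt; apply/orP; left; apply/eqP; congr (_ ^+ _ * _).
by rewrite /Z; ring.
Qed.

Let A := expR 1 * kap0 * 4 `^ gam.

(** Of the k factors k^gam only k - 2 are frozen at (2q)^gam; the other two are absorbed by k^2 <=
    4^k. The variance parameter 2A is thus free of q, and the diagonal part fits under q^beta |B|_op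
    |B|_HS because q <= q^(2 beta). *)
Lemma sqr_growth q k : (2 <= k <= 2 * q)%N ->
  `|E (fun w => (f w ^+ 2 - 1) ^+ k)| <=
  k`!%:R * (2 * A) ^+ 2 * (A * (2 * q%:R) `^ gam) ^+ (k - 2).
Proof.
move=> /andP[k2 kq]; have k0 : (0 < k)%N by apply: leq_trans k2.
have kp : (0 : R) < k%:R by rewrite ltr0n.
have kap1 := growth_const_ge1.
have kap_ge0 : 0 <= kap0 by lra.
have e0 := expR_ge0 (1 : R); have p4 := powR_ge0 (4 : R) gam.
have A0 : 0 <= A by rewrite /A !mulr_ge0.
have m1 : all_moments P (fun w => f w ^+ 2 - 1).
  by apply: all_momentsB; [exact: all_momentsX|exact: all_moments_cst].
apply: le_trans (Ex_abs _) _; first exact: all_moments_intgX.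
apply: (@le_trans _ _ (E (fun w => `|f w| ^+ (2 * k) + 1))).
  apply: Ex_le.
  - by apply: intg_abs; exact: all_moments_intgX.
  - apply: intgD; last exact: intg_cst.
    by apply: all_moments_intgX; exact: all_moments_abs.
  move=> w; rewrite normrX exprM real_normK ?num_real//.
  have s0 := sqr_ge0 (f w); set x := f w ^+ 2 in s0 *.
  have [x1|x1] := lerP x 1.
    apply: (@le_trans _ _ 1); last by rewrite lerDr exprn_ge0.
    by apply: exprn_ile1; lra.
  apply: (@le_trans _ _ (x ^+ k)); last by rewrite lerDl.
  by apply: lerXn2r; rewrite ?nnegrE; lra.
rewrite ExD; [|by apply: all_moments_intgX; exact: all_moments_abs|exact: intg_cst].
rewrite Ex_cst.
have k2' : (0 < 2 * k)%N by rewrite muln_gt0.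
apply: (@le_trans _ _ (2 * (tau * (2 * k)%:R `^ beta) ^+ (2 * k) + 1)).
  by rewrite lerD2r; exact: f_growth.
set D := kap0 * (k%:R * k%:R `^ gam).
have D0 : 0 <= D by rewrite /D !mulr_ge0 ?powR_ge0.
have -> : (tau * (2 * k)%:R `^ beta) ^+ (2 * k) = (D / 2) ^+ k.
  rewrite exprM; congr (_ ^+ k); rewrite natrM powRM// !exprMn -four_powR_beta.
  by rewrite powR2beta_gam// /D /growth_const; field.
have D1 : 1 <= D.
  rewrite /D; have h1 : 1 <= k%:R :> R by rewrite ler1n.
  have h2 : 1 <= k%:R `^ gam by rewrite -[leLHS](powRr0 k%:R); apply: ler_powR.
  exact: mulr_ege1 kap1 (mulr_ege1 h1 h2).
have Dk : 1 <= D ^+ k by rewrite exprn_ege1.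
apply: (@le_trans _ _ (2 * D ^+ k)).
  have : (2^-1 : R) ^+ k <= 2^-1.
    by rewrite -[leRHS]expr1 ler_wiXn2l// ?invr_ge0//; lra.
  rewrite exprMn; set a := D ^+ k in Dk *; set b := _ ^+ k => b2.
  have := ler_wpM2l (ltac:(lra) : 0 <= a) b2; lra.
have hkk : (k%:R : R) ^+ k <= expR 1 ^+ k * k`!%:R by exact: pow_self_le.
have f0 : (0 : R) <= k`!%:R by [].
have hg2 : ((k%:R : R) `^ gam) ^+ k <= (4 `^ gam) ^+ k * ((2 * q%:R) `^ gam) ^+ (k - 2).
  have pk := powR_ge0 (k%:R : R) gam.
  rewrite -[X in _ ^+ X <= _](subnKC k2) exprD; apply: ler_pM; rewrite ?exprn_ge0//.
    have pX (x : R) n : 0 <= x -> (x `^ gam) ^+ n = (x ^+ n) `^ gam.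
      move=> x0; rewrite -powR_mulrn ?powR_ge0// -powRrM mulrC powRrM.
      by rewrite powR_mulrn.
    rewrite !pX//; apply: ge0_ler_powR; rewrite ?nnegrE ?exprn_ge0//.
    rewrite -natrX -[4]/(4%:R) -natrX ler_nat.
    rewrite -[4%N]/(2 ^ 2)%N -expnM mulnC expnM leq_exp2r//.
    exact: ltnW (ltn_expl _ _).
  apply: lerXn2r; rewrite ?nnegrE ?powR_ge0//.
  by apply: ge0_ler_powR; rewrite ?nnegrE ?mulr_ge0// -natrM ler_nat.
have -> : k`!%:R * (2 * A) ^+ 2 * (A * (2 * q%:R) `^ gam) ^+ (k - 2) =
    4 * (kap0 ^+ k * ((expR 1 ^+ k * k`!%:R) * ((4 `^ gam) ^+ k * ((2 * q%:R) `^ gam) ^+ (k - 2)))).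
  have Ak : A ^+ 2 * A ^+ (k - 2) = A ^+ k by rewrite -exprD subnKC.
  rewrite exprMn [(A * _) ^+ _]exprMn.
  transitivity (4 * k`!%:R * (A ^+ 2 * A ^+ (k - 2)) * ((2 * q%:R) `^ gam) ^+ (k - 2)).
    by ring.
  rewrite Ak /A !exprMn; ring.
apply: ler_pM => //; [by rewrite exprn_ge0|by lra|].
rewrite /D (exprMn k kap0) (exprMn k k%:R) ler_wpM2l ?exprn_ge0//.
by apply: ler_pM; rewrite ?exprn_ge0 ?powR_ge0.
Qed.

End one.

(** The identity 2q (2q)^gam = (2q)^(2 beta) turns the powers of q in [quad_moment] into powers of
    q^beta: the linear constant becomes a multiple of q^(2 beta), and [Y] is the sum of the two
    scales it has to dominate. *)
Lemma quad_moment_psi (m : nat) (xi : 'I_m -> Omega -> R) (tau : R) (q : nat)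
    (l : nat) (B : 'M[R]_(l, m)) :
  (forall i, all_moments P (xi i)) ->
  (forall F : 'I_m -> set R, (forall i, measurable (F i)) ->
    E (fun w => \prod_i \1_(F i) (xi i w)) = \prod_i E (fun w => \1_(F i) (xi i w))) ->
  0 < tau -> (forall i, E (xi i) = 0) -> (forall i, E (fun w => xi i w ^+ 2) = 1) ->
  (forall i, moment_growth P beta tau (xi i)) ->
  1 <= growth_const tau ->
  (0 < q)%N -> 0 < op_norm B -> forall J,
  E (fun w => quad xi B J w ^+ (2 * q)) <=
  (quad_const * growth_const tau * (q%:R `^ beta * op_norm B * hs_norm B +
    (q%:R `^ beta * op_norm B) ^+ 2)) ^+ (2 * q).
Proof.
move=> xm xi0 tau0 xmean xvar xg kap1 q0 o0 J.
set k0 := growth_const tau in kap1 *; set o := op_norm B in o0 *.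
set H := hs_norm B; set th := q%:R `^ beta.
have H0 : 0 <= H := hs_norm_ge0 B.
have q0' : (0 : R) < q%:R by rewrite ltr0n.
have th0 : 0 < th by rewrite powR_gt0.
have e0 : 0 < expR (1 : R) := expR_gt0 1.
have p4 : 0 < (4 : R) `^ gam by rewrite powR_gt0.
have p4b : 0 < (4 : R) `^ beta by rewrite powR_gt0.
pose A := expR 1 * k0 * 4 `^ gam.
have A0 : 0 < A by rewrite /A !mulr_gt0//; lra.
pose sig := 2 * A; pose h := A * (2 * q%:R) `^ gam.
pose kap := Num.sqrt (4 * expR 1 * tau ^+ 2 * (2 * q%:R) `^ gam).
have kapX : 0 < 4 * expR 1 * tau ^+ 2 * (2 * q%:R) `^ gam.
  apply: mulr_gt0; last by rewrite powR_gt0// mulr_gt0.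
  by apply: mulr_gt0; rewrite ?exprn_gt0// mulr_gt0.
have kap_gt0 : 0 < kap by rewrite sqrtr_gt0.
have th2 : q%:R * (2 * q%:R) `^ gam = 4 `^ beta * th ^+ 2 / 2.
  apply: (@mulfI _ 2) => //; rewrite mulrA -powR2beta_gam ?mulr_gt0//.
  by rewrite powRM// exprMn -four_powR_beta -/th; field.
have LE : linear_const q kap = 4 * expR 1 ^+ 3 * k0 * th ^+ 2.
  rewrite /linear_const sqr_sqrtr ?ltW//.
  have -> : expR (2 : R) = expR 1 ^+ 2 by rewrite -expRM_natl mulr1.
  transitivity (16 * tau ^+ 2 * expR 1 ^+ 3 * (q%:R * (2 * q%:R) `^ gam)); first by ring.
  by rewrite th2 /k0 /growth_const; field.
pose Y := 2 * A * th * o * H + A * 4 `^ beta * th ^+ 2 * o ^+ 2.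
have Y1 : 0 <= 2 * A * th * o * H by rewrite !mulr_ge0// ltW.
have Y2 : 0 < A * 4 `^ beta * th ^+ 2 * o ^+ 2.
  by apply: mulr_gt0; rewrite ?exprn_gt0//; apply: mulr_gt0; rewrite ?exprn_gt0// mulr_gt0.
have Y0 : 0 < Y by rewrite /Y ltr_wpDl.
have qth : q%:R <= th ^+ 2.
  rewrite (powR2beta (ltW q0')); apply: le1r_powR; first by rewrite ler1n.
  by have := beta_ge; lra.
have sig0 : 0 <= sig by rewrite mulr_ge0// ltW.
have h0 : 0 <= h by rewrite mulr_ge0 ?powR_ge0// ltW.
have Ysig : q%:R * (sig * (o * H)) ^+ 2 <= Y ^+ 2.
  apply: (@le_trans _ _ ((2 * A * th * o * H) ^+ 2)).
    rewrite (_ : (2 * A * th * o * H) ^+ 2 = th ^+ 2 * (sig * (o * H)) ^+ 2); last first.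
      by rewrite /sig; ring.
    by rewrite ler_wpM2r// sqr_ge0.
  by apply: lerXn2r; rewrite ?nnegrE ?(ltW Y0)// lerDl ltW.
have Yh : 2 * q%:R * h * o ^+ 2 <= Y.
  rewrite (_ : 2 * q%:R * h * o ^+ 2 = A * 4 `^ beta * th ^+ 2 * o ^+ 2); last first.
    rewrite /h; transitivity (2 * A * (q%:R * (2 * q%:R) `^ gam) * o ^+ 2); first by ring.
    by rewrite th2; field.
  by rewrite lerDr.
apply: le_trans (quad_moment xm xi0 q0 kap_gt0 sig0 h0 xmean xvar
  (fun i j hj => even_growth (xg i) hj)
  (fun i k hk => sqr_growth (ltW tau0) (xm i) (xvar i) (xg i) hk) Y0 Ysig Yh J) _.
(* The linear constant is x th^2 with x >= 1, so its root is at most x th; the final bound stays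
   linear in the growth constant. *)
have sL : Num.sqrt (linear_const q kap) <= 4 * expR 1 ^+ 3 * k0 * th.
  have x1 : 1 <= 4 * expR 1 ^+ 3 * k0.
    have e1 : 1 <= expR (1 : R) ^+ 3.
      by rewrite exprn_ege1//; apply: le_trans (expR_ge1Dx _); lra.
    nra.
  set x := 4 * expR 1 ^+ 3 * k0 in x1 *.
  rewrite -[leRHS]ger0_norm; last by apply: mulr_ge0; [lra|exact: ltW].
  rewrite -sqrtr_sqr ler_wsqrtr// LE -/x exprMn ler_wpM2r ?sqr_ge0//.
  nra.
have L0 := linear_const_ge0 q kap.
have sL0 := sqrtr_ge0 (linear_const q kap).
have W0 : 0 <= 8 * expR 1 * Y + 24 * (Num.sqrt (linear_const q kap) * o * H) +
    128 * linear_const q kap * o ^+ 2.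
  apply: addr_ge0; first apply: addr_ge0.
  - by rewrite !mulr_ge0// ltW.
  - by rewrite !mulr_ge0// ltW.
  - by apply: mulr_ge0; rewrite ?sqr_ge0// mulr_ge0.
have ineq : 8 * expR 1 * Y + 24 * (Num.sqrt (linear_const q kap) * o * H) +
    128 * linear_const q kap * o ^+ 2 <=
    quad_const * k0 * (th * o * H + (th * o) ^+ 2).
  have oH : 0 <= th * o * H by rewrite !mulr_ge0// ltW.
  have o2 : 0 <= (th * o) ^+ 2 by exact: sqr_ge0.
  apply: (@le_trans _ _ (8 * expR 1 * Y + 24 * ((4 * expR 1 ^+ 3 * k0 * th) * o * H) +
    128 * (4 * expR 1 ^+ 3 * k0 * th ^+ 2) * o ^+ 2)).
    move: sL; set sl := Num.sqrt _ => sL; rewrite LE lerD2r lerD2l ler_wpM2l//.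
    by rewrite -!(mulrA _ o H) ler_wpM2r// mulr_ge0// ltW.
  rewrite /Y /quad_const /A.
  set e := expR 1 in e0 *; set g := 4 `^ gam in p4 *; set b := 4 `^ beta in p4b *.
  set u := th * o * H in oH *; set v := (th * o) ^+ 2 in o2 *.
  rewrite [leLHS](_ : _ = (16 * e ^+ 2 * g * k0 + 96 * e ^+ 3 * k0) * u +
     (8 * e ^+ 2 * g * b * k0 + 512 * e ^+ 3 * k0) * v); last by rewrite /u /v; ring.
  have z1 : 0 <= e ^+ 2 * g * b * k0 by rewrite !mulr_ge0// ?(ltW e0) ?(ltW p4) ?(ltW p4b)//; lra.
  have z2 : 0 <= e ^+ 2 * g * k0 by rewrite !mulr_ge0// ?(ltW e0) ?(ltW p4)//; lra.
  have z3 : 0 <= e ^+ 3 * k0 by rewrite !mulr_ge0 ?exprn_ge0// ?(ltW e0)//; lra.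
  have := mulr_ge0 z1 oH; have := mulr_ge0 z2 o2; have := mulr_ge0 z3 oH; lra.
by apply: lerXn2r; rewrite ?nnegrE//; apply: le_trans ineq.
Qed.

End QuadraticFormPsi.

(** * Projections of the rows of the random matrix *)

Lemma dotp_borel (R : realType) (n : nat) (x : 'cV[R]_n) (F : set R) :
  measurable F -> @borel R n [set v | F (dotp v x)].
Proof.
pose G := [set U : set 'cV[R]_n | open U].
have h : measurable_fun setT ((fun v => dotp v x) : g_sigma_algebraType G -> R).
  apply: (measurability _ (RGenOInfty.measurableE R)) => _ [_ [c ->] <-].
  rewrite setTI; apply: sub_sigma_algebra.
  have cont : continuous (fun v : 'cV[R]_n => dotp v x).
    rewrite /dotp; apply: continuous_big.
      exact: add_continuous.
    move=> i _ v.
    apply: (@continuousM R _ (fun v : 'cV[R]_n => v i 0) (cst (x i 0)) v).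
      exact: coord_continuous.
    exact: cst_continuous.
  have -> : (fun v : 'cV[R]_n => dotp v x) @^-1` `]c, +oo[ =
      (fun v : 'cV[R]_n => dotp v x) @^-1` [set y | c < y].
    by apply/seteqP; split => v /=; rewrite in_itv /= andbT.
  rewrite /G /=; apply: open_comp; last exact: open_gt.
  by move=> v _; exact: cont.
by move=> mF; have := h measurableT F mF; rewrite setTI.
Qed.

Section RandomMatrix.
Context d (Omega : measurableType d) (R : realType) (P : probability Omega R).
Local Notation E := (Ex P).
Variables (m n : nat) (A : Omega -> 'M[R]_(m, n)) (alpha K : R).
Hypothesis A_meas : random_matrix A.
Hypothesis A_mean : zero_mean P A.
Hypothesis A_indep : independent_vectors P (row_vec A).
Hypothesis A_iso : forall i : 'I_m, isotropic P (row_vec A i).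
Hypothesis alpha_gt0 : 0 < alpha.
Hypothesis A_psi : forall i : 'I_m, (psi_norm_vec P alpha (row_vec A i) <= K%:E)%E.

Definition row_dot (x : 'cV[R]_n) (i : 'I_m) w : R := dotp (row_vec A i w) x.

Lemma row_dotE x i w : row_dot x i w = (A w *m x) i 0.
Proof. by rewrite mxE; apply: eq_bigr => j _; rewrite !mxE. Qed.

Lemma measurable_row_dot x i : measurable_fun setT (row_dot x i).
Proof.
rewrite (_ : row_dot x i = fun w => \sum_j A w i j * x j 0); last first.
  by apply/funext => w; apply: eq_bigr => j _; rewrite !mxE.
by apply: measurable_sum => j; apply: measurable_funM => //; exact: A_meas.
Qed.

Lemma Ex_indic_comp (X : Omega -> R) (F : set R) : measurable_fun setT X ->
  measurable F -> (E (fun w => \1_F (X w)))%:E = P (X @^-1` F).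
Proof.
move=> mX mF; have mXF : measurable (X @^-1` F) by rewrite -[X in measurable X]setTI; exact: mX.
have -> : (fun w => \1_F (X w)) = \1_(X @^-1` F) :> (Omega -> R).
  by apply/funext => w; rewrite !indicE; congr (_ %:R); apply/idP/idP; rewrite !inE.
rewrite -Ex_EFin; first by rewrite integral_indic// setIT.
exact: integrable_indic.
Qed.

(** By [dotp_borel], an event on the projection of a row is a Borel event on the row itself, so
    independence passes to the projections. *)
Lemma row_dot_indep x (F : 'I_m -> set R) : (forall i, measurable (F i)) ->
  E (fun w => \prod_i \1_(F i) (row_dot x i w)) =
  \prod_i E (fun w => \1_(F i) (row_dot x i w)).
Proof.
move=> mF; apply: EFin_inj.
have := A_indep [set: 'I_m]%SET (fun i => dotp_borel x (mF i)).
pose S := \bigcap_(i in [set i | i \in [set: 'I_m]%SET]) (row_dot x i @^-1` F i).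
have mS : measurable S.
  apply: fin_bigcap_measurable => // i _.
  by rewrite -[X in measurable X]setTI; exact: measurable_row_dot.
have -> : (fun w => \prod_i \1_(F i) (row_dot x i w)) = \1_S :> (Omega -> R).
  apply/funext => w; rewrite [RHS]indicE.
  have [wS|wS] := boolP (w \in S).
    rewrite big1// => i _; rewrite indicE mem_set//.
    by move: wS; rewrite inE => /(_ i); apply; rewrite /= inE.
  have /existsNP[i Fi] : ~ forall i, F i (row_dot x i w).
    by move=> h; move/negP: wS; apply; rewrite inE => i _; exact: h.
  by rewrite (bigD1 i)//= indicE memNset// mul0r.
rewrite -Ex_EFin; last exact: integrable_indic.
rewrite integral_indic// setIT.
move=> h; transitivity (P S); first by [].
rewrite [LHS]h [RHS](_ : _ = \prod_i (E (fun w => \1_(F i) (row_dot x i w)))%:E)%E; last first.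
  by elim/big_rec2 : _ => //= i a b _ <-.
apply: eq_big => [i|i _]; first by rewrite inE.
by rewrite Ex_indic_comp//; exact: measurable_row_dot.
Qed.

Let beta := alpha^-1.
Let lam : R := beta `^ beta.

(** The infimum in the psi norm need not be attained, so the admissible scale is taken below an
    arbitrary c > K. *)
Lemma psi_witness x i c : l2norm x = 1 -> K < c ->
  exists t, [/\ 0 < t, t < c, all_moments P (row_dot x i) &
    moment_growth P beta (t * lam) (row_dot x i)].
Proof.
move=> x1 Kc.
have : (psi_norm P alpha (row_dot x i) <= K%:E)%E.
  apply: le_trans (A_psi i); apply: ereal_sup_ubound.
  by exists x.
move=> h; have := le_lt_trans h (_ : (K%:E < c%:E)%E); rewrite lte_fin => /(_ Kc).
move/ereal_inf_lt => [_ [t [t0 tE] <-]]; rewrite lte_fin => tc.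
have [h1 h2] := psi_moments alpha_gt0 t0 (measurable_row_dot x i) tE.
by exists t.
Qed.

Lemma l2norm_delta (j : 'I_n) : l2norm (delta_mx j 0 : 'cV[R]_n) = 1.
Proof.
rewrite /l2norm (bigD1 j)//= mxE !eqxx expr1n big1 ?addr0 ?sqrtr1//.
by move=> k /negbTE kj; rewrite mxE kj expr0n.
Qed.

(** [psi_witness] speaks of unit vectors. The entries are the projections on basis vectors, and
    general projections inherit their moments by linearity. *)
Lemma entry_moments i j : all_moments P (fun w => A w i j).
Proof.
have K1 : K < K + 1 by rewrite ltrDl.
have [t [_ _ h _]] := psi_witness i (l2norm_delta j) K1.
move: h; rewrite (_ : row_dot _ _ = fun w => A w i j)//.
by apply/funext => w; rewrite row_dotE -colE mxE.
Qed.

Lemma row_dot_moments x i : all_moments P (row_dot x i).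
Proof.
rewrite (_ : row_dot x i = fun w => \sum_j x j 0 * A w i j); last first.
  by apply/funext => w; rewrite row_dotE mxE; apply: eq_bigr => j _; rewrite mulrC.
by apply: all_moments_sum => j _; apply: all_momentsZ; exact: entry_moments.
Qed.

Lemma row_dot_mean x i : E (row_dot x i) = 0.
Proof.
rewrite (_ : row_dot x i = fun w => \sum_j x j 0 * A w i j); last first.
  by apply/funext => w; rewrite row_dotE mxE; apply: eq_bigr => j _; rewrite mulrC.
have ie j : intg P (fun w => A w i j) by apply: all_moments_intg; exact: entry_moments.
rewrite Ex_sum => [|j _]; last exact: intgZ.
rewrite big1// => j _; rewrite ExZ// (_ : E _ = 0) ?mulr0//.
by apply: EFin_inj; rewrite -Ex_EFin//; have := A_mean i j; rewrite unlock.
Qed.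

Lemma row_dot_var x i : E (fun w => row_dot x i w ^+ 2) = l2norm x ^+ 2.
Proof.
rewrite (_ : (fun w => _) = fun w => \sum_j \sum_k (x j 0 * x k 0) * (A w i j * A w i k)); last first.
  apply/funext => w; rewrite row_dotE mxE expr2 mulr_suml; apply: eq_bigr => j _.
  by rewrite mulr_sumr; apply: eq_bigr => k _; rewrite mulrACA mulrC.
have ie j k : intg P (fun w => A w i j * A w i k).
  by apply/all_moments_intg/all_momentsM; exact: entry_moments.
have Ejk j k : E (fun w => A w i j * A w i k) = (j == k)%:R.
  apply: EFin_inj; rewrite -Ex_EFin//; have := A_iso i j k.
  rewrite unlock [X in _ = X%:E -> _]mxE => <-; apply: eq_integral => w _.
  by rewrite mxE big_ord1 !mxE.
rewrite Ex_sum => [|j _]; last by apply: intg_sum => k _; exact: intgZ.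
rewrite l2norm_sqr; apply: eq_bigr => j _.
rewrite Ex_sum => [|k _]; last exact: intgZ.
rewrite (bigD1 j)//= big1 => [|k kj]; rewrite ExZ// Ejk.
  by rewrite eqxx mulr1 addr0 expr2.
by rewrite eq_sym (negbTE kj) mulr0.
Qed.

(* Isotropy bounds K below by a constant depending on alpha only, which lets
   the final estimate trade K ^ 2 for K `^ (4 / alpha). *)
Definition K_min : R := (2 * Num.sqrt (growth_const beta lam))^-1.

Lemma growth_const_gt0 : 0 < growth_const beta lam.
Proof.
have l0 : 0 < lam by rewrite powR_gt0// invr_gt0.
by rewrite mulr_gt0 ?powR_gt0// mulr_gt0// exprn_gt0.
Qed.

Lemma growth_constZ t : growth_const beta (t * lam) = t ^+ 2 * growth_const beta lam.
Proof. by rewrite /growth_const exprMn; ring. Qed.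

Lemma K_min_lt (i : 'I_m) (x : 'cV[R]_n) : l2norm x = 1 -> K_min < K.
Proof.
move=> x1; have g0 := growth_const_gt0.
have s0 : 0 < Num.sqrt (growth_const beta lam) by rewrite sqrtr_gt0.
have k0 : 0 < K_min by rewrite invr_gt0 mulr_gt0.
(* Unit variance forces every admissible scale t to be at least 2 K_min, so t < K + K_min yields
   K_min < K. *)
have [|t [t0 tK tm tg]] := @psi_witness x i (K + K_min) x1; first by rewrite ltrDl.
have v1 : E (fun w => row_dot x i w ^+ 2) = 1 by rewrite row_dot_var x1 expr1n.
have := growth_const_ge1 v1 tg; rewrite growth_constZ => h.
have : 1 <= t * Num.sqrt (growth_const beta lam).
  rewrite -(@ler_pXn2r _ 2) ?nnegrE ?mulr_ge0 ?(ltW t0) ?(ltW s0)//.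
  by rewrite expr1n exprMn sqr_sqrtr// ltW.
rewrite -ler_pdivrMr// mul1r => h2.
have e : (Num.sqrt (growth_const beta lam))^-1 = K_min + K_min.
  by rewrite /K_min; field; rewrite lt0r_neq0.
by move: h2; rewrite e => h2; move: tK; lra.
Qed.

Lemma K_min_gt0 : 0 < K_min.
Proof. by rewrite invr_gt0 mulr_gt0// sqrtr_gt0 growth_const_gt0. Qed.

Lemma moment_growth_le tau tau' f : 0 <= tau -> tau <= tau' ->
  moment_growth P beta tau f -> moment_growth P beta tau' f.
Proof.
move=> t0 tt h r r0; apply: le_trans (h r r0) _; rewrite ler_wpM2l//.
apply: lerXn2r; rewrite ?nnegrE ?mulr_ge0 ?powR_ge0//; first exact: le_trans tt.
by rewrite ler_wpM2r// powR_ge0.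
Qed.

Variables (l : nat) (B : 'M[R]_(l, m)).
Hypothesis alpha_le2 : alpha <= 2.
Hypothesis op_gt0 : 0 < op_norm B.

Let beta_ge : 1 / 2 <= beta.
Proof. by rewrite mul1r lef_pV2 ?posrE. Qed.

(** The 4 is the square of the factor in 2K > K, the level below which the admissible scales are
    taken. *)
Definition dev2_const : R := quad_const beta * (4 * growth_const beta lam).

Lemma unit_dim_gt0 : exists i : 'I_m, true.
Proof.
case: (m) B op_gt0 => [|m'] B' o0; last by exists ord0.
have := op_norm_le_hs B'.
have -> : hs_norm B' = 0 by rewrite /hs_norm big1 ?sqrtr0// => i _; rewrite big_ord0.
by rewrite leNgt o0.
Qed.

Lemma unit_deviation_moment (q : nat) (x : 'cV[R]_n) : (0 < q)%N -> l2norm x = 1 ->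
  E (fun w => (l2norm (B *m A w *m x) ^+ 2 - hs_norm B ^+ 2) ^+ (2 * q)) <=
  (dev2_const * K ^+ 2 * (q%:R `^ beta * op_norm B * hs_norm B +
    (q%:R `^ beta * op_norm B) ^+ 2)) ^+ (2 * q).
Proof.
move=> q0 x1; have [i0 _] := unit_dim_gt0.
have K0 : 0 < K := lt_trans K_min_gt0 (K_min_lt i0 x1).
have l0 : 0 < lam by rewrite powR_gt0// invr_gt0.
have K2 : K < 2 * K by lra.
have gr i : moment_growth P beta (2 * K * lam) (row_dot x i).
  have [t [t0 tK _ tg]] := psi_witness i x1 K2.
  apply: moment_growth_le tg; first by rewrite mulr_ge0// ltW.
  by rewrite ler_wpM2r// ltW.
have v1 i : E (fun w => row_dot x i w ^+ 2) = 1 by rewrite row_dot_var x1 expr1n.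
have t0 : 0 < 2 * K * lam by rewrite !mulr_gt0.
have := quad_moment_psi beta_ge (row_dot_moments x) (row_dot_indep x) t0
  (row_dot_mean x) v1 gr (growth_const_ge1 (v1 i0) (gr i0)) q0 op_gt0 [set: 'I_m]%SET.
rewrite growth_constZ (_ : quad_const beta * _ = dev2_const * K ^+ 2); last first.
  by rewrite /dev2_const; ring.
rewrite (_ : (fun w => quad _ _ _ _ ^+ _) = fun w =>
   (l2norm (B *m A w *m x) ^+ 2 - hs_norm B ^+ 2) ^+ (2 * q))//.
apply/funext => w; congr (_ ^+ _); rewrite /quad hs_norm_sqr; congr (_ ^+ 2 - _).
  congr l2norm; rewrite -mulmxA; congr (_ *m _); apply/colP => i.
  by rewrite mxE inE row_dotE.
by apply: eq_bigl => i; rewrite inE.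
Qed.

Lemma all_moments_sqrt_sum N (f : 'I_N -> Omega -> R) : (forall i, all_moments P (f i)) ->
  all_moments P (fun w => Num.sqrt (\sum_i f i w ^+ 2)).
Proof.
move=> hf; apply: (all_moments_dom (g := fun w => 1 + \sum_i f i w ^+ 2)).
- apply: (measurableT_comp (continuous_measurable_fun (@sqrt_continuous R))).
  by apply: measurable_sum => i; apply: measurable_funX; exact: (hf i).1.
- apply: all_momentsD; first exact: all_moments_cst.
  by apply: all_moments_sum => i _; exact: all_momentsX.
move=> w; rewrite ger0_norm ?sqrtr_ge0//.
have s0 : 0 <= \sum_i f i w ^+ 2 by apply: sumr_ge0 => i _; exact: sqr_ge0.
have := sqr_sqrtr s0; have := sqrtr_ge0 (\sum_i f i w ^+ 2).
set a := Num.sqrt _; have := sqr_ge0 (a - 1); nra.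
Qed.

Lemma image_norm_moments x : all_moments P (fun w => l2norm (B *m A w *m x)).
Proof.
apply: all_moments_sqrt_sum => k.
rewrite (_ : (fun w => _) = fun w => \sum_i B k i * row_dot x i w); last first.
  by apply/funext => w; rewrite -mulmxA mxE; apply: eq_bigr => i _; rewrite row_dotE.
by apply: all_moments_sum => i _; apply: all_momentsZ; exact: row_dot_moments.
Qed.

End RandomMatrix.

(** * Increments of the deviation process *)

Section EvenMoments.
Context d (Omega : measurableType d) (R : realType) (P : probability Omega R).
Variable q : nat.
Hypothesis q0 : (0 < q)%N.
Implicit Types (f g : Omega -> R) (M N : R).

(** A bound on the L^(2q) norm, kept as a power to avoid roots. The triangle inequality is used in
    the form [even_momentD], with a factor 2. *)
Definition even_moment_le f M :=
  all_moments P f /\ Ex P (fun w => f w ^+ (2 * q)) <= M ^+ (2 * q).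

Lemma even_moment_dom f g M : measurable_fun setT f -> even_moment_le g M ->
  (forall w, `|f w| <= `|g w|) -> even_moment_le f M.
Proof.
move=> mf [gm gM] fg; have fm : all_moments P f.
  by apply: all_moments_dom fg => //; exact: all_moments_abs.
split=> //; apply: le_trans gM; apply: Ex_le => [||w]; try exact: all_moments_intgX.
rewrite !exprM -[f w ^+ 2]real_normK ?num_real// -[g w ^+ 2]real_normK ?num_real//.
by rewrite -!exprM; apply: lerXn2r; rewrite ?nnegrE.
Qed.

Lemma even_moment_abs f M : even_moment_le f M -> even_moment_le (fun w => `|f w|) M.
Proof.
move=> h; apply: (even_moment_dom _ h) => [|w]; last by rewrite normr_id.
exact: (all_moments_meas (all_moments_abs h.1)).
Qed.

Lemma even_moment_mono f M N : 0 <= M -> M <= N -> even_moment_le f M -> even_moment_le f N.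
Proof.
move=> M0 MN [fm h]; split=> //; apply: le_trans h _.
by apply: lerXn2r; rewrite ?nnegrE//; exact: le_trans MN.
Qed.

Lemma even_moment_scale f M (c : R) : even_moment_le f M ->
  even_moment_le (fun w => c * f w) (`|c| * M).
Proof.
move=> [fm h]; split; first exact: all_momentsZ.
under eq_fun do rewrite exprMn.
rewrite ExZ; last exact: all_moments_intgX.
rewrite exprMn [`|c| ^+ _]exprM real_normK ?num_real// -exprM ler_wpM2l//.
by rewrite exprM exprn_ge0// sqr_ge0.
Qed.

Lemma even_moment_cst (c : R) : even_moment_le (fun=> c) `|c|.
Proof.
split; first exact: all_moments_cst.
by rewrite Ex_cst [in leRHS]exprM real_normK ?num_real// -exprM.
Qed.

Lemma exprD_superadd (x y : R) n : 0 <= x -> 0 <= y ->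
  x ^+ n.+1 + y ^+ n.+1 <= (x + y) ^+ n.+1.
Proof.
move=> x0 y0; elim: n => [|n ih]; first by rewrite !expr1.
rewrite ![_ ^+ n.+2]exprS; apply: le_trans (ler_wpM2l (addr_ge0 x0 y0) ih).
have : 0 <= x ^+ n.+1 by rewrite exprn_ge0.
have : 0 <= y ^+ n.+1 by rewrite exprn_ge0.
set a := x ^+ _; set b := y ^+ _; nra.
Qed.

Lemma even_momentD f g M N : 0 <= M -> 0 <= N ->
  even_moment_le f M -> even_moment_le g N ->
  even_moment_le (fun w => f w + g w) (2 * (M + N)).
Proof.
move=> M0 N0 [fm fM] [gm gN]; split; first exact: all_momentsD.
have ifg : intg P (fun w => f w ^+ (2 * q) + g w ^+ (2 * q)).
  by apply: intgD; exact: all_moments_intgX.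
apply: (@le_trans _ _ (Ex P (fun w => 2 ^+ (2 * q) * (f w ^+ (2 * q) + g w ^+ (2 * q))))).
  apply: Ex_le => [||w]; [|exact: intgZ|exact: even_powD_le].
  by apply: all_moments_intgX; exact: all_momentsD.
rewrite ExZ// ExD; [|exact: all_moments_intgX..].
rewrite exprMn ler_wpM2l ?exprn_ge0//; apply: le_trans (lerD fM gN) _.
have -> : (2 * q = (2 * q).-1.+1)%N by rewrite prednK// muln_gt0.
exact: exprD_superadd.
Qed.

End EvenMoments.

Section Increments.
Context d (Omega : measurableType d) (R : realType) (P : probability Omega R).
Variables (l n : nat) (G : Omega -> 'M[R]_(l, n)) (q : nat) (a s H : R).
Hypotheses (q0 : (0 < q)%N) (a1 : 1 <= a) (s0 : 0 < s) (H0 : 0 <= H).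
Hypothesis G_moments : forall x, all_moments P (fun w => l2norm (G w *m x)).
Hypothesis G_dev : forall x, l2norm x = 1 ->
  Ex P (fun w => (l2norm (G w *m x) ^+ 2 - H ^+ 2) ^+ (2 * q)) <=
  (a * (s * H + s ^+ 2)) ^+ (2 * q).
Implicit Types x y u v : 'cV[R]_n.
Local Notation mb := (even_moment_le P q).

Definition deviation x w : R := l2norm (G w *m x) - H * l2norm x.

Lemma deviation_moments x : all_moments P (deviation x).
Proof. by apply: all_momentsB => //; exact: all_moments_cst. Qed.

Lemma normalize x : x != 0 -> l2norm ((l2norm x)^-1 *: x) = 1.
Proof.
move=> x0; have nx : l2norm x != 0 by apply: contra x0 => /eqP/l2norm0_eq0 ->.
by rewrite l2normZ ger0_norm ?invr_ge0 ?l2norm_ge0// mulVf.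
Qed.

Lemma l2norm_gt0 x : x != 0 -> 0 < l2norm x.
Proof.
move=> x0; rewrite lt_neqAle l2norm_ge0 andbT eq_sym.
by apply: contra x0 => /eqP/l2norm0_eq0 ->.
Qed.

Lemma image_normZ x (c : R) w : l2norm (G w *m (c *: x)) = `|c| * l2norm (G w *m x).
Proof. by rewrite -scalemxAr l2normZ. Qed.

Let as0 : 0 <= a * s.
Proof. by apply: mulr_ge0; [have := a1; lra|exact: ltW]. Qed.

Let W0 : 0 <= a * (s * H + s ^+ 2).
Proof.
apply: mulr_ge0; first by have := a1; lra.
by rewrite addr_ge0 ?sqr_ge0// mulr_ge0// ltW.
Qed.

Lemma sqr_deviation_moment x :
  mb (fun w => l2norm (G w *m x) ^+ 2 - H ^+ 2 * l2norm x ^+ 2)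
     (l2norm x ^+ 2 * (a * (s * H + s ^+ 2))).
Proof.
have am y : all_moments P (fun w => l2norm (G w *m y) ^+ 2 - H ^+ 2 * l2norm y ^+ 2).
  by apply: all_momentsB; [exact: all_momentsX|exact: all_moments_cst].
have [->|x0] := eqVneq x 0.
  split=> //; rewrite (_ : (fun w => _) = fun=> 0); last first.
    apply/funext => w; rewrite mulmx0 !l2norm0 expr0n/= mulr0 subrr.
    by rewrite expr0n muln_eq0/= eqn0Ngt q0.
  by rewrite Ex_cst l2norm0 expr0n/= mul0r exprn_ge0.
have nx := l2norm_gt0 x0; pose y := (l2norm x)^-1 *: x.
have y1 : l2norm y = 1 by exact: normalize.
have xy : x = l2norm x *: y by rewrite scalerA divff ?scale1r// gt_eqF.
rewrite (_ : (fun w => _) = fun w => l2norm x ^+ 2 * (l2norm (G w *m y) ^+ 2 - H ^+ 2)).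
  rewrite -{2}[l2norm x ^+ 2]ger0_norm ?sqr_ge0//; apply: even_moment_scale.
  split; last exact: G_dev.
  by have := am y; rewrite y1 expr1n mulr1.
apply/funext => w; rewrite {1}xy image_normZ ger0_norm ?l2norm_ge0//.
by rewrite exprMn; ring.
Qed.

(** Write N = |Gx|, so |N - H| (N + H) = |N^2 - H^2|. If s <= H, division by H <= N + H is
    affordable: (s H + s^2) / H <= 2 s. If H < s, then |N - H|^2 <= |N^2 - H^2| bounds the 2q-th
    moment by a q-th moment of N^2 - H^2, and s H + s^2 <= 2 s^2; here a >= 1 is used. *)
Lemma deviation_unit_moment x : l2norm x = 1 -> mb (deviation x) (2 * a * s).
Proof.
move=> x1; have dm := deviation_moments x.
have := sqr_deviation_moment x; rewrite x1 expr1n mulr1 mul1r => Qm.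
have N0 w : 0 <= l2norm (G w *m x) := l2norm_ge0 _.
have [sH|Hs] := lerP s H.
  have Hp : 0 < H by apply: lt_le_trans sH.
  have := even_moment_scale H^-1 Qm; rewrite ger0_norm ?invr_ge0// => hQ.
  apply: (even_moment_mono (M := H^-1 * (a * (s * H + s ^+ 2)))).
  - by rewrite mulr_ge0 ?invr_ge0.
  - have k : 0 <= a * s * (H - s) by apply: mulr_ge0 => //; rewrite subr_ge0.
    by rewrite ler_pdivrMl//; lra.
  apply: even_moment_dom hQ _ => [|w]; first exact: dm.1.
  rewrite normrM ger0_norm ?invr_ge0// mulrC ler_pdivlMr//.
  rewrite subr_sqr normrM /deviation x1 mulr1 ler_wpM2l//.
  by rewrite ger0_norm ?addr_ge0// lerDr.
split=> //.
have sq w : deviation x w ^+ (2 * q) <= `|l2norm (G w *m x) ^+ 2 - H ^+ 2| ^+ q.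
  rewrite exprM; apply: lerXn2r; rewrite ?nnegrE ?sqr_ge0//.
  rewrite -real_normK ?num_real// subr_sqr normrM /deviation x1 mulr1 expr2.
  rewrite ler_wpM2l// [leRHS]ger0_norm ?addr_ge0//.
  by rewrite ler_norml; apply/andP; split; have := N0 w; have := H0; lra.
have Qm2 : all_moments P (fun w => `|l2norm (G w *m x) ^+ 2 - H ^+ 2|).
  exact: all_moments_abs Qm.1.
apply: (@le_trans _ _ (Ex P (fun w => `|l2norm (G w *m x) ^+ 2 - H ^+ 2| ^+ q))).
  by apply: Ex_le => //; exact: all_moments_intgX.
have E0 : 0 <= Ex P (fun w => `|l2norm (G w *m x) ^+ 2 - H ^+ 2| ^+ q).
  by apply: Ex_ge0 => w; rewrite exprn_ge0.
have b0 : 0 <= 2 * a * s by rewrite -mulrA mulr_ge0.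
rewrite -ler_sqr ?nnegrE ?exprn_ge0//.
apply: le_trans (Ex_sqr_le (all_momentsX q Qm2)) _.
under eq_fun do rewrite -exprM mulnC exprM real_normK ?num_real// -exprM.
apply: le_trans Qm.2 _.
rewrite [leRHS](_ : _ = ((2 * a * s) ^+ 2) ^+ (2 * q)); last first.
  by rewrite -!exprM; congr (_ ^+ _); lia.
apply: lerXn2r; rewrite ?nnegrE ?sqr_ge0//.
apply: (@le_trans _ _ (a * (2 * s ^+ 2))).
  have a0 : 0 <= a by have := a1; lra.
  by rewrite ler_wpM2l//; have := s0; nra.
rewrite (_ : (2 * a * s) ^+ 2 = a * (4 * a * s ^+ 2)); last by ring.
have s2 : 0 <= s ^+ 2 by exact: sqr_ge0.
have a1' := a1; by rewrite ler_wpM2l//; [lra|nra].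
Qed.

Lemma image_norm_dist x y w :
  `|l2norm (G w *m x) - l2norm (G w *m y)| <= l2norm (G w *m (x - y)).
Proof. by rewrite mulmxBr; exact: l2norm_dist. Qed.

(** Polarization: 4 <Gu, Gv> = |G(u + v)|^2 - |G(u - v)|^2. Orthogonality makes u + v and u - v
    equally long, so the centring terms cancel; their common squared length is at most 1 + 4 = 5. *)
Lemma bilinear_moment u v : dotp u v = 0 -> l2norm u = 1 -> l2norm v <= 2 ->
  mb (fun w => dotp (G w *m u) (G w *m v)) (5 * (a * (s * H + s ^+ 2))).
Proof.
move=> uv u1 v2.
have np : l2norm (u + v) ^+ 2 = 1 + l2norm v ^+ 2.
  by rewrite -dotpp dotpDr !dotpDl !dotpp u1 (dotpC v u) uv; ring.
have nm : l2norm (u + - v) ^+ 2 = 1 + l2norm v ^+ 2.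
  by rewrite -dotpp dotpDr !dotpDl !dotpNr !dotpNl !dotpp u1 (dotpC v u) uv; ring.
have v5 : 0 <= 1 + l2norm v ^+ 2 <= 5.
  by have vn := l2norm_ge0 v; apply/andP; split; nra.
have /andP[v50 v55] := v5.
have h1 := sqr_deviation_moment (u + v); have h2 := sqr_deviation_moment (u + - v).
rewrite np in h1; rewrite nm in h2.
have c0 : 0 <= (1 + l2norm v ^+ 2) * (a * (s * H + s ^+ 2)) by rewrite mulr_ge0.
have := even_momentD q0 c0 (mulr_ge0 (normr_ge0 (-1)) c0) h1 (even_moment_scale (-1) h2).
move=> /(even_moment_scale (1 / 4 : R)).
have q4 : `|1 / 4 : R| = 1 / 4 by rewrite ger0_norm//; lra.
rewrite q4 normrN1 !mul1r.
rewrite (_ : (fun w => _) = fun w => dotp (G w *m u) (G w *m v)).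
  apply: even_moment_mono; first by rewrite mulr_ge0//; lra.
  have := ler_wpM2r W0 v55; set W := a * _; lra.
apply/funext => w; rewrite !mulmxDr mulmxN -!dotpp !dotpDr !dotpDl !dotpNr !dotpNl.
by rewrite (dotpC (G w *m v) (G w *m u)); field.
Qed.

(* While |Gx| + |Gy| >= H, dividing |Gx|^2 - |Gy|^2 = <G(x-y), G(x+y)> by that
   sum costs a factor 1/H, and x-y is orthogonal to x+y. Otherwise the
   deviations at x and y add up to at least H, and the triangle inequality is
   enough. *)
Lemma unit_increment_moment x y : l2norm x = 1 -> l2norm y = 1 ->
  mb (fun w => l2norm (G w *m x) - l2norm (G w *m y)) (64 * a * s * l2norm (x - y)).
Proof.
move=> x1 y1; set D := l2norm (x - y).
have mN : measurable_fun setT (fun w => l2norm (G w *m x) - l2norm (G w *m y)).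
  by apply: measurable_funB; apply: all_moments_meas.
have [xy|xy] := eqVneq x y.
  rewrite /D xy subrr l2norm0 mulr0 (_ : (fun w => _) = fun=> 0); last first.
    by apply/funext => w; rewrite subrr.
  by rewrite -[X in mb _ X](normr0 R); exact: even_moment_cst.
have xy0 : x - y != 0 by rewrite subr_eq0.
have D0 : 0 < D by exact: l2norm_gt0.
pose u := D^-1 *: (x - y); have u1 : l2norm u = 1 by exact: normalize.
have xyu : x - y = D *: u by rewrite scalerA divff ?scale1r// gt_eqF.
have Nu w : `|l2norm (G w *m x) - l2norm (G w *m y)| <= D * (H + deviation u w).
  apply: le_trans (image_norm_dist x y w) _; rewrite xyu image_normZ gtr0_norm//.
  by rewrite /deviation u1 mulr1 addrC subrK.
have Zu := deviation_unit_moment u1.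
have as2 : 0 <= 2 * a * s by rewrite -mulrA mulr_ge0.
(* If H < s, the bound [Nu] is enough by itself: H < s <= a s, and the deviation at [u] has size 2 a
   s. *)
have [sH|Hs] := lerP s H; last first.
  have h1 := even_momentD q0 (normr_ge0 H) as2 (even_moment_cst P q H) Zu.
  have := even_moment_scale D h1 => h2.
  apply: (even_moment_mono _ _ (even_moment_dom mN h2 _)).
  - by rewrite mulr_ge0// mulr_ge0// addr_ge0.
  - rewrite gtr0_norm// mulrC ler_wpM2r ?(ltW D0)// ger0_norm//.
    have : s <= a * s by rewrite ler_peMl// ltW.
    by lra.
  - by move=> w; apply: le_trans (Nu w) _; exact: ler_norm.
pose v := x + y; have v2 : l2norm v <= 2.
  by apply: le_trans (l2normD _ _) _; rewrite x1 y1; lra.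
have uv : dotp u v = 0.
  rewrite dotpZl /v dotpDl dotpNl !dotpDr !dotpp x1 y1 (dotpC y x).
  by rewrite (_ : _ + _ = 0) ?mulr0//; ring.
have Hp : 0 < H by apply: lt_le_trans sH.
have := even_moment_scale H^-1 (bilinear_moment uv u1 v2).
rewrite ger0_norm ?invr_ge0// => hB.
have {}hB : mb (fun w => H^-1 * dotp (G w *m u) (G w *m v)) (10 * (a * s)).
  apply: even_moment_mono hB; first by rewrite mulr_ge0 ?invr_ge0// mulr_ge0.
  have k : 0 <= a * s * (H - s) by rewrite mulr_ge0 ?subr_ge0.
  by rewrite ler_pdivrMl//; lra.
have a10 : 0 <= 10 * (a * s) by rewrite mulr_ge0.
have h1 := even_momentD q0 a10 as2 (even_moment_abs hB) (even_moment_abs (deviation_unit_moment x1)).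
have h2 := even_momentD q0 as2 as2 (even_moment_abs (deviation_unit_moment y1)) (even_moment_abs Zu).
have c1 : 0 <= 2 * (10 * (a * s) + 2 * a * s) by rewrite mulr_ge0// addr_ge0.
have c2 : 0 <= 2 * (2 * a * s + 2 * a * s) by rewrite mulr_ge0// addr_ge0.
have h3 := even_moment_scale D (even_momentD q0 c1 c2 h1 h2).
apply: (even_moment_mono _ _ (even_moment_dom mN h3 _)).
- by rewrite !mulr_ge0// addr_ge0.
- by rewrite gtr0_norm// mulrC ler_wpM2r ?(ltW D0)//; lra.
move=> w; rewrite [leRHS]ger0_norm; last first.
  by rewrite mulr_ge0 ?(ltW D0)// !addr_ge0.
have Zx := normr_ge0 (deviation x w); have Zy := normr_ge0 (deviation y w).
have Zu0 := normr_ge0 (deviation u w); have Bl := normr_ge0 (H^-1 * dotp (G w *m u) (G w *m v)).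
have Nx0 := l2norm_ge0 (G w *m x); have Ny0 := l2norm_ge0 (G w *m y).
have [NH|NH]   := lerP H (l2norm (G w *m x) + l2norm (G w *m y)).
  apply: (@le_trans _ _ (D * `|H^-1 * dotp (G w *m u) (G w *m v)|)); last first.
    by rewrite ler_pM2l//; lra.
  rewrite normrM (gtr0_norm (_ : 0 < H^-1)) ?invr_gt0// mulrCA mulrC ler_pdivlMr//.
  rewrite -(gtr0_norm D0) -normrM -dotpZl scalemxAr -xyu.
  rewrite (_ : dotp _ _ = l2norm (G w *m x) ^+ 2 - l2norm (G w *m y) ^+ 2); last first.
    rewrite /v !(mulmxBr, mulmxDr) dotpDl dotpNl !dotpDr !dotpp.
    by rewrite (dotpC (G w *m y) (G w *m x)); ring.
  by rewrite subr_sqr normrM ler_wpM2l// ger0_norm ?addr_ge0.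
apply: le_trans (Nu w) _; rewrite ler_pM2l//.
have : H <= `|deviation x w| + `|deviation y w|.
  have := ler_norm (- deviation x w); have := ler_norm (- deviation y w).
  rewrite !normrN /deviation x1 y1; lra.
have := ler_norm (deviation u w); lra.
Qed.

(** With x = |x| x' and y = |y| y', homogeneity gives Z x - Z y = |x| (Z x' - Z y') + (|x| - |y|) Z
    y', where |x| |x' - y'| <= 2 |x - y|. The constant is 260 = 2 (64 * 2 + 2). *)
Lemma increment_moment x y :
  Ex P (fun w => (deviation x w - deviation y w) ^+ (2 * q)) <=
  (260 * a * s * l2norm (x - y)) ^+ (2 * q).
Proof.
have as2 : 0 <= 2 * a * s by rewrite -mulrA mulr_ge0.
have devZ z w : z != 0 -> deviation z w = l2norm z * deviation ((l2norm z)^-1 *: z) w.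
  move=> z0; have nz := l2norm_gt0 z0; rewrite /deviation (normalize z0) image_normZ.
  by rewrite ger0_norm ?invr_ge0 ?l2norm_ge0//; field; rewrite gt_eqF.
have dev0 w : deviation 0 w = 0 by rewrite /deviation mulmx0 !l2norm0 mulr0 subrr.
have one z : z != 0 -> mb (deviation z) (l2norm z * (2 * a * s)).
  move=> z0; have := even_moment_scale (l2norm z) (deviation_unit_moment (normalize z0)).
  rewrite ger0_norm ?l2norm_ge0// (_ : (fun w => _) = deviation z)//.
  by apply/funext => w; rewrite -devZ.
have mD : measurable_fun setT (fun w => deviation x w - deviation y w).
  by apply: measurable_funB; apply: all_moments_meas; exact: deviation_moments.
suff: mb (fun w => deviation x w - deviation y w) (260 * a * s * l2norm (x - y)) by case.
have n0 := l2norm_ge0 (x - y).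
have [x0|x0] := eqVneq x 0; last have [y0|y0] := eqVneq y 0.
- have [y0|y0] := eqVneq y 0.
    rewrite x0 y0 subrr l2norm0 mulr0 (_ : (fun w => _) = fun=> 0); last first.
      by apply/funext => w; rewrite subrr.
    by rewrite -[X in mb _ X](normr0 R); exact: even_moment_cst.
  apply: (even_moment_mono _ _ (even_moment_dom mD (one y y0) _)).
  + by rewrite mulr_ge0 ?l2norm_ge0.
  + rewrite x0 sub0r l2normN mulrC ler_wpM2r ?l2norm_ge0//; lra.
  + by move=> w; rewrite x0 dev0 sub0r normrN.
- apply: (even_moment_mono _ _ (even_moment_dom mD (one x x0) _)).
  + by rewrite mulr_ge0 ?l2norm_ge0.
  + rewrite y0 subr0 mulrC ler_wpM2r ?l2norm_ge0//; lra.
  + by move=> w; rewrite y0 dev0 subr0.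
pose x' := (l2norm x)^-1 *: x; pose y' := (l2norm y)^-1 *: y.
have nx := l2norm_gt0 x0; have ny := l2norm_gt0 y0.
have h1 := even_moment_scale (l2norm x) (unit_increment_moment (normalize x0) (normalize y0)).
have h2 := even_moment_scale (l2norm x - l2norm y) (deviation_unit_moment (normalize y0)).
rewrite -/x' -/y' in h1 h2.
have c1 : 0 <= `|l2norm x| * (64 * a * s * l2norm (x' - y')).
  by rewrite mulr_ge0// mulr_ge0 ?l2norm_ge0// -mulrA mulr_ge0.
have c2 : 0 <= `|l2norm x - l2norm y| * (2 * a * s) by rewrite mulr_ge0.
have := even_momentD q0 c1 c2 h1 h2.
rewrite (_ : (fun w => _ + _) = fun w => deviation x w - deviation y w); last first.
  apply/funext => w; rewrite (devZ x w x0) (devZ y w y0) -/x' -/y' /deviation.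
  by rewrite /x' /y' !normalize//; ring.
apply: even_moment_mono; first by rewrite mulr_ge0// addr_ge0.
have d1 : l2norm x * l2norm (x' - y') <= 2 * l2norm (x - y).
  rewrite -[X in X * _]ger0_norm ?l2norm_ge0// -l2normZ.
  have -> : l2norm x *: (x' - y') = (x - y) + (l2norm y - l2norm x) *: y'.
    rewrite scalerBr scalerBl !scalerA !divff ?gt_eqF// !scale1r.
    by rewrite addrA subrK.
  apply: le_trans (l2normD _ _) _; rewrite l2normZ (normalize y0) mulr1.
  have := l2norm_dist y x; rewrite -(l2normN (y - x)) opprB; lra.
have d2 := l2norm_dist x y.
rewrite ger0_norm ?l2norm_ge0//.
have e1 := ler_wpM2l as0 d1; have e2 := ler_wpM2l as0 d2.
rewrite (_ : 2 * _ = 128 * (a * s * (l2norm x * l2norm (x' - y'))) +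
   4 * (a * s * `|l2norm x - l2norm y|)); last by ring.
lra.
Qed.

End Increments.

(** * Generic chaining *)

Section ChainingNet.
Context (R : realType) (n : nat).
Local Open Scope card_scope.
Implicit Types (T S : set 'cV[R]_n) (A : nat -> set (set 'cV[R]_n)).

Lemma pblock_memP T (D : set (set 'cV[R]_n)) x : partition D id T -> T x ->
  D (pblock D id x) /\ pblock D id x x.
Proof.
move=> [cT _ _] Tx.
have : exists S, D S /\ S x by move: Tx; rewrite -cT => -[S DS Sx]; exists S.
by move/getPex.
Qed.

Lemma pblock_uniq T (D : set (set 'cV[R]_n)) S x : partition D id T -> D S -> S x ->
  pblock D id x = S.
Proof.
move=> pT DS Sx; have Tx : T x by have [<- _ _] := pT; exists S.
have [h1 h2] := pblock_memP pT Tx.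
by have [_ tD _] := pT; apply: tD => //; exists x.
Qed.

Lemma admissible_card T A k : admissible T A -> A k #<= `I_(2 ^ (2 ^ k)).
Proof.
move=> [_ _ A0 Ak]; case: k => [|k]; last exact: Ak.
move: A0; rewrite card_eq_le => /andP[h _]; apply: card_le_trans h _.
by apply: subset_card_le => j /= /leq_trans; apply.
Qed.

Lemma l2norm_le_diameter S s t : S s -> S t ->
  ((l2norm (s - t))%:E <= diameter S)%E.
Proof. by move=> Ss St; apply: ereal_sup_ubound; exists s => //; exists t. Qed.

Lemma diameter_ge0 S x : S x -> (0 <= diameter S)%E.
Proof.
move=> Sx; apply: le_trans (l2norm_le_diameter Sx Sx).
by rewrite lee_fin l2norm_ge0.
Qed.

(** [pi k] picks one point in each cell of level k. Cells are nested, so [pi k] is unchanged by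
    first applying [pi k.+1]: a step from level k + 1 to level k is determined by its starting
    point, and at most 2^(2^(k+1)) steps occur. Since x, [pi k x] and [pi k.+1 x] all lie in the
    cell of x at level k, its diameter bounds both distances. *)
Lemma chaining_net (alpha g : R) T A : admissible T A ->
  (forall t, T t -> (\sum_(0 <= k <oo)
     (2 `^ (k%:R / alpha))%:E * diameter (pblock (A k) id t) <= g%:E)%E) ->
  exists (pi : nat -> 'cV[R]_n -> 'cV[R]_n) (rep : nat -> nat -> 'cV[R]_n),
  [/\ forall k x, T x -> T (pi k x),
      forall k x, T x -> exists2 j, (j < 2 ^ (2 ^ k))%N & pi k x = rep k j,
      forall k x, T x -> pi k (pi k.+1 x) = pi k x,
      forall N x, T x ->
        \sum_(k < N) 2 `^ (k%:R / alpha) * l2norm (pi k.+1 x - pi k x) <= g &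
      forall N x, T x ->
        \sum_(k < N) 2 `^ (k%:R / alpha) * l2norm (x - pi k x) <= g].
Proof.
move=> adm hg; have [pT refT _ _] := adm.
pose cell k x := pblock (A k) id x.
pose pi k x : 'cV[R]_n := get (cell k x).
have cellT k x : T x -> A k (cell k x) /\ cell k x x by move=> Tx; exact: pblock_memP (pT k) Tx.
have pi_cell k x : T x -> cell k x (pi k x).
  by move=> Tx; apply: getPex; exists x; exact: (cellT k x Tx).2.
have piT k x : T x -> T (pi k x).
  move=> Tx; have [<- _ _] := pT k; exists (cell k x); last exact: pi_cell.
  exact: (cellT k x Tx).1.
have cell_pi k x : T x -> cell k (pi k.+1 x) = cell k x.
  move=> Tx; have [h1 h2] := cellT k.+1 x Tx.
  have [S' AS' sub] := refT k _ h1.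
  rewrite /cell (pblock_uniq (pT k) AS' (sub _ (pi_cell _ _ Tx))).
  by rewrite (pblock_uniq (pT k) AS' (sub _ h2)).
have pi_cell1 k x : T x -> cell k x (pi k.+1 x).
  by move=> Tx; rewrite -cell_pi//; exact: (cellT k _ (piT k.+1 x Tx)).2.
have fcell k : exists f : nat -> set 'cV[R]_n, forall S, A k S -> exists2 j, (j < 2 ^ (2 ^ k))%N & S = f j.
  have /pcard_leP[f] := admissible_card k adm.
  exists (fun j => [get S | A k S /\ f S = j]) => S AS; exists (f S).
    by have := @funS _ _ _ _ f S AS.
  have [AS' fS'] : [set S' | A k S' /\ f S' = f S] [get S' | A k S' /\ f S' = f S].
    by apply: getPex; exists S.
  by apply: (@inj _ _ _ f); rewrite ?inE.
have /choice[f hf] := fcell.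
have sum_le (h : nat -> R) x : T x -> (forall k, ((h k)%:E <= diameter (cell k x))%E) ->
    forall N, \sum_(k < N) 2 `^ (k%:R / alpha) * h k <= g.
  move=> Tx hk N; rewrite -lee_fin; apply: le_trans (hg x Tx).
  have d0 k : (0 <= (2 `^ (k%:R / alpha))%:E * diameter (pblock (A k) id x))%E.
    by rewrite mule_ge0 ?lee_fin ?powR_ge0//; exact: diameter_ge0 (cellT k x Tx).2.
  apply: le_trans (nneseries_lim_ge N _); last by move=> k _ _; exact: d0.
  rewrite big_mkord -sumEFin; apply: lee_sum => k _.
  by rewrite EFinM lee_wpmul2l ?lee_fin ?powR_ge0//; exact: hk.
exists pi, (fun k j => get (f k j)); split.
- exact: piT.
- move=> k x Tx; have [j jk e] := hf k _ (cellT k x Tx).1.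
  by exists j => //; rewrite /pi e.
- by move=> k x Tx; rewrite /pi cell_pi.
- move=> N x Tx; apply: (sum_le (fun k => l2norm (pi k.+1 x - pi k x)) _ Tx) => k.
  by apply: l2norm_le_diameter; [exact: pi_cell1|exact: pi_cell].
- move=> N x Tx; apply: (sum_le (fun k => l2norm (x - pi k x)) _ Tx) => k.
  by apply: l2norm_le_diameter; [exact: (cellT k x Tx).2|exact: pi_cell].
Qed.

End ChainingNet.

Section Chaining.
Context d (Omega : measurableType d) (R : realType) (P : probability Omega R).
Local Notation E := (Ex P).
Variables (n : nat) (Z : 'cV[R]_n -> Omega -> R) (alpha Gam r g : R).
Variables (T : set 'cV[R]_n) (pi : nat -> 'cV[R]_n -> 'cV[R]_n) (rep : nat -> nat -> 'cV[R]_n).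
Hypotheses (alpha_gt0 : 0 < alpha) (Gam_gt0 : 0 < Gam).
Hypothesis Z_moments : forall x, all_moments P (Z x).
Hypothesis Z0 : forall w, Z 0 w = 0.
Hypothesis Z_lip : forall w, exists2 L, 0 <= L &
  forall x y, `|Z x w - Z y w| <= L * l2norm (x - y).
Hypothesis Z_inc : forall q x y, (0 < q)%N ->
  E (fun w => (Z x w - Z y w) ^+ (2 * q)) <=
  (Gam * q%:R `^ alpha^-1 * l2norm (x - y)) ^+ (2 * q).
Hypothesis T_rad : forall x, T x -> l2norm x <= r.
Hypothesis pi_T : forall k x, T x -> T (pi k x).
Hypothesis pi_rep : forall k x, T x -> exists2 j, (j < 2 ^ (2 ^ k))%N & pi k x = rep k j.
Hypothesis pi_pi : forall k x, T x -> pi k (pi k.+1 x) = pi k x.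
Hypothesis pi_sum : forall N x, T x ->
  \sum_(k < N) 2 `^ (k%:R / alpha) * l2norm (pi k.+1 x - pi k x) <= g.
Hypothesis pi_cvg : forall N x, T x ->
  \sum_(k < N) 2 `^ (k%:R / alpha) * l2norm (x - pi k x) <= g.

(** The weights are at least 1, so distances staying above eps from [k0] on would make the sums in
    [pi_cvg] unbounded. *)
Lemma net_dense x eps k0 : T x -> 0 < eps -> exists2 k, (k0 <= k)%N & l2norm (x - pi k x) <= eps.
Proof.
move=> Tx e0; apply: contrapT => h.
have far k : (k0 <= k)%N -> eps < l2norm (x - pi k x).
  by move=> kk; rewrite ltNge; apply/negP => le; apply: h; exists k.
pose M := (Num.truncn (g / eps)).+1.
have gM : g < M%:R * eps by rewrite -ltr_pdivrMr// truncnS_gt.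
have := pi_cvg (k0 + M) Tx; apply/negP; rewrite -ltNge; apply: lt_le_trans gM _.
rewrite -(big_mkord xpredT (fun k => 2 `^ (k%:R / alpha) * l2norm (x - pi k x))).
rewrite (big_cat_nat (n := k0))//= ?leq_addr//.
apply: ler_wpDl.
  by apply: sumr_ge0 => k _; rewrite mulr_ge0 ?powR_ge0 ?l2norm_ge0.
have -> : M%:R * eps = \sum_(k0 <= k < k0 + M) eps.
  by rewrite sumr_const_nat addKn mulr_natl.
apply: ler_sum_nat => k /andP[kk _].
apply: le_trans (ltW (far k kk)) _; rewrite ler_peMl ?l2norm_ge0//.
by rewrite -[leLHS](powRr0 2); apply: ler_powR; rewrite ?ler1n// divr_ge0// ltW.
Qed.

(* The factor [expR 2] makes the moment of order 2q at most exp(-4q), so that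
   summing over 2^q increments with q = 2^(k+1) still leaves a summable
   series. At x = y the quotient by zero is 0. *)
Definition normalized_inc (q : nat) x y w : R :=
  (Z x w - Z y w) / (expR 2 * (Gam * q%:R `^ alpha^-1 * l2norm (x - y))).

Lemma normalized_inc_moments q x y : all_moments P (normalized_inc q x y).
Proof.
rewrite /normalized_inc; under eq_fun do rewrite mulrC.
by apply: all_momentsZ; exact: all_momentsB.
Qed.

(** From |t| <= 1 + t^(2q). At distance 0 the Lipschitz property makes the left side vanish. *)
Lemma normalized_inc_le q x y w : (0 < q)%N ->
  `|Z x w - Z y w| <=
  expR 2 * Gam * q%:R `^ alpha^-1 * l2norm (x - y) * (1 + normalized_inc q x y w ^+ (2 * q)).
Proof.
move=> q0; have [L _ hL] := Z_lip w.
have [xy|xy] := eqVneq (l2norm (x - y)) 0.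
  by rewrite xy mulr0 mul0r; have := hL x y; rewrite xy mulr0.
have nxy : 0 < l2norm (x - y) by rewrite lt_neqAle eq_sym xy l2norm_ge0.
have q1 : 0 < (q%:R : R) `^ alpha^-1 by rewrite powR_gt0// ltr0n.
set D := expR 2 * Gam * q%:R `^ alpha^-1 * l2norm (x - y).
have D0 : 0 < D by rewrite !mulr_gt0// expR_gt0.
have -> : Z x w - Z y w = D * normalized_inc q x y w.
  by rewrite /normalized_inc mulrC (_ : expR 2 * _ = D) ?divfK ?gt_eqF// /D; ring.
rewrite normrM gtr0_norm// ler_pM2l//.
set t := normalized_inc q x y w.
have -> : t ^+ (2 * q) = `|t| ^+ (2 * q) by rewrite !exprM real_normK ?num_real.
have [t1|/ltW t1] := lerP `|t| 1.
  by apply: le_trans t1 _; rewrite lerDl exprn_ge0.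
apply: (@le_trans _ _ (`|t| ^+ (2 * q))); last by rewrite lerDr.
by rewrite -{1}[`|t|]expr1 ler_weXn2l// muln_gt0.
Qed.

Lemma Ex_normalized_inc q x y : (0 < q)%N ->
  E (fun w => normalized_inc q x y w ^+ (2 * q)) <= expR (- 4) ^+ q.
Proof.
move=> q0; have [xy|xy] := eqVneq (l2norm (x - y)) 0.
  rewrite (_ : (fun w => _) = fun=> 0); last first.
    by apply/funext => w; rewrite /normalized_inc xy !mulr0 invr0 mulr0 expr0n muln_eq0/= eqn0Ngt q0.
  by rewrite Ex_cst exprn_ge0// expR_ge0.
have nxy : 0 < l2norm (x - y) by rewrite lt_neqAle eq_sym xy l2norm_ge0.
have q1 : 0 < (q%:R : R) `^ alpha^-1 by rewrite powR_gt0// ltr0n.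
set D := Gam * q%:R `^ alpha^-1 * l2norm (x - y).
have D0 : 0 < D by rewrite !mulr_gt0.
rewrite (_ : (fun w => _) = fun w =>
    (expR 2 * D)^-1 ^+ (2 * q) * (Z x w - Z y w) ^+ (2 * q)); last first.
  by apply/funext => w; rewrite /normalized_inc -/D -exprMn mulrC.
rewrite ExZ; last by apply: all_moments_intgX; exact: all_momentsB.
rewrite exprVn mulrC ler_pdivrMr; last by rewrite exprn_gt0// mulr_gt0// expR_gt0.
apply: le_trans (Z_inc x y q0) _; rewrite -/D [(expR 2 * D) ^+ _]exprMn mulrA.
rewrite [expR 2 ^+ _]exprM -exprMn (_ : expR (- 4) * _ = 1) ?expr1n ?mul1r//.
by rewrite -expRM_natl -expRD (_ : - 4 + _ = 0) ?expR0//; ring.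
Qed.

Section level.
Variable k0 : nat.

(** Collects all steps from level k0 + i + 1 to level k0 + i. With q = 2^(k0+i+1) there are 2^q
    indices, each contributing the 2q-th power of a normalized increment, so one sum bounds each
    such step uniformly in x. *)
Definition level_sum i w : R := \sum_(j < 2 ^ (2 ^ (k0 + i).+1))
  normalized_inc (2 ^ (k0 + i).+1) (rep (k0 + i).+1 j) (pi (k0 + i) (rep (k0 + i).+1 j)) w
    ^+ (2 * 2 ^ (k0 + i).+1).

(** The steps from level [k0] to the origin, where the process vanishes. The order 2^(k0+1) is that
    of the first level above, so base and steps share one constant. *)
Definition base_sum w : R := \sum_(j < 2 ^ (2 ^ k0))
  normalized_inc (2 ^ k0.+1) (rep k0 j) 0 w ^+ (2 * 2 ^ k0.+1).

Definition chain_sum w : \bar R :=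
  ((base_sum w)%:E + \sum_(0 <= i <oo) (level_sum i w)%:E)%E.

Lemma level_sum_ge0 i w : 0 <= level_sum i w.
Proof. by apply: sumr_ge0 => j _; rewrite exprM exprn_ge0 ?sqr_ge0. Qed.

Lemma base_sum_ge0 w : 0 <= base_sum w.
Proof. by apply: sumr_ge0 => j _; rewrite exprM exprn_ge0 ?sqr_ge0. Qed.

Lemma chain_sum_ge0 w : (0 <= chain_sum w)%E.
Proof.
by rewrite adde_ge0 ?lee_fin ?base_sum_ge0// nneseries_ge0// => i _ _; rewrite lee_fin level_sum_ge0.
Qed.

Lemma level_sum_moments i : all_moments P (level_sum i).
Proof.
by apply: all_moments_sum => j _; apply: all_momentsX; exact: normalized_inc_moments.
Qed.

Lemma base_sum_moments : all_moments P base_sum.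
Proof.
by apply: all_moments_sum => j _; apply: all_momentsX; exact: normalized_inc_moments.
Qed.

Lemma measurable_chain_sum : measurable_fun setT chain_sum.
Proof.
apply: emeasurable_funD; first by apply/measurable_EFinP; exact: base_sum_moments.1.
apply: ge0_emeasurable_sum => i.
  by move=> w _ _; rewrite lee_fin level_sum_ge0.
by move=> _; apply/measurable_EFinP; exact: (level_sum_moments i).1.
Qed.

Lemma two_le_expR1 : 2 <= expR (1 : R).
Proof. by apply: le_trans (expR_ge1Dx 1). Qed.

(** At most 2^q <= e^q terms, each at most e^(-4q), leave e^(-3q). *)
Lemma Ex_level_bound (N q : nat) (f : 'I_N -> Omega -> R) : (0 < q)%N -> (N <= 2 ^ q)%N ->
  (forall j, all_moments P (f j)) ->
  (forall j, E (fun w => f j w ^+ (2 * q)) <= expR (- 4) ^+ q) ->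
  E (fun w => \sum_j f j w ^+ (2 * q)) <= expR (- (3 * q%:R)).
Proof.
move=> q0 Nq fm hf; rewrite Ex_sum => [|j _]; last exact: all_moments_intgX.
apply: (@le_trans _ _ (\sum_(j < N) expR (- 4) ^+ q)); first exact: ler_sum.
rewrite sumr_const card_ord -[leLHS]mulr_natl.
apply: (@le_trans _ _ (expR 1 ^+ q * expR (- 4) ^+ q)).
  rewrite ler_wpM2r ?exprn_ge0 ?expR_ge0//.
  apply: (@le_trans _ _ (2 ^+ q)); first by rewrite -natrX ler_nat.
  by apply: lerXn2r; rewrite ?nnegrE ?expR_ge0// two_le_expR1.
rewrite -exprMn -expRD -expRM_natl le_eqVlt; apply/orP; left; apply/eqP.
by congr expR; ring.
Qed.

Lemma expR_pow_half (m : nat) : expR (- m%:R) <= 1 / (2 ^ m)%:R :> R.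
Proof.
rewrite expRN mul1r natrX -[m%:R]mulr1 expRM_natl lef_pV2 ?posrE ?exprn_gt0 ?expR_gt0//.
by apply: lerXn2r; rewrite ?nnegrE ?expR_ge0// two_le_expR1.
Qed.

Lemma integral_chain_sum :
  (\int[P]_w chain_sum w <= (2 * expR (- (2 ^ k0.+1)%:R))%:E)%E.
Proof.
set e := expR (- _).
have q0 k : (0 < 2 ^ k)%N by rewrite expn_gt0.
rewrite ge0_integralD//; first last.
- apply: ge0_emeasurable_sum => i.
    by move=> w _ _; rewrite lee_fin level_sum_ge0.
  by move=> _; apply/measurable_EFinP; exact: (level_sum_moments i).1.
- by move=> w _; apply: nneseries_ge0 => i _ _; rewrite lee_fin level_sum_ge0.
- by apply/measurable_EFinP; exact: base_sum_moments.1.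
- by move=> w _; rewrite lee_fin base_sum_ge0.
rewrite integral_nneseries//; first last.
- by move=> i w _; rewrite lee_fin level_sum_ge0.
- by move=> i; apply/measurable_EFinP; exact: (level_sum_moments i).1.
rewrite Ex_EFin; last by apply: all_moments_intg; exact: base_sum_moments.
rewrite (_ : 2 * e = e + e); last by ring.
rewrite EFinD; apply: leeD.
  rewrite lee_fin; apply: le_trans (Ex_level_bound (q := 2 ^ k0.+1) _ _ _ _) _ => //.
  - by rewrite leq_exp2l// leq_exp2l.
  - by move=> j; exact: normalized_inc_moments.
  - by move=> j; exact: Ex_normalized_inc.
  - rewrite ler_expR lerN2; have : (0 : R) <= (2 ^ k0.+1)%:R by []; lra.
(* Level i contributes at most e / 2^(i+1), because 3 * 2^(k0+i+1) >= 2^(k0+1) + i + 1. *)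
apply: le_trans (epsilon_trick0 xpredT (expR_ge0 _ : 0 <= e)).
apply: lee_nneseries => [i _ _|i _].
  by apply: integral_ge0 => w _; rewrite lee_fin level_sum_ge0.
rewrite Ex_EFin; last by apply: all_moments_intg; exact: level_sum_moments.
rewrite lee_fin; apply: le_trans (Ex_level_bound (q := 2 ^ (k0 + i).+1) _ _ _ _) _ => //.
- by move=> j; exact: normalized_inc_moments.
- by move=> j; exact: Ex_normalized_inc.
apply: (@le_trans _ _ (e * expR (- i.+1%:R))).
  rewrite -expRD ler_expR -opprD lerN2 -natrD -[3]/(3%:R) -natrM ler_nat.
  have h1 : (2 ^ k0.+1 <= 2 ^ (k0 + i).+1)%N by rewrite leq_exp2l// ltnS leq_addr.
  have h2 : (i.+1 <= 2 ^ (k0 + i).+1)%N.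
    apply: leq_trans (ltnW (ltn_expl i.+1 (ltnSn 1))) _.
    by rewrite leq_exp2l// ltnS leq_addl.
  lia.
rewrite ler_wpM2l ?expR_ge0//; apply: le_trans (expR_pow_half _) _.
by rewrite mul1r.
Qed.

(** [chain_sum] dominates the normalized power of every step, so each step costs its deterministic
    size times at most 1 + W, and the sizes add up to at most [g]. The chain stops at [pi N x]; x
    itself is reached by density and the Lipschitz bound, whose constant may depend on [w]. *)
Lemma chaining_pointwise w x : T x -> (chain_sum w < +oo)%E ->
  `|Z x w| <= expR 2 * Gam * 2 `^ alpha^-1 * (2 `^ (k0%:R / alpha) * r + g) *
    (1 + fine (chain_sum w)).
Proof.
move=> Tx Wfin; set om := fine (chain_sum w).
have q0 k : (0 < 2 ^ k)%N by rewrite expn_gt0.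
have omE : om%:E = chain_sum w.
  by rewrite fineK// ge0_fin_numE// chain_sum_ge0.
have series0 : (0 <= \sum_(0 <= i <oo) (level_sum i w)%:E)%E.
  by apply: nneseries_ge0 => i _ _; rewrite lee_fin level_sum_ge0.
have om0 : 0 <= om by rewrite -lee_fin omE chain_sum_ge0.
have base_le : base_sum w <= om.
  by rewrite -lee_fin omE leeDl.
have level_le i : level_sum i w <= om.
  rewrite -lee_fin omE; apply: le_trans (leeDr _ _); last by rewrite lee_fin base_sum_ge0.
  apply: le_trans (nneseries_lim_ge i.+1 _); last by move=> k _ _; rewrite lee_fin level_sum_ge0.
  rewrite big_nat_recr//= leeDr// sume_ge0// => k _; exact: level_sum_ge0.
(* The moment growth q^(1/alpha) at q = 2^(k+1) is the weight of level k times 2^(1/alpha). *)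
have theta k : ((2 ^ k.+1)%:R : R) `^ alpha^-1 = 2 `^ alpha^-1 * 2 `^ (k%:R / alpha).
  have k1 : k.+1%:R = 1 + k%:R :> R by rewrite -natr1 addrC.
    by rewrite natrX -powR_mulrn// -powRrM k1 mulrDl mul1r powRD//; apply/implyP.
pose c := expR 2 * Gam * 2 `^ alpha^-1.
have c0 : 0 <= c by rewrite !mulr_ge0 ?expR_ge0 ?powR_ge0// ltW.
have step k : (k0 <= k)%N -> `|Z (pi k.+1 x) w - Z (pi k x) w| <=
    c * (1 + om) * (2 `^ (k%:R / alpha) * l2norm (pi k.+1 x - pi k x)).
  move=> kk; have [j jk e] := pi_rep k.+1 Tx.
  have h := normalized_inc_le (pi k.+1 x) (pi k x) w (q0 k.+1).
  apply: le_trans h _; rewrite theta.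
  rewrite (_ : _ * (1 + om) * _ = c * (2 `^ (k%:R / alpha) * l2norm (pi k.+1 x - pi k x)) * (1 + om)); last by ring.
  rewrite (_ : expR 2 * Gam * _ * _ = c * (2 `^ (k%:R / alpha) * l2norm (pi k.+1 x - pi k x))); last by rewrite /c; ring.
  rewrite ler_wpM2l//; first by rewrite mulr_ge0// mulr_ge0 ?powR_ge0 ?l2norm_ge0.
  rewrite lerD2l; apply: le_trans (level_le (k - k0)%N).
  rewrite /level_sum subnKC// (bigD1 (Ordinal jk))//= -e pi_pi// lerDl.
  by apply: sumr_ge0 => j' _; rewrite exprM exprn_ge0 ?sqr_ge0.
have base : `|Z (pi k0 x) w| <= c * (1 + om) * (2 `^ (k0%:R / alpha) * r).
  have [j jk e] := pi_rep k0 Tx.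
  have h := normalized_inc_le (pi k0 x) 0 w (q0 k0.+1).
  rewrite Z0 !subr0 theta in h; apply: le_trans h _.
  rewrite (_ : expR 2 * Gam * _ * _ = c * (2 `^ (k0%:R / alpha) * l2norm (pi k0 x))); last by rewrite /c; ring.
  rewrite [leRHS]mulrAC; apply: ler_pM.
  - by rewrite mulr_ge0// mulr_ge0 ?powR_ge0 ?l2norm_ge0.
  - by rewrite addr_ge0// exprM exprn_ge0 ?sqr_ge0.
  - by rewrite ler_wpM2l// ler_wpM2l ?powR_ge0// T_rad//; exact: pi_T.
  rewrite lerD2l; apply: le_trans base_le.
  rewrite /base_sum (bigD1 (Ordinal jk))//= -e lerDl.
  by apply: sumr_ge0 => j' _; rewrite exprM exprn_ge0 ?sqr_ge0.
have chain N : (k0 <= N)%N -> `|Z (pi N x) w| <=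
    c * (1 + om) * (2 `^ (k0%:R / alpha) * r +
    \sum_(k0 <= k < N) 2 `^ (k%:R / alpha) * l2norm (pi k.+1 x - pi k x)).
  elim: N => [|N ih].
    by rewrite leqn0 => /eqP k00; move: base; rewrite k00 big_geq// addr0.
  rewrite leq_eqVlt => /orP[/eqP <-|].
    by rewrite big_geq// addr0.
  rewrite ltnS => kN; rewrite big_nat_recr//= addrA mulrDr.
  apply: le_trans (_ : `|Z (pi N x) w| + `|Z (pi N.+1 x) w - Z (pi N x) w| <= _).
    by rewrite -[X in `|X| <= _](subrK (Z (pi N x) w)) addrC ler_normD.
  by apply: lerD; [exact: ih|exact: step].
have bound N : (k0 <= N)%N ->
    `|Z (pi N x) w| <= c * (2 `^ (k0%:R / alpha) * r + g) * (1 + om).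
  move=> kN; apply: le_trans (chain N kN) _; rewrite [leLHS]mulrAC ler_wpM2r ?addr_ge0//.
  rewrite ler_wpM2l// lerD2l; apply: le_trans (pi_sum N Tx).
  rewrite -(big_mkord xpredT (fun k => 2 `^ (k%:R / alpha) * l2norm (pi k.+1 x - pi k x))).
  rewrite [leRHS](big_cat_nat (n := k0))//= lerDr.
  by apply: sumr_ge0 => k _; rewrite mulr_ge0 ?powR_ge0 ?l2norm_ge0.
have [L L0 hL] := Z_lip w.
apply/ler_addgt0Pr => eps e0.
(* L + 1 rather than L, since L may be 0. *)
have [|k kk hk] := @net_dense x (eps / (L + 1)) k0 Tx; first by rewrite divr_gt0// ltr_wpDl.
rewrite addrC -[Z x w](subrK (Z (pi k x) w)); apply: le_trans (ler_normD _ _) _.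
apply: lerD; last exact: bound.
apply: le_trans (hL x (pi k x)) _; apply: le_trans (ler_wpM2l L0 hk) _.
rewrite mulrA ler_pdivrMr ?ltr_wpDl// mulrC ler_wpM2l ?(ltW e0)//.
by rewrite lerDl.
Qed.

End level.

Hypotheses (r_gt0 : 0 < r) (T_neq0 : T !=set0).

Definition process_sup w : \bar R := ereal_sup [set `|Z x w|%:E | x in T].

Lemma process_sup_ge0 w : (0 <= process_sup w)%E.
Proof.
have [t0 Tt0] := T_neq0; apply: (@le_trans _ _ `|Z t0 w|%:E); first by rewrite lee_fin.
by apply: ereal_sup_ubound; exists t0.
Qed.

(* The points [rep k j] in T form a countable dense subset of T. *)
Lemma measurable_process_sup : measurable_fun setT process_sup.
Proof.
have [t0 Tt0] := T_neq0.
(* [rep k j] may lie outside T when j is not the index of a cell. Such indices, and codes of no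
   pair, are sent to [t0]. *)
pose pt (N : nat) : 'cV[R]_n := if (unpickle N : option (nat * nat)) is Some (k, j)
  then (if `[< T (rep k j) >] then rep k j else t0) else t0.
have ptT N : T (pt N).
  by rewrite /pt; case: unpickle => [[k j]|]//; case: asboolP.
rewrite (_ : process_sup = fun w => esups (fun N => `|Z (pt N) w|%:E) 0); last first.
  apply/funext => w; apply/eqP; rewrite eq_le; apply/andP; split; last first.
    apply: ge_ereal_sup => _ [N _ <-]; apply: ereal_sup_ubound.
    by exists (pt N).
  apply: ge_ereal_sup => _ [x Tx <-]; apply/lee_addgt0Pr => eps e0.
  have [L L0 hL] := Z_lip w.
  have [|k _ hk] := @net_dense x (eps / (L + 1)) 0 Tx.
    by rewrite divr_gt0// ltr_wpDl.
  have [j _ e] := pi_rep k Tx.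
  apply: (@le_trans _ _ (`|Z (pi k x) w|%:E + eps%:E)%E); last first.
    apply: leeD => //; apply: ereal_sup_ubound; exists (pickle (k, j)) => //.
    by rewrite /pt pickleK e asboolT//; rewrite -e; exact: pi_T.
  rewrite -EFinD lee_fin -[Z x w](subrK (Z (pi k x) w)) [in leRHS]addrC.
  apply: le_trans (ler_normD _ _) _; rewrite lerD2r.
  apply: le_trans (hL x (pi k x)) _; apply: le_trans (ler_wpM2l L0 hk) _.
  rewrite mulrA ler_pdivrMr ?ltr_wpDl// mulrC ler_wpM2l ?(ltW e0)//.
  by rewrite lerDl.
apply: measurable_fun_esups => N; apply/measurable_EFinP.
by apply: measurableT_comp => //; exact: (Z_moments (pt N)).1.
Qed.

Let c : R := expR 2 * Gam * 2 `^ alpha^-1.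

Let c_gt0 : 0 < c.
Proof. by rewrite mulr_gt0 ?powR_gt0// mulr_gt0// expR_gt0. Qed.

Let g_ge0 : 0 <= g.
Proof. by have [t0 Tt0] := T_neq0; have := pi_sum 0 Tt0; rewrite big_ord0. Qed.

Lemma integral_process_sup :
  (\int[P]_w process_sup w <= (3 * c * (r + g))%:E)%E.
Proof.
pose K := c * (r + g).
have K0 : 0 < K by rewrite mulr_gt0// ltr_wpDr.
pose W := chain_sum 0.
have W0 w : (0 <= W w)%E by exact: chain_sum_ge0.
have mW : measurable_fun setT W by exact: measurable_chain_sum.
have dom w : (process_sup w <= K%:E * (1 + W w))%E.
  have [Wy|Wy] := leP +oo%E (W w).
    by move: Wy; rewrite leye_eq => /eqP ->; rewrite addey// gt0_muley ?lte_fin// leey.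
  apply: ge_ereal_sup => _ [x Tx <-].
  have := chaining_pointwise Tx Wy.
  rewrite mul0r powRr0 mul1r -/c -/K -lee_fin EFinM EFinD fineK//.
  by rewrite ge0_fin_numE// W0.
have m1W : measurable_fun setT (fun w => (1 + W w)%E) by apply: emeasurable_funD.
apply: (@le_trans _ _ (\int[P]_w (K%:E * (1 + W w)))%E).
  apply: ge0_le_integral => //.
  - by move=> w _; exact: process_sup_ge0.
  - exact: measurable_process_sup.
  - by apply: emeasurable_funM.
rewrite ge0_integralZl//; first last.
- by rewrite lee_fin ltW.
- by move=> w _; rewrite adde_ge0.
rewrite ge0_integralD// integral_cst//= mul1e.
rewrite [X in (X + _)%E](_ : _ = 1%E); last exact: probability_setT.
have := integral_chain_sum 0; rewrite -/W => h.
(* The expectation of W is at most 2 exp(-2) <= 2, so that of 1 + W is at most 3. *)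
apply: (@le_trans _ _ (K%:E * (1 + 2%:E))%E).
  apply: lee_wpmul2l; first by rewrite lee_fin ltW.
  apply: leeD => //; apply: le_trans h _; rewrite lee_fin.
  have : expR (- (2 ^ 1)%:R) <= 1 :> R by rewrite -[leRHS]expR0 ler_expR oppr_le0.
  lra.
by rewrite -EFinD -EFinM lee_fin /K le_eqVlt; apply/orP; left; apply/eqP; ring.
Qed.

Lemma process_sup_tail k0 :
  ((1 - 2 * expR (- (2 ^ k0.+1)%:R))%:E <=
   P [set w | process_sup w <= (2 * c * (2 `^ (k0%:R / alpha) * r + g))%:E])%E.
Proof.
set K := 2 * c * _.
pose W := chain_sum k0.
have W0 w : (0 <= W w)%E by exact: chain_sum_ge0.
have mW : measurable_fun setT W by exact: measurable_chain_sum.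
(* Off this event 1 + W <= 2, which is the leading 2 in [K]; Markov's inequality at level 1 bounds
   its probability by the expectation of W. *)
pose F := [set w | (1 <= W w)%E].
have mF : measurable F.
  by rewrite -[F]setTI; apply: emeasurable_fun_c_infty.
have PF : (P F <= (2 * expR (- (2 ^ k0.+1)%:R))%:E)%E.
  apply: le_trans (integral_chain_sum k0).
  have := @le_integral_comp_abse _ _ _ P setT measurableT W 1 id.
  rewrite mul1e setTI => h.
  apply: le_trans (le_trans (h _ _ _ _ _) _) => //.
  - rewrite le_eqVlt; apply/orP; left; apply/eqP; congr (P _); apply/seteqP.
    by split=> w /=; rewrite gee0_abs.
  - rewrite le_eqVlt; apply/orP; left; apply/eqP; apply: eq_integral => w _ /=.
    by rewrite gee0_abs.
have sub : ~` F `<=` [set w | (process_sup w <= K%:E)%E].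
  move=> w /= /negP; rewrite -ltNge => W1.
  have Wy : (W w < +oo)%E by apply: lt_trans W1 (ltry 1).
  have Wf : fine (W w) <= 1.
    by rewrite -lee_fin fineK ?ge0_fin_numE// ltW.
  apply: ge_ereal_sup => _ [x Tx <-]; rewrite lee_fin.
  apply: le_trans (chaining_pointwise Tx Wy) _.
  have s0 : 0 <= c * (2 `^ (k0%:R / alpha) * r + g).
    by rewrite mulr_ge0 ?(ltW c_gt0)// addr_ge0// mulr_ge0 ?powR_ge0// ltW.
  rewrite -/c -/(W w) /K; apply: (@le_trans _ _ (c * (2 `^ (k0%:R / alpha) * r + g) * 2)).
    by rewrite ler_wpM2l//; lra.
  by rewrite le_eqVlt; apply/orP; left; apply/eqP; ring.
have mS : measurable [set w | (process_sup w <= K%:E)%E].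
  by rewrite -[X in measurable X]setTI; apply: emeasurable_fun_infty_c => //; exact: measurable_process_sup.
apply: le_trans (le_measure P _ _ sub); rewrite ?inE//; last exact: measurableC.
have PC : P (~` F) = (1 - P F)%E := probability_setC P mF.
by rewrite [leRHS]PC EFinB; apply: leeB.
Qed.

End Chaining.

(** * Radius and chaining functional of the index set *)

Section SetFunctionals.
Context (R : realType) (n : nat).
Implicit Types (T : set 'cV[R]_n).

Lemma bounded_l2norm T : bounded_set T -> exists r : R, forall x, T x -> l2norm x <= r.
Proof.
move=> [M [_ hM]]; exists (\sum_(i < n) (M + 1)) => x Tx.
apply: le_trans (l2norm_le_sum x) _; apply: ler_sum => i _.
apply: (le_trans _ (hM (M + 1) _ x Tx)); last by rewrite ltrDl.
rewrite -[`|x|]/(mx_norm x) mx_normrE.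
exact: (le_bigmax _ (fun ij => `|x ij.1 ij.2|) (i, 0)).
Qed.

Lemma le_rad_set T x : T x -> ((l2norm x)%:E <= rad_set T)%E.
Proof. by move=> Tx; apply: ereal_sup_ubound; exists x. Qed.

Lemma talagrand_gamma_ge0 alpha T : T !=set0 -> (0 <= talagrand_gamma alpha T)%E.
Proof.
move=> [t0 Tt0]; apply: le_ereal_inf_tmp => _ [A [pT _ _ _] <-].
apply: (@le_trans _ _ (\sum_(0 <= k <oo)
  (2 `^ (k%:R / alpha))%:E * diameter (pblock (A k) id t0))%E).
  apply: nneseries_ge0 => k _ _; rewrite mule_ge0 ?lee_fin ?powR_ge0//.
  exact: diameter_ge0 (pblock_memP (pT k) Tt0).2.
by apply: ereal_sup_ubound; exists t0.
Qed.

End SetFunctionals.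

Lemma sup_dev_le0 (R : realType) l m n (B : 'M[R]_(l, m)) (A : 'M[R]_(m, n)) T :
  (forall x, T x -> l2norm (B *m A *m x) - hs_norm B * l2norm x = 0) ->
  (sup_dev B A T <= 0)%E.
Proof. by move=> h; apply: ge_ereal_sup => _ [x Tx <-]; rewrite h// normr0. Qed.

(** * The deviation process of BA over T *)

Section Deviation.
Context d (Omega : measurableType d) (R : realType) (P : probability Omega R).
Variables (m n : nat) (A : Omega -> 'M[R]_(m, n)) (alpha K : R).
Hypothesis A_meas : random_matrix A.
Hypothesis A_mean : zero_mean P A.
Hypothesis A_indep : independent_vectors P (row_vec A).
Hypothesis A_iso : forall i : 'I_m, isotropic P (row_vec A i).
Hypothesis A_psi : forall i : 'I_m, (psi_norm_vec P alpha (row_vec A i) <= K%:E)%E.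
Hypotheses (alpha_gt0 : 0 < alpha) (alpha_le2 : alpha <= 2).
Variables (l : nat) (B : 'M[R]_(l, m)) (T : set 'cV[R]_n).
Hypothesis B_gt0 : 0 < op_norm B.

(** The summand 1 secures the condition a >= 1 under which the increments were estimated. *)
Definition dev_scale : R := 1 + dev2_const alpha * K ^+ 2.

Lemma dev2_const_ge0 : 0 <= dev2_const alpha.
Proof.
by rewrite mulr_ge0 ?quad_const_ge0// mulr_ge0// ltW// growth_const_gt0.
Qed.

Lemma dev_scale_ge1 : 1 <= dev_scale.
Proof. by rewrite lerDl mulr_ge0 ?dev2_const_ge0 ?sqr_ge0. Qed.

Lemma image_increment_moment q x y : (0 < q)%N ->
  Ex P (fun w => (deviation (fun w => B *m A w) (hs_norm B) x w -
    deviation (fun w => B *m A w) (hs_norm B) y w) ^+ (2 * q)) <=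
  (260 * dev_scale * op_norm B * q%:R `^ alpha^-1 * l2norm (x - y)) ^+ (2 * q).
Proof.
move=> q0; rewrite (_ : 260 * _ * _ * _ = 260 * dev_scale * (q%:R `^ alpha^-1 * op_norm B)); last by ring.
have s0 : 0 < q%:R `^ alpha^-1 * op_norm B by rewrite mulr_gt0// powR_gt0 ?ltr0n.
apply: increment_moment => //.
- exact: dev_scale_ge1.
- exact: hs_norm_ge0.
- by move=> z; exact: (image_norm_moments A_meas alpha_gt0 A_psi).
move=> z z1; apply: le_trans (unit_deviation_moment A_meas A_mean A_indep A_iso alpha_gt0 A_psi alpha_le2 B_gt0 q0 z1) _.
have c0 : 0 <= dev2_const alpha * K ^+ 2 by rewrite mulr_ge0 ?dev2_const_ge0 ?sqr_ge0.
have w0 : 0 <= q%:R `^ alpha^-1 * op_norm B * hs_norm B + (q%:R `^ alpha^-1 * op_norm B) ^+ 2.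
  by rewrite addr_ge0 ?sqr_ge0// mulr_ge0 ?hs_norm_ge0// ltW.
apply: lerXn2r; rewrite ?nnegrE.
- by apply: mulr_ge0.
- by apply: mulr_ge0 => //; rewrite addr_ge0.
- by rewrite ler_wpM2r// lerDr.
Qed.

Hypotheses (T_neq0 : T !=set0) (T_bounded : bounded_set T).
Hypothesis T_nontrivial : exists2 x, T x & x != 0.

(** As K > K_min, 1 <= K^2 / K_min^2; as also 4/alpha >= 2, K^2 <= K^(4/alpha) / K_min^(4/alpha -
    2). *)
Lemma dev_scale_le :
  dev_scale <= (K_min alpha ^- 2 + dev2_const alpha) / K_min alpha `^ (4 / alpha - 2) *
    K `^ (4 / alpha).
Proof.
have [x Tx x0] := T_nontrivial.
have [i _] := unit_dim_gt0 B_gt0.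
have kK := K_min_lt A_meas A_iso alpha_gt0 A_psi i (normalize x0).
have k0 := K_min_gt0 alpha_gt0; have K0 := lt_trans k0 kK.
have e2 : 0 <= 4 / alpha - 2.
  by rewrite subr_ge0 ler_pdivlMr//; have := alpha_le2; lra.
have -> : K `^ (4 / alpha) = K ^+ 2 * K `^ (4 / alpha - 2).
  rewrite -powR_mulrn ?(ltW K0)// -powRD; last by rewrite (lt0r_neq0 K0) implybT.
  by congr (_ `^ _); ring.
rewrite [leRHS](_ : _ = (K_min alpha ^- 2 + dev2_const alpha) * K ^+ 2 *
   (K `^ (4 / alpha - 2) / K_min alpha `^ (4 / alpha - 2))); last by ring.
have s0 : 0 <= (K_min alpha ^- 2 + dev2_const alpha) * K ^+ 2.
  by rewrite mulr_ge0 ?sqr_ge0// addr_ge0 ?dev2_const_ge0// invr_ge0 sqr_ge0.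
apply: le_trans (ler_peMr s0 _); last first.
  by rewrite ler_pdivlMr ?powR_gt0// mul1r; apply: ge0_ler_powR; rewrite ?nnegrE ?(ltW K0) ?(ltW k0) ?(ltW kK).
rewrite mulrDl lerD2r mulrC ler_pdivlMr ?exprn_gt0// mul1r.
by apply: lerXn2r; rewrite ?nnegrE ltW.
Qed.

Lemma sup_dev_bounds : (talagrand_gamma alpha T < +oo)%E ->
  exists r g : R, [/\ rad_set T = r%:E, 0 < r &
      (g%:E <= talagrand_gamma alpha T + r%:E)%E] /\
    [/\ measurable_fun setT (fun w => sup_dev B (A w) T),
    (\int[P]_w sup_dev B (A w) T <=
      (3 * (expR 2 * (260 * dev_scale * op_norm B) * 2 `^ alpha^-1) * (r + g))%:E)%E &
    forall k0, ((1 - 2 * expR (- (2 ^ k0.+1)%:R))%:E <=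
      P [set w | sup_dev B (A w) T <=
        (2 * (expR 2 * (260 * dev_scale * op_norm B) * 2 `^ alpha^-1) *
          (2 `^ (k0%:R / alpha) * r + g))%:E])%E].
Proof.
move=> gfin; have [x0 Tx0 x0n] := T_nontrivial.
have [r0 hr0] := bounded_l2norm T_bounded.
have radr0 : (rad_set T <= r0%:E)%E.
  by apply: ge_ereal_sup => _ [x Tx <-]; rewrite lee_fin hr0.
have rad_ge0 : (0 <= rad_set T)%E.
  by apply: le_trans (le_rad_set Tx0); rewrite lee_fin l2norm_ge0.
have radfin : rad_set T \is a fin_num.
  by rewrite ge0_fin_numE//; apply: le_lt_trans radr0 (ltry _).
set r := fine (rad_set T); have radE : rad_set T = r%:E by rewrite fineK.
have T_rad x : T x -> l2norm x <= r by move=> Tx; rewrite -lee_fin -radE le_rad_set.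
have r_gt0 : 0 < r by apply: lt_le_trans (T_rad _ Tx0); exact: l2norm_gt0.
have gamma0 := talagrand_gamma_ge0 alpha T_neq0.
have gammafin : talagrand_gamma alpha T \is a fin_num by rewrite ge0_fin_numE.
(* The infimum need not be attained. An admissible sequence within [r] > 0 of it is good enough,
   since the radius occurs in the bound anyway. *)
have : (talagrand_gamma alpha T < talagrand_gamma alpha T + r%:E)%E.
  by rewrite lteDl// lte_fin.
move=> /ereal_inf_lt[y [N admN yE] ylt].
have ser0 x : T x -> (0 <= \sum_(0 <= k <oo)
    (2 `^ (k%:R / alpha))%:E * diameter (pblock (N k) id x))%E.
  move=> Tx; apply: nneseries_ge0 => k _ _; rewrite mule_ge0 ?lee_fin ?powR_ge0//.
  by have [pT _ _ _] := admN; exact: diameter_ge0 (pblock_memP (pT k) Tx).2.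
have y_ge x : T x -> (\sum_(0 <= k <oo)
    (2 `^ (k%:R / alpha))%:E * diameter (pblock (N k) id x) <= y)%E.
  by move=> Tx; rewrite -yE; apply: ereal_sup_ubound; exists x.
have yfin : y \is a fin_num.
  rewrite ge0_fin_numE; last exact: le_trans (ser0 _ Tx0) (y_ge _ Tx0).
  apply: lt_trans ylt _; rewrite -(fineK gammafin) -EFinD; exact: ltry.
have [pi [rep [piT pirep pipi pisum picvg]]] :=
  @chaining_net _ _ alpha (fine y) T N admN (fun x Tx => eq_rect _ (fun z => _ <= z)%E (y_ge x Tx) _ (esym (fineK yfin))).
pose Z := deviation (fun w => B *m A w) (hs_norm B).
have Gam_gt0 : 0 < 260 * dev_scale * op_norm B.
  have s0 : 0 < dev_scale := lt_le_trans ltr01 dev_scale_ge1.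
  by apply: mulr_gt0 B_gt0; apply: mulr_gt0 s0; rewrite ltr0n.
have Zm x : all_moments P (Z x).
  by apply: deviation_moments => {}x; exact: (image_norm_moments A_meas alpha_gt0 A_psi).
have Z0 w : Z 0 w = 0 by rewrite /Z /deviation mulmx0 !l2norm0 mulr0 subrr.
(* A crude constant depending on [w] suffices: it serves only for limits along the net and for
   points at distance 0. *)
have Zlip w : exists2 L, 0 <= L & forall x z, `|Z x w - Z z w| <= L * l2norm (x - z).
  exists (hs_norm (B *m A w) + hs_norm B); first by rewrite addr_ge0 ?hs_norm_ge0.
  move=> x z; rewrite (_ : Z x w - Z z w =
    (l2norm (B *m A w *m x) - l2norm (B *m A w *m z)) -
      hs_norm B * (l2norm x - l2norm z)); last by rewrite /Z /deviation; ring.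
  apply: le_trans (ler_normB _ _) _; rewrite mulrDl; apply: lerD.
    apply: le_trans (l2norm_dist _ _) _; rewrite -mulmxBr; exact: l2norm_mulmx_le_hs.
  by rewrite normrM ger0_norm ?hs_norm_ge0// ler_wpM2l ?hs_norm_ge0// l2norm_dist.
exists r, (fine y); split; first by split=> //; rewrite fineK// ltW.
split.
- exact: measurable_process_sup alpha_gt0 Zm Zlip piT pirep picvg T_neq0.
- exact: integral_process_sup alpha_gt0 Gam_gt0 Zm Z0 Zlip (@image_increment_moment) T_rad piT pirep pipi pisum picvg r_gt0 T_neq0.
- exact: process_sup_tail alpha_gt0 Gam_gt0 Zm Z0 Zlip (@image_increment_moment) T_rad piT pirep pipi pisum picvg r_gt0 T_neq0.
Qed.

End Deviation.

(** k is the binary logarithm, rounded down, of the integer part of u^alpha, which is positive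
    because u >= 1. *)
Lemma dyadic_level (R : realType) (alpha u : R) : 0 < alpha -> 1 <= u ->
  exists k : nat, 2 `^ (k%:R / alpha) <= u /\ u `^ alpha <= (2 ^ k.+1)%:R.
Proof.
move=> a0 u1; have u0 : 0 < u by lra.
pose t := Num.truncn (u `^ alpha); exists (trunc_log 2 t).
have ua1 : 1 <= u `^ alpha by rewrite -[leLHS](powRr0 u); apply: ler_powR => //; exact: ltW.
have t0 : (0 < t)%N by rewrite /t truncn_gt0.
have tu : t%:R <= u `^ alpha by rewrite truncn_le powR_ge0.
split; last first.
  apply: le_trans (ltW (truncnS_gt _)) _; rewrite ler_nat.
  exact: trunc_log_ltn.
have h : 2 `^ (trunc_log 2 t)%:R <= u `^ alpha :> R.
  rewrite powR_mulrn// -natrX; apply: le_trans tu; rewrite ler_nat.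
  exact: trunc_logP.
rewrite powRrM -[leRHS](powRr1 (ltW u0)) -[X in u `^ X](divff (lt0r_neq0 a0)) powRrM.
by apply: ge0_ler_powR; rewrite ?nnegrE ?powR_ge0// invr_ge0 ltW.
Qed.

Theorem theorem1p1 (R : realType) :
  exists2 C : R, 0 < C &
  forall alpha : R, 0 < alpha <= 2 ->
  exists2 Calpha : R, 0 < Calpha &
  forall (l m n : nat) (B : 'M[R]_(l, m))
    (d : measure_display) (Omega : measurableType d) (P : probability Omega R)
    (A : Omega -> 'M[R]_(m, n)) (K : R) (T : set 'cV[R]_n),
  random_matrix A ->
  zero_mean P A ->
  independent_vectors P (row_vec A) ->
  (forall i : 'I_m, isotropic P (row_vec A i)) ->
  (forall i : 'I_m, (psi_norm_vec P alpha (row_vec A i) <= K%:E)%E) ->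
  T !=set0 ->
  bounded_set T ->
  (\int[P]_w sup_dev B (A w) T <=
     (Calpha * K `^ (4 / alpha) * op_norm B)%:E * (talagrand_gamma alpha T + rad_set T))%E
  /\
  (forall u : R, 0 <= u ->
     (P [set w | sup_dev B (A w) T <=
           (Calpha * K `^ (4 / alpha) * op_norm B)%:E *
             (talagrand_gamma alpha T + u%:E * rad_set T)] >=
      (1 - C * expR (- (u `^ alpha)))%:E)%E).
Proof.
(* For u < 1 the tail bound is void as soon as C exp(-1) >= 1, which 4 satisfies; for u >= 1 the
   chaining bound has the smaller factor 2. *)
exists 4 => // alpha /andP[a0 a2].
set a3 := (K_min alpha ^- 2 + dev2_const alpha) / K_min alpha `^ (4 / alpha - 2).
have k0 : 0 < K_min alpha := K_min_gt0 a0.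
have a3_gt0 : 0 < a3.
  by rewrite divr_gt0 ?powR_gt0// ltr_pwDl ?invr_gt0 ?exprn_gt0// dev2_const_ge0.
(* With g <= gamma + r, the expectation bound 3 (r + g) is at most 6 (gamma + r). The tail bound
   asks for 2 * 2 only. *)
set Calpha := 6 * (expR 2 * 260 * 2 `^ alpha^-1 * a3).
have n0 k : 0 <= k%:R :> R by rewrite ler0n.
have C_gt0 : 0 < Calpha.
  have h1 : 0 < 2 `^ alpha^-1 :> R by rewrite powR_gt0 ?ltr0n.
  have h2 : 0 < 260 :> R by rewrite ltr0n.
  have h3 : 0 < 6 :> R by rewrite ltr0n.
  exact: mulr_gt0 h3 (mulr_gt0 (mulr_gt0 (mulr_gt0 (expR_gt0 2) h2) h1) a3_gt0).
exists Calpha => // l m n B d Omega P A K T Am A0 Ai Aiso Apsi T0 Tb.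
have gamma0 := talagrand_gamma_ge0 alpha T0.
have rad0 : (0 <= rad_set T)%E.
  by have [t0 Tt0] := T0; apply: le_trans (le_rad_set Tt0); rewrite lee_fin l2norm_ge0.
set c := Calpha * _ * _.
have c0 : 0 <= c := mulr_ge0 (mulr_ge0 (ltW C_gt0) (powR_ge0 _ _)) (op_norm_ge0 B).
(* Covers B = 0 and T reduced to the origin, where the deviation vanishes identically. Otherwise B
   has a column, so A has a row, and T yields a unit vector; together they force K > K_min > 0. *)
have trivial : (forall w, (sup_dev B (A w) T <= 0)%E) ->
  (\int[P]_w sup_dev B (A w) T <= c%:E * (talagrand_gamma alpha T + rad_set T))%E /\
  (forall u : R, 0 <= u ->
     (P [set w | sup_dev B (A w) T <= c%:E * (talagrand_gamma alpha T + u%:E * rad_set T)] >=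
      (1 - 4 * expR (- (u `^ alpha)))%:E)%E).
  move=> h; have sup0 w : sup_dev B (A w) T = 0%E.
    apply/eqP; rewrite eq_le h/=; have [t0 Tt0] := T0.
    by apply: (@le_trans _ _ (`|l2norm (B *m A w *m t0) - hs_norm B * l2norm t0|%:E));
      [rewrite lee_fin|apply: ereal_sup_ubound; exists t0].
  split.
    by rewrite integral0_eq// mule_ge0 ?lee_fin// adde_ge0.
  move=> u u0; rewrite (_ : [set w | _] = setT).
    by rewrite [leRHS]probability_setT lee_fin gerBl mulr_ge0// expR_ge0.
  apply/seteqP; split=> // w _ /=; rewrite sup0 mule_ge0 ?lee_fin// adde_ge0// mule_ge0//.
have [zB|zB] := eqVneq (op_norm B) 0.
  apply: trivial => w; apply: sup_dev_le0 => x _.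
  rewrite (op_norm0_hs zB) mul0r subr0; apply/eqP; rewrite eq_le l2norm_ge0 andbT -mulmxA.
  by apply: le_trans (l2norm_mulmx_le_hs _ _) _; rewrite (op_norm0_hs zB) mul0r.
have o_gt0 : 0 < op_norm B by rewrite lt_neqAle eq_sym zB op_norm_ge0.
have [[x Tx x0]|all0] := pselect (exists2 x, T x & x != 0); last first.
  apply: trivial => w; apply: sup_dev_le0 => x Tx.
  have -> : x = 0 by apply: contrapT => /eqP xn; apply: all0; exists x.
  by rewrite mulmx0 !l2norm0 mulr0 subrr.
have Tn : exists2 x, T x & x != 0 by exists x.
have [i _] := unit_dim_gt0 o_gt0.
have kK := K_min_lt Am Aiso a0 Apsi i (normalize x0).
have K0 : 0 < K := lt_trans k0 kK.
have c_gt0 : 0 < c := mulr_gt0 (mulr_gt0 C_gt0 (powR_gt0 _ K0)) o_gt0.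
(* An infinite gamma makes both right sides infinite, because the factor [c] is positive. *)
have [gy|gfin] := eqVneq (talagrand_gamma alpha T) +oo%E.
  split=> [|u u0].
    by rewrite gy addye ?gt0_muley ?lte_fin ?leey// gt_eqF// (lt_le_trans _ rad0).
  rewrite (_ : [set w | _] = setT).
    by rewrite [leRHS]probability_setT lee_fin gerBl mulr_ge0// expR_ge0.
  apply/seteqP; split=> // w _ /=; rewrite gy addye ?gt0_muley ?lte_fin ?leey//.
  by rewrite gt_eqF// (@lt_le_trans _ _ 0%E)// mule_ge0.
have {}gfin : (talagrand_gamma alpha T < +oo)%E by rewrite ltey.
have [r [g [[radE r0 gle] [msup intS tail]]]] :=
  sup_dev_bounds Am A0 Ai Aiso Apsi a0 a2 o_gt0 T0 Tb Tn gfin.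
have [G GE] : exists G : R, talagrand_gamma alpha T = G%:E.
  by exists (fine (talagrand_gamma alpha T)); rewrite fineK// ge0_fin_numE.
rewrite radE GE in gle intS tail gamma0 *.
rewrite -EFinD lee_fin in gle; rewrite lee_fin in gamma0.
have ds := dev_scale_le Am Aiso Apsi a0 a2 o_gt0 Tn.
set e := expR 2 * _ * _ in intS tail.
have ec : 6 * e <= c.
  rewrite /c /Calpha /e.
  rewrite [leLHS](_ : _ = 6 * (expR 2 * 260 * 2 `^ alpha^-1 * op_norm B) * dev_scale alpha K); last by ring.
  rewrite [leRHS](_ : _ = 6 * (expR 2 * 260 * 2 `^ alpha^-1 * op_norm B) * (a3 * K `^ (4 / alpha))); last by ring.
  apply: ler_wpM2l ds; apply: mulr_ge0 (n0 6) _; apply: mulr_ge0 (ltW o_gt0).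
  exact: mulr_ge0 (mulr_ge0 (expR_ge0 2) (n0 260%N)) (powR_ge0 _ _).
have e0 : 0 <= e.
  have s0 : 0 <= dev_scale alpha K := le_trans ler01 (dev_scale_ge1 K a0).
  apply: mulr_ge0; last exact: powR_ge0.
  apply: mulr_ge0; first exact: expR_ge0.
  exact: mulr_ge0 (mulr_ge0 (n0 260%N) s0) (ltW o_gt0).
split.
  apply: le_trans intS _; rewrite -EFinD -EFinM lee_fin.
  apply: (@le_trans _ _ (6 * e * (G + r))); last by rewrite ler_wpM2r// addr_ge0// ltW.
  have h : e * (r + g) <= e * (2 * (G + r)) by rewrite ler_wpM2l//; lra.
  lra.
move=> u u0.
have [u1|u1] := ltP u 1.
  apply: le_trans (measure_ge0 _ _); rewrite lee_fin subr_le0.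
  have ua : u `^ alpha <= 1.
    apply: (@le_trans _ _ (1 `^ alpha)); last by rewrite powR1.
    by apply: ge0_ler_powR; rewrite ?nnegrE ?(ltW u1)// ltW.
  have : expR (-1) <= expR (- u `^ alpha) :> R by rewrite ler_expR lerN2.
  have : (1 / 2) ^+ 2 <= expR (-1) :> R.
    rewrite (_ : -1 = - (1 / 2) + - (1 / 2)); last by lra.
    rewrite expRD -expr2; apply: lerXn2r; rewrite ?nnegrE ?expR_ge0//.
    by have := expR_ge1Dx (- (1 / 2) : R); lra.
  lra.
have [k [ku uk]] := dyadic_level a0 u1.
apply: (@le_trans _ _ (1 - 2 * expR (- (2 ^ k.+1)%:R))%:E).
  have : expR (- (2 ^ k.+1)%:R) <= expR (- u `^ alpha) by rewrite ler_expR lerN2.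
  have := expR_ge0 (- u `^ alpha); rewrite lee_fin; lra.
have msub (z : \bar R) : measurable [set w | (sup_dev B (A w) T <= z)%E].
  by rewrite -[X in measurable X]setTI; exact: emeasurable_fun_infty_c.
apply: le_trans (tail k) _; apply: le_measure; rewrite ?inE; [exact: msub|exact: msub|].
move=> w /= /le_trans; apply; rewrite (_ : (_ * _ = (c * (G + u * r))%:E)%E)// lee_fin.
have ur : r <= u * r by rewrite ler_peMl// ltW.
have h : e * (2 `^ (k%:R / alpha) * r + g) <= e * (2 * (G + u * r)).
  rewrite ler_wpM2l//; have := ler_wpM2r (ltW r0) ku; lra.
apply: (@le_trans _ _ (6 * e * (G + u * r))); last first.
  by rewrite ler_wpM2r// addr_ge0// mulr_ge0// ltW.
have : 0 <= e * (G + u * r) by rewrite mulr_ge0// addr_ge0// mulr_ge0// ltW.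
lra.
Qed.
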